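(* (Maximum Principle.) Let the standing assumptions (1)–(7) of the context hold, with $p\ge 2$ (the exponent of assumption (6)), $q=\frac{p}{p-1}$, and $\lambda>(2\omega)\vee\omega$. Let $t\ge 0$ and $x\in V'$. Consider the system $$ \begin{cases} y'(\tau)=Ay(\tau)+Bu(\tau), & \tau\ge t,\\ y(t)=x,\\ \pi'(\tau)=(\lambda-A_1^* )\pi(\tau)-g_0'(y(\tau)), & \tau\ge t,\\ \lim_{T\to+\infty}e^{(\omega-\lambda)T}\pi(T)=0,\\ -B^*\pi(\tau)\in\partial h_0(u(\tau)), & \text{for a.e. }\tau\ge t, \end{cases}\qquad (\mathrm{CO}) $$ where the differential equations are understood in the mild sense described in the context. (i) Let $(u,y)\in L^p_\lambda(t,+\infty;U)\times L^1_{loc}(t,+\infty;V')$ be an admissible pair at $(t,x)$. If there exists $\pi\in L^q_\lambda(t,+\infty;V)$ satisfying, along with $u$ and $y$, the system (CO), then $(u,y)$ is optimal at $(t,x)$. (ii) Assume further that either $p>2$ and $\lambda>0$, or $p=2$, $\lambda>0$ and $\omega<0$. Then, conversely, any pair $(u^*,y^* )$ optimal at $(t,x)$ necessarily admits a co-state $\pi\in L^q_\lambda(t,+\infty;V)$ satisfying, along with $u^*$ and $y^*$, the system (CO).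
   Context: Setting. $V,H$ are real separable Hilbert spaces, $V$ continuously embedded in $H$; $H$ is identified with its dual, $V'$ is the topological dual of $V$ (not identified with $V$), so $V\hookrightarrow H\hookrightarrow V'$. $U$ is a real separable Hilbert space identified with its dual. $\langle\cdot,\cdot\rangle$ is the duality pairing between $V$ and $V'$. The Fréchet derivative of a real function on $V'$ is regarded as a map $V'\to V$. $\Sigma_0(X)$ denotes the set of convex Fréchet differentiable functions $X\to\mathbb R$ with Lipschitz continuous derivative. $f^*$ is the convex conjugate of $f$ and $\partial f$ its (convex) subdifferential. $a\vee b=\max\{a,b\}$. Standing assumptions: (1) $A:D(A)\subset V'\to V'$ generates a strongly continuous semigroup $\{e^{\tau A}\}_{\tau\ge0}$ on $V'$ and there is $\omega\in\mathbb R$ with $|e^{\tau A}x|_{V'}\le e^{\omega\tau}|x|_{V'}$ for all $\tau\ge0$, $x\in V'$; (2) $B:U\to V'$ is linear and continuous; (3) $g_0\in\Sigma_0(V')$; (4) $h_0:U\to\mathbb R$ is convex and lower semicontinuous, and $\partial h_0$ is injective (i.e. $\partial h_0(u_1)\cap\partial h_0(u_2)=\emptyset$ if $u_1\ne u_2$); (5) $h_0^*(0)=0$ and $h_0^*\in\Sigma_0(U)$; (6) there are $a>0$, $b\in\mathbb R$, $p>1$ with $h_0(u)\ge a|u|_U^p+b$ for all $u\in U$; (7) $\lambda\in\mathbb R$, $\lambda>\omega$. $A_1^*:D(A_1^* )\subset V\to V$ is the adjoint of $A$ with respect to the duality $\langle\cdot,\cdot\rangle$; $B^*:V\to U$ is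 the adjoint of $B$. For $r\ge1$ and a Hilbert space $X$, $L^r_\lambda(t,+\infty;X)=\{u:[t,+\infty)\to X:\ \tau\mapsto u(\tau)e^{-\lambda\tau/r}\in L^r(t,+\infty;X)\}$. Control problem. For $t\ge0$, $x\in V'$, $u\in L^p_\lambda(t,+\infty;U)$, the trajectory is the mild solution of $y'=Ay+Bu$, $y(t)=x$: $y(\tau)=e^{(\tau-t)A}x+\int_t^\tau e^{(\tau-\sigma)A}Bu(\sigma)\,d\sigma$. The pair $(u,y)$ is then called admissible at $(t,x)$; it is optimal at $(t,x)$ if $u$ minimizes over $L^p_\lambda(t,+\infty;U)$ the functional $J(t,x,u)=\int_t^{+\infty}e^{-\lambda\tau}[g_0(y(\tau))+h_0(u(\tau))]\,d\tau$. The mild solution of $\pi'=(\lambda-A_1^* )\pi-g_0'(y)$ on $[t,+\infty)$ together with $\lim_{T\to+\infty}e^{(\omega-\lambda)T}\pi(T)=0$ is the function $\pi(\tau)=\int_\tau^{+\infty}e^{(A_1^*-\lambda)(\sigma-\tau)}g_0'(y(\sigma))\,d\sigma$. *)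

(* Defs.v *)
From HB Require Import structures.
From mathcomp Require Import all_boot all_order all_algebra.
From mathcomp Require Import all_classical all_reals all_analysis.

Set Implicit Arguments.
Unset Strict Implicit.
Unset Printing Implicit Defensive.

Import Order.TTheory GRing.Theory Num.Theory.
Import numFieldNormedType.Exports.

Local Open Scope classical_set_scope.
Local Open Scope ring_scope.

HB.mixin Record isHilbert (R : realType) X & CompleteNormedModule R X := {
  dot : X -> X -> R ;
  dotC : forall x y : X, dot x y = dot y x ;
  dotPl : forall (a : R) (x y z : X),
    dot (a *: x + y) z = a * dot x z + dot y z ;
  dotxx : forall x : X, dot x x = `|x| ^+ 2
}.

#[short(type="hilbertType")]
HB.structure Definition Hilbert (R : realType) :=
  {X of isHilbert R X & CompleteNormedModule R X}.

Definition separable (T : topologicalType) :=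
  exists2 Q : set T, countable Q & dense Q.

Section Dual.
Context {R : realType} {V : normedModType R}.

Definition dual_pred : {pred V -> R^o} :=
  fun f => `[< linear f /\ continuous f >].

(* V' carries the operator norm, dual_norm below. *)
Record dual := Dual { dual_fun :> V -> R^o ; _ : dual_fun \in dual_pred }.

HB.instance Definition _ := [isSub for dual_fun].
HB.instance Definition _ := [Choice of dual by <:].

Fact dual_submod_closed : submod_closed dual_pred.
Proof.
split.
  apply/asboolP; split; first by move=> a u v /=; rewrite scaler0 addr0.
  exact: cst_continuous.
move=> a f g /asboolP[fl fc] /asboolP[gl gc]; apply/asboolP; split.
  move=> b u v; rewrite /= !fctE /= fl gl !scalerDr !scalerA (mulrC b).
  by rewrite addrACA.
move=> x; apply: (@continuousD _ _ _ (a *: f) g x); last exact: gc.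
exact: (continuous_comp (fc x) (@scaler_continuous R R^o a (f x))).
Qed.

HB.instance Definition _ :=
  GRing.isSubmodClosed.Build R (V -> R^o)%type dual_pred dual_submod_closed.
HB.instance Definition _ := [SubChoice_isSubLmodule of dual by <:].

Definition dual_norm (f : dual) : R := sup [set `|f x| | x in [set x | `|x| <= 1]].

Fact dual_linear (f : dual) : linear f.
Proof. by case: f => f /= /asboolP[]. Qed.

Fact dual_continuous (f : dual) : continuous f.
Proof. by case: f => f /= /asboolP[]. Qed.

HB.instance Definition _ (f : dual) :=
  GRing.isLinear.Build R V R^o _ f (dual_linear f).

Fact dual_has_sup (f : dual) : has_sup [set `|f x| | x in [set x | `|x| <= 1]].
Proof.
split; first by exists `|f 0|, 0 => //=; rewrite normr0.
have /linear_boundedP : bounded_near f (nbhs (0 : V)).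
  by apply/linear_bounded_continuous; exact: dual_continuous.
move=> /pinfty_ex_gt0[r r0 fr]; exists r => _ [x /= x1 <-].
by apply: (le_trans (fr x)); rewrite ger_pMr.
Qed.

Fact dual_norm_ub (f : dual) x : `|f x| <= dual_norm f * `|x|.
Proof.
have [->|x0] := eqVneq x 0; first by rewrite linear0 !normr0 mulr0.
rewrite -ler_pdivrMr ?normr_gt0//.
apply: (sup_upper_bound (dual_has_sup f)).
exists (`|x|^-1 *: x); first by rewrite /= normfZV.
by rewrite linearZ /= normrM normfV normr_id mulrC.
Qed.

Fact dual_norm_lub (f : dual) c : (forall x, `|x| <= 1 -> `|f x| <= c) ->
  dual_norm f <= c.
Proof.
move=> fc; apply: ge_sup; first by case: (dual_has_sup f).
by move=> _ [x x1 <-]; exact: fc.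
Qed.

Fact dual_norm_ge0 (f : dual) : 0 <= dual_norm f.
Proof.
apply: (le_trans (normr_ge0 (f 0))).
by apply: (sup_upper_bound (dual_has_sup f)); exists 0; rewrite //= normr0.
Qed.

Fact dual_normD (f g : dual) : dual_norm (f + g) <= dual_norm f + dual_norm g.
Proof.
apply: dual_norm_lub => x x1; apply: (le_trans (ler_normD (f x) (g x))).
by apply: lerD; apply: (le_trans (dual_norm_ub _ _));
  rewrite ler_piMr ?dual_norm_ge0.
Qed.

Let dual_normZ_le (a : R) (f : dual) : dual_norm (a *: f) <= `|a| * dual_norm f.
Proof.
apply: dual_norm_lub => x x1.
rewrite [X in `|X|](_ : _ = a * f x)// normrM ler_wpM2l//.
by apply: (le_trans (dual_norm_ub _ _)); rewrite ler_piMr ?dual_norm_ge0.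
Qed.

Fact dual_normZ (a : R) (f : dual) : dual_norm (a *: f) = `|a| * dual_norm f.
Proof.
apply/eqP; rewrite eq_le dual_normZ_le /=.
have [->|a0] := eqVneq a 0; first by rewrite normr0 mul0r dual_norm_ge0.
rewrite -ler_pdivlMl ?normr_gt0// -normfV.
by have := dual_normZ_le a^-1 (a *: f); rewrite scalerA mulVf// scale1r.
Qed.

Fact dual_norm_eq0 (f : dual) : dual_norm f = 0 -> f = 0.
Proof.
move=> f0; apply/val_inj/funext => x; apply/eqP; rewrite -normr_le0.
by apply: (le_trans (dual_norm_ub f x)); rewrite f0 mul0r.
Qed.

HB.instance Definition _ :=
  Lmodule_isNormed.Build R dual dual_normD dual_normZ dual_norm_eq0.

End Dual.
Arguments dual {R} V.

(* The Lipschitz condition on the derivative is with respect to the operator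
   norm, spelled out on vectors. *)
Definition Sigma0 (R : realType) (X : normedModType R) (f : X -> R) :=
  [/\ @convex_function R X setT f,
      forall x, differentiable (f : X -> R^o) x &
      exists k : R, forall x y h : X,
        `|'d (f : X -> R^o) x h - 'd (f : X -> R^o) y h| <= k * `|x - y| * `|h| ].

Definition convex_conjugate (R : realType) (U : hilbertType R) (h : U -> R)
    (s : U) : \bar R :=
  ereal_sup [set (dot s u - h u)%:E | u in [set: U]].

Definition subdifferential (R : realType) (U : hilbertType R) (h : U -> R)
    (u : U) : set U :=
  [set s | forall w, h u + dot s (w - u) <= h w].

(* The derivative of a function on V', an element of V'', is seen as an element
   of V by reflexivity. *)
Definition is_predual_derivative (R : realType) (V : normedModType R)
    (g : dual V -> R) (dg : dual V -> V) :=
  forall x w : dual V, 'd (g : dual V -> R^o) x w = w (dg x).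

Definition C0_semigroup (R : realType) (X : normedModType R)
    (S : R -> X -> X) :=
  [/\ forall s, 0 <= s -> linear (S s) /\ continuous (S s),
      forall x, S 0 x = x,
      forall s r x, 0 <= s -> 0 <= r -> S (s + r) x = S s (S r x) &
      forall x, S h x @[h --> 0^'+] --> x ].

(* An unbounded operator is a domain D together with a map A whose values
   outside D are irrelevant. *)
Definition generates (R : realType) (X : normedModType R)
    (D : set X) (A : X -> X) (S : R -> X -> X) :=
  C0_semigroup S /\
  forall x z, (D x /\ A x = z) <->
    h^-1 *: (S h x - x) @[h --> 0^'+] --> z.

Definition is_duality_adjoint (R : realType) (V : normedModType R)
    (D : set (dual V)) (A : dual V -> dual V) (D1 : set V) (A1 : V -> V) :=
  forall v w : V, (D1 v /\ A1 v = w) <->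
    (forall x : dual V, D x -> A x v = x w).

Definition is_control_adjoint (R : realType) (V : normedModType R)
    (U : hilbertType R) (B : U -> dual V) (Bs : V -> U) :=
  forall u v, B u v = dot (Bs v) u.

Section Integration.
Context {R : realType} {X : normedModType R}.
Implicit Types (D : set R) (f : R -> X).
Local Notation mu := (@lebesgue_measure R).

Definition borel_fun D f :=
  measurable_fun D (f : R -> g_sigma_algebraType (@open X)).

(* A simple function is a finite list of pairs (E, c) standing for the sum of
   the functions equal to c on E and to 0 elsewhere. *)
Definition simple_val (s : seq (set R * X)) (r : R) : X :=
  \sum_(p <- s) (\1_(p.1) r : R) *: p.2.

Definition simple_int (s : seq (set R * X)) : X :=
  \sum_(p <- s) fine (mu p.1) *: p.2.

Definition integrable_simple D (s : seq (set R * X)) :=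
  forall p, p \in s -> [/\ measurable p.1, p.1 `<=` D & (mu p.1 < +oo)%E].

Definition is_bochner_integral D f (v : X) :=
  borel_fun D f /\
  exists s : nat -> seq (set R * X),
    [/\ forall n, integrable_simple D (s n),
        (\int[mu]_(r in D) (`|f r - simple_val (s n) r|)%:E)%E
          @[n --> \oo] --> 0%E &
        simple_int (s n) @[n --> \oo] --> v ].

(* Elements of L^r_lambda(t, +oo; X) are represented by Borel functions; their
   values outside [t, +oo[ are irrelevant. *)
Definition Lweighted (r lam t : R) f :=
  borel_fun `[t, +oo[ f /\
  (\int[mu]_(s in `[t, +oo[) (`|expR (- lam * s / r) *: f s| `^ r)%:E < +oo)%E.

Definition L1loc (t : R) f :=
  borel_fun `]t, +oo[ f /\
  forall K, K `<=` `]t, +oo[ -> compact K ->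
    (\int[mu]_(s in K) (`|f s|)%:E < +oo)%E.

End Integration.

Section Control.
Context {R : realType} {V U : hilbertType R}.
Variables (S : R -> dual V -> dual V) (B : U -> dual V).
Variables (g0 : dual V -> R) (h0 : U -> R) (lam p : R).
Implicit Types (t : R) (x : dual V) (u : R -> U) (y : R -> dual V).
Local Notation mu := (@lebesgue_measure R).

(* Integrals are relational: the Bochner integral below exists and is equal to
   y(s) - e^{(s-t)A} x. *)
Definition mild_state t x u y :=
  forall s, t <= s ->
    is_bochner_integral `[t, s] (fun r => S (s - r) (B (u r)))
      (y s - S (s - t) x).

Definition admissible t x u y := Lweighted p lam t u /\ mild_state t x u y.

(* As for every integral in the library, the value is the integral of the
   positive part minus that of the negative part, and +oo - +oo = -oo. *)
Definition cost t u y : \bar R :=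
  (\int[mu]_(s in `[t, +oo[) (expR (- lam * s) * (g0 (y s) + h0 (u s)))%:E)%E.

Definition optimal t x u y :=
  admissible t x u y /\
  forall v z, admissible t x v z -> (cost t u y <= cost t v z)%E.

Variables (S1 : R -> V -> V) (Bs : V -> U) (dg0 : dual V -> V) (omega : R).
Implicit Type pi : R -> V.

(* The integrand is exp((A1^* - lambda)(r - s)) g0'(y(r)), with S1 the semigroup
   generated by A1^*. *)
Definition mild_costate t y pi :=
  forall s, t <= s ->
    is_bochner_integral `[s, +oo[
      (fun r => expR (- lam * (r - s)) *: S1 (r - s) (dg0 (y r))) (pi s).

Definition CO t x u y pi :=
  [/\ mild_state t x u y,
      mild_costate t y pi,
      expR ((omega - lam) * T) *: pi T @[T --> +oo] --> (0 : V) &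
      {ae mu, forall s, t <= s -> subdifferential h0 (u s) (- Bs (pi s))} ].

End Control.

(* Main.v *)
(* The linear part of the system is encoded by the duality identity
     int e^(-lam s) <zeta(s), G(s)> ds = int e^(-lam s) (B^* pi(s), w(s)) ds
   between the state zeta issued from 0 with control w and the co-state pi with
   source G; it follows from Fubini's theorem and from the adjointness of the two
   semigroups.  All vector-valued integrals are handled through scalar ones.

   (i) With G = g0'(y), the gradient inequality for g0 and the subdifferential
   inequality for h0 bound the cost of any competitor from below by the cost of
   (u, y) plus a term that integrates to 0 by duality.  For lam > 0 the duality is
   used in L^2_lam.  For lam <= 0 the weighted spaces do not contain constants,
   which forces the gradients of h0^* and g0 to vanish at 0; then u, y and g0'(y)
   are in L^q_lam and the duality between L^p_lam and L^q_lam applies.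

   (ii) Let pi be the co-state of y^* and uh the gradient of h0^* at - B^* pi, which
   is in L^p_lam by coercivity of h0.  Comparing u^* with u^* + e (uh - u^* ) as e -> 0
   shows that the nonnegative Fenchel-Young gap of u^* with respect to - B^* pi
   has integral <= 0; hence it vanishes almost everywhere. *)
Require Import Defs.
From HB Require Import structures.
From mathcomp Require Import all_boot all_order all_algebra.
From mathcomp Require Import all_classical all_reals all_analysis.
From mathcomp Require Import measurable_realfun lra ring.

Set Implicit Arguments.
Unset Strict Implicit.
Unset Printing Implicit Defensive.

Import Order.TTheory GRing.Theory Num.Theory.
Import numFieldNormedType.Exports.
Local Open Scope classical_set_scope.
Local Open Scope ring_scope.

(** * Hilbert spaces and their duals *)

(** Only the generators are given as adjoint. Adjointness of the semigroups has to be derived, with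
    no growth bound on [S1] to start from: the uniform boundedness principle supplies local bounds,
    the identity is proved on the two domains and extended in one variable at a time, and the rate
    [omega] then passes to [S1] by duality. The exponent 2 used for [lam > 0] comes from
    [2 omega < lam]: this lets convolution with [e^(omega s)] act on [L^2_lam], whereas
    [p omega < lam] can fail when [omega > 0]. The gradient of [g0] has affine growth, so it stays
    in [L^2_lam], which then contains constants. A trajectory is known only through one integral
    identity per time; its measurability in time is recovered from separability, by testing against
    countably many functionals. As [g0] may be unbounded below, costs are not known to be finite and
    cannot simply be subtracted. In (ii) [h0] need not be differentiable, but its conjugate is: the
    direction of variation is read off the conjugate, and convexity of [h0] along the segment
    replaces its derivative. *)

Section HilbertTheory.
Context {R : realType} {V : hilbertType R}.
Implicit Types (x y z : V) (a : R) (f : dual V).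

Lemma dotDl x y z : dot (x + y) z = dot x z + dot y z.
Proof. by have := dotPl 1 x y z; rewrite scale1r mul1r. Qed.

Lemma dot0l z : dot 0 z = 0.
Proof. by apply: (addIr (dot 0 z)); rewrite -dotDl add0r add0r. Qed.

Lemma dotZl a x z : dot (a *: x) z = a * dot x z.
Proof. by have := dotPl a x 0 z; rewrite addr0 dot0l addr0. Qed.

Lemma dotNl x z : dot (- x) z = - dot x z.
Proof. by rewrite -scaleN1r dotZl mulN1r. Qed.

Lemma dotBl x y z : dot (x - y) z = dot x z - dot y z.
Proof. by rewrite dotDl dotNl. Qed.

Lemma dotDr x y z : dot x (y + z) = dot x y + dot x z.
Proof. by rewrite dotC dotDl !(dotC x). Qed.

Lemma dot0r x : dot x 0 = 0.
Proof. by rewrite dotC dot0l. Qed.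

Lemma dotZr a x z : dot x (a *: z) = a * dot x z.
Proof. by rewrite dotC dotZl dotC. Qed.

Lemma dotNr x z : dot x (- z) = - dot x z.
Proof. by rewrite dotC dotNl dotC. Qed.

Lemma dotBr x y z : dot x (y - z) = dot x y - dot x z.
Proof. by rewrite dotDr dotNr. Qed.

Lemma sqr_normD x y : `|x + y| ^+ 2 = `|x| ^+ 2 + 2 * dot x y + `|y| ^+ 2.
Proof. by rewrite -!dotxx dotDl !dotDr (dotC y x); lra. Qed.

Lemma CauchySchwarz x y : `|dot x y| <= `|x| * `|y|.
Proof.
have [->|y0] := eqVneq y 0; first by rewrite dot0r !normr0 mulr0.
have yp : 0 < `|y| ^+ 2 by rewrite exprn_gt0// normr_gt0.
(* The part of [x] orthogonal to [y], scaled by [|y|^2] to avoid a division. Its square norm is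
   [|y|^2 (|x|^2 |y|^2 - (dot x y)^2)]. *)
have h : 0 <= `| `|y| ^+ 2 *: x + (- dot x y) *: y| ^+ 2 by rewrite sqr_ge0.
rewrite sqr_normD dotZl dotZr !normrZ !exprMn normr_id normrN in h.
have -> : `|x| * `|y| = `| `|x| * `|y| | by rewrite ger0_norm// mulr_ge0.
rewrite -ler_sqr ?nnegrE// !real_normK ?num_real//.
rewrite real_normK ?num_real// in h.
have : 0 <= `|y| ^+ 2 * (`|x| ^+ 2 * `|y| ^+ 2 - dot x y ^+ 2) by lra.
by rewrite pmulr_rge0// subr_ge0 exprMn.
Qed.

Lemma dot_linear y : linear (fun z => dot y z : R^o).
Proof. by move=> a u v; rewrite dotDr dotZr. Qed.

Lemma linear_bound_continuous {X Y : normedModType R} (g : X -> Y) (c : R) :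
  linear g -> (forall z : X, `|g z| <= c * `|z|) -> continuous g.
Proof.
move=> gl gc.
pose G : {linear X -> Y} := HB.pack g (GRing.isLinear.Build _ _ _ _ _ gl).
apply: (@linear_bounded_continuous _ _ _ G).1.
apply/linear_boundedP.
near=> r => x; apply: (le_trans (gc x)); apply: ler_wpM2r => //.
Unshelve. all: by end_near. Qed.

Lemma dualP (g : V -> R^o) (c : R) : linear g ->
  (forall z, `|g z| <= c * `|z|) -> exists f : dual V, forall z, f z = g z.
Proof.
move=> gl gc.
have h : g \in dual_pred.
  by apply/asboolP; split=> //; exact: (linear_bound_continuous gl gc).
by exists (Dual h).
Qed.

End HilbertTheory.

Section DualTheory.
Context {R : realType} {V : normedModType R}.
Implicit Types (f g : dual V) (v : V).

Lemma dual_eqP f g : (forall v, f v = g v) -> f = g.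
Proof. by move=> fg; apply/val_inj/funext. Qed.

Lemma dual_addE f g v : (f + g) v = f v + g v. Proof. by []. Qed.
Lemma dual_subE f g v : (f - g) v = f v - g v. Proof. by []. Qed.
Lemma dual_scaleE a f v : (a *: f) v = a * f v. Proof. by []. Qed.
Lemma dual_zeroE v : (0 : dual V) v = 0. Proof. by []. Qed.

Lemma dualD f v w : f (v + w) = f v + f w. Proof. exact: linearD. Qed.
Lemma dualB f v w : f (v - w) = f v - f w. Proof. exact: linearB. Qed.
Lemma dualZ f a v : f (a *: v) = a * f v. Proof. exact: linearZ. Qed.

Lemma dual_le f v : `|f v| <= `|f| * `|v|.
Proof. exact: dual_norm_ub. Qed.

Lemma dual_norm_le f c : 0 <= c -> (forall v, `|f v| <= c * `|v|) -> `|f| <= c.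
Proof.
move=> c0 fc; apply: dual_norm_lub => v v1.
by rewrite (le_trans (fc v))// ler_piMr.
Qed.

End DualTheory.

(** * Riesz representation *)

Section Riesz.
Context {R : realType} {V : hilbertType R}.
Implicit Types (f : dual V) (v z : V).

Lemma dot_bound v z : `|(dot v z : R^o)| <= `|v| * `|z|.
Proof. exact: CauchySchwarz. Qed.

(** The Riesz isometry of V onto V'. It is a tool for transporting norming families, separability
    and reflexivity; states remain in [dual V]. *)
Definition dot_dual v : dual V := sval (cid (dualP (dot_linear v) (dot_bound v))).

Lemma dot_dualE v z : dot_dual v z = dot v z.
Proof. by rewrite /dot_dual; case: cid. Qed.

Lemma norm_dot_dual v : `|dot_dual v| = `|v|.
Proof.
apply/eqP; rewrite eq_le; apply/andP; split.
  by apply: dual_norm_le => // z; rewrite dot_dualE CauchySchwarz.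
have [->|v0] := eqVneq v 0; first by rewrite normr0.
have := dual_le (dot_dual v) v.
by rewrite dot_dualE dotxx normrX normr_id expr2 ler_pM2r// normr_gt0.
Qed.

Lemma dot_norm_le v c : 0 <= c -> (forall z, `|dot v z| <= c * `|z|) -> `|v| <= c.
Proof.
move=> c0 h; rewrite -norm_dot_dual; apply: dual_norm_le => // z.
by rewrite dot_dualE.
Qed.

Lemma dot_eqP v w : (forall z, dot v z = dot w z) -> v = w.
Proof.
move=> h; apply/eqP; rewrite -subr_eq0 -normr_le0; apply: dot_norm_le => // z.
by rewrite dotBl h subrr normr0 mul0r.
Qed.

Lemma dot_dualB v w : dot_dual (v - w) = dot_dual v - dot_dual w.
Proof. by apply: dual_eqP => z; rewrite dual_subE !dot_dualE dotBl. Qed.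

Lemma dual_separates v w : (forall f, f v = f w) -> v = w.
Proof.
move=> h; apply: dot_eqP => z; have := h (dot_dual z).
by rewrite !dot_dualE !(dotC z).
Qed.

(** The functionals [dot_dual z], of norm [|z|], already detect the norm of [v], so no Hahn-Banach
    extension is involved. *)
Lemma predual_norm_le v c : 0 <= c -> (forall f, `|f v| <= c * `|f|) -> `|v| <= c.
Proof.
move=> c0 h; apply: dot_norm_le => // z.
by rewrite dotC -dot_dualE -(norm_dot_dual z).
Qed.

Lemma vanishing_seq : exists d : nat -> R, (forall n, 0 < d n) /\
  forall e, 0 < e -> exists N : nat, forall n, (N <= n)%N -> d n <= e.
Proof.
exists (fun n => n.+1%:R^-1); split=> [n|e e0]; first by rewrite invr_gt0.
exists (Num.truncn e^-1) => n Nn.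
rewrite -[leRHS]invrK lef_pV2 ?posrE ?invr_gt0//.
by rewrite (le_trans (ltW (truncnS_gt _)))// ler_nat.
Qed.

Lemma cvgn_cauchy {X : completeNormedModType R} (u : nat -> X) :
  (forall e, 0 < e -> exists N : nat, forall m n, (N <= m)%N -> (N <= n)%N ->
    `|u m - u n| <= e) -> cvgn u.
Proof.
move=> h; apply/cauchy_cvgP/cauchy_ballP => e e0.
have [N hN] := h (e / 2) ltac:(by rewrite divr_gt0).
near_simpl.
near=> m n => /=; rewrite -ball_normE /=.
apply: (@le_lt_trans _ _ (e / 2)); last by rewrite ltr_pdivrMr// ltr_pMr// ltr1n.
by apply: hN; [near: m|near: n]; exact: nbhs_infty_ge.
Unshelve. all: by end_near. Qed.

(* The minimizer of |v|^2/2 - f v; minimizing sequences are Cauchy by the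
   parallelogram identity. *)
Lemma riesz_ex f : exists v, forall z, f z = dot v z.
Proof.
pose I (v : V) : R := `|v| ^+ 2 / 2 - f v.
have Ilb v : - (`|f| ^+ 2 / 2) <= I v.
  have := dual_le f v; rewrite ler_norml => /andP[_ h].
  rewrite /I; have := sqr_ge0 (`|v| - `|f|); nra.
pose E : set R := range I.
have hE : has_inf E.
  by split; [exists (I 0), 0|exists (- (`|f| ^+ 2 / 2)) => _ [v _ <-]].
have Einf v : inf E <= I v by apply: ge_inf; [exact: hE.2|exists v].
have [d [dp hd]] := vanishing_seq.
have /choice[u hu] : forall n : nat, exists v, I v < inf E + d n.
  move=> n; have := @inf_adherent _ E (d n) (dp n) hE.
  by move=> [_ [v _ <-] ?]; exists v.
have uC m n : `|u m - u n| ^+ 2 <= 4 * (d m + d n).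
  have := Einf (2^-1 *: (u m + u n)); have := hu m; have := hu n.
  rewrite /I dualZ dualD normrZ exprMn ger0_norm ?invr_ge0//.
  rewrite !sqr_normD dotNr normrN.
  lra.
have ucv : cvgn u.
  apply: cvgn_cauchy => e e0.
  have [N hN] := hd (e ^+ 2 / 8) ltac:(by rewrite divr_gt0// exprn_gt0).
  exists N => m n Nm Nn; rewrite -ler_sqr ?nnegrE// ?(ltW e0)//.
  have := uC m n; have := hN _ Nm; have := hN _ Nn; lra.
exists (limn u) => z; set v := limn u.
(* First variation at the minimizer: [I (u n + s z)] is at least [inf E], hence more than
   [I (u n) - d n]. The margin [e] pays for [d n] and for replacing [u n] by its limit. *)
have key s : 0 <= s * (dot v z - f z) + s ^+ 2 * `|z| ^+ 2 / 2.
  apply/ler_addgt0Pr => e e0.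
  have cz : 0 < e / (2 * (`|s| * `|z| + 1)).
    by rewrite divr_gt0// mulr_gt0// ltr_wpDl// mulr_ge0.
  have [N1 hN1] := hd (e / 2) ltac:(by rewrite divr_gt0).
  have [N2 _ hN2] := (@cvgrPdist_le _ _ _ _ _ _ v).1 ucv _ cz.
  pose n := maxn N1 N2.
  have := hN1 n (leq_maxl _ _); have := hN2 n (leq_maxr _ _) => /= h1 h2.
  have := Einf (u n + s *: z); have := hu n.
  rewrite /I sqr_normD dualD dualZ dotZr normrZ exprMn real_normK ?num_real//.
  have h3 : `|s * dot (v - u n) z| <= e / 2.
    rewrite normrM (le_trans (ler_wpM2l _ (CauchySchwarz _ _)))//.
    rewrite mulrCA (le_trans (ler_wpM2r _ h1)) ?mulr_ge0//.
    have W0 : 0 <= `|s| * `|z| by rewrite mulr_ge0.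
    move: (`|s| * `|z|) W0 => W W0.
    rewrite (_ : e / _ * _ = e / 2 * (W / (W + 1))); last by field; lra.
    apply: ler_piMr; first by rewrite divr_ge0// ltW.
    by rewrite ler_pdivrMr ?ltr_wpDl// mul1r lerDl.
  rewrite dotBl in h3; move: h3; rewrite ler_norml => /andP[h3 _]; lra.
suff : dot v z - f z = 0 by move/eqP; rewrite subr_eq0 => /eqP.
set D := dot v z - f z in key *; set Z := `|z| ^+ 2 in key.
have Z0 : 0 <= Z by exact: sqr_ge0.
(* The minimizing [s] would be [- D / Z]; adding 1 covers [z = 0] and still leaves a negative
   multiple of [D ^+ 2]. *)
have := key (- D / (Z + 1)).
have Z1 : 0 < Z + 1 by lra.
have -> : - D / (Z + 1) * D + (- D / (Z + 1)) ^+ 2 * Z / 2 =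
  - (D ^+ 2 * (Z / 2 + 1) / (Z + 1) ^+ 2) by field; rewrite gt_eqF.
rewrite oppr_ge0 => h.
have : D ^+ 2 * (Z / 2 + 1) <= 0.
  by move: h; rewrite ler_pdivrMr ?exprn_gt0// mul0r.
move=> h'; have := sqr_ge0 D => d0.
have : D ^+ 2 = 0 by nra.
by move/eqP; rewrite sqrf_eq0 => /eqP.
Qed.

Definition riesz f : V := sval (cid (riesz_ex f)).

Lemma rieszE f z : dot (riesz f) z = f z.
Proof. by rewrite /riesz; case: cid. Qed.

Lemma rieszK f : dot_dual (riesz f) = f.
Proof. by apply: dual_eqP => z; rewrite dot_dualE rieszE. Qed.

Lemma separable_dual : separable V -> separable (dual V).
Proof.
move=> [Q cQ dQ]; exists (dot_dual @` Q).
  exact: (sub_countable (card_image_le _ _)).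
move=> O O0 oO; have [f Of] := O0.
have dc : continuous dot_dual.
  move=> v; apply/cvgrPdist_le => e e0.
  near=> w; rewrite -dot_dualB norm_dot_dual.
  by near: w; exact: cvgr_dist_le.
have := dQ (dot_dual @^-1` O).
case.
- by exists (riesz f); rewrite /= rieszK.
- by apply: open_comp => // v _; exact: dc.
move=> v [Ov Qv]; exists (dot_dual v); split => //; by exists v.
Unshelve. all: by end_near. Qed.

End Riesz.

(** * Strongly continuous semigroups and adjoints *)

Section Semigroup.
Context {R : realType} {X : normedModType R}.
Variable S : R -> X -> X.
Hypothesis SC : C0_semigroup S.
Implicit Types (x y : X) (s r : R).

Lemma sg_linear s : 0 <= s -> linear (S s).
Proof. by case: SC => h _ _ _ /h[]. Qed.

Lemma sg_continuous s : 0 <= s -> continuous (S s).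
Proof. by case: SC => h _ _ _ /h[]. Qed.

Lemma sgD s x y : 0 <= s -> S s (x + y) = S s x + S s y.
Proof. by move=> s0; have := sg_linear s0 1 x y; rewrite !scale1r. Qed.

Lemma sg0 s : 0 <= s -> S s 0 = 0.
Proof.
by move=> s0; have := sgD 0 0 s0; rewrite addr0 => /(canLR (addrK _)); rewrite subrr.
Qed.

Lemma sgZ s a x : 0 <= s -> S s (a *: x) = a *: S s x.
Proof. by move=> s0; have := sg_linear s0 a x 0; rewrite !(sg0 s0) !addr0. Qed.

Lemma sgB s x y : 0 <= s -> S s (x - y) = S s x - S s y.
Proof. by move=> s0; rewrite -scaleN1r sgD// sgZ// scaleN1r. Qed.

Lemma sg_id x : S 0 x = x. Proof. by case: SC. Qed.

Lemma sg_add s r x : 0 <= s -> 0 <= r -> S (s + r) x = S s (S r x).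
Proof. by case: SC => _ _ + _; exact. Qed.

Lemma sg_right x e : 0 < e ->
  exists2 d, 0 < d & forall h, 0 <= h <= d -> `|S h x - x| <= e.
Proof.
move=> e0; case: SC => _ _ _ /(_ x)/cvgrPdist_le/(_ _ e0) [d /= d0 hd].
exists (d / 2); first by rewrite divr_gt0.
move=> h /andP[]; rewrite le_eqVlt => /predU1P[<- _|h0 hd2].
  by rewrite sg_id subrr normr0 ltW.
rewrite distrC; apply: hd => //=; rewrite sub0r normrN gtr0_norm//.
by rewrite (le_lt_trans hd2)// ltr_pdivrMr// ltr_pMr// ltr1n.
Qed.

Lemma linear_continuous_bounded {Y : normedModType R} (g : X -> Y) :
  linear g -> continuous g -> exists2 r, 0 < r & forall x, `|g x| <= r * `|x|.
Proof.
move=> gl gc.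
pose G : {linear X -> Y} := HB.pack g (GRing.isLinear.Build _ _ _ _ _ gl).
have /linear_boundedP/pinfty_ex_gt0[r r0 hr] : bounded_near G (nbhs (0 : X)).
  exact/linear_bounded_continuous.
by exists r.
Qed.

(** [S s] commutes with the difference quotients at [x] and, being continuous, carries their limit
    along. *)
Lemma sg_generator_invariant D A x s : generates D A S -> 0 <= s -> D x ->
  D (S s x) /\ A (S s x) = S s (A x).
Proof.
move=> [_ gA] s0 Dx; apply/gA.
have hx : h^-1 *: (S h x - x) @[h --> 0^'+] --> A x by apply/gA.
have := cvg_comp _ _ hx (@sg_continuous _ s0 (A x)).
apply: cvg_trans; apply: near_eq_cvg; near=> h.
have h0 : 0 <= h by near: h; exact: nbhs_right_ge.
rewrite /= (sgZ _ _ s0) (sgB _ _ s0) -(sg_add _ s0 h0) -(sg_add _ h0 s0).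
by rewrite (addrC s).
Unshelve. all: by end_near. Qed.

Lemma sg_difference D A x e : generates D A S -> D x -> 0 < e ->
  exists2 d, 0 < d &
    forall h, 0 < h <= d -> `|S h x - x - h *: A x| <= e * h.
Proof.
move=> [_ gA] Dx e0.
have : h^-1 *: (S h x - x) @[h --> 0^'+] --> A x by apply/gA.
move=> /cvgrPdist_le/(_ _ e0) [d /= d0 hd].
exists (d / 2); first by rewrite divr_gt0.
move=> h /andP[h0 hd2].
have /(hd h)/(_ h0) : ball 0 d h.
  rewrite /ball /= sub0r normrN gtr0_norm// (le_lt_trans hd2)//.
  by rewrite ltr_pdivrMr// ltr_pMr// ltr1n.
rewrite distrC -(ler_pM2r h0); apply: le_trans.
rewrite -[X in _ * X](gtr0_norm h0) mulrC -normrZ scalerBr scalerA.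
by rewrite divff ?scale1r// gt_eqF.
Qed.

End Semigroup.

(** * Local boundedness of a strongly continuous semigroup *)

Section LocalBound.
Context {R : realType} {X : completeNormedModType R}.
Variable S : R -> X -> X.
Hypothesis SC : C0_semigroup S.

(** Uniform boundedness principle. Otherwise there are times [s n] tending to 0 and vectors of the
    unit ball sent beyond [n + 1], although each orbit is bounded along [s n] by strong continuity
    at 0. This serves [S1], for which no growth estimate is available before adjointness. *)
Lemma sg_bounded_near0 : exists d M : R, [/\ 0 < d, 1 <= M &
  forall s x, 0 <= s <= d -> `|S s x| <= M * `|x|].
Proof.
apply: contrapT => /forallNP noM.
have [d [dp hd]] := @vanishing_seq R.
have /choice[s hs] : forall n : nat, exists s, 0 <= s <= d n /\
    exists x, n%:R + 1 < `|S s x| /\ `|x| <= 1.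
  move=> n; apply: contrapT => /forallNP h; have /forallNP := noM (d n).
  move=> /(_ (n%:R + 1)); apply; split => //; first by rewrite lerDr.
  move=> s x sd; have [->|x0] := eqVneq x 0.
    by rewrite (sg0 SC) ?normr0 ?mulr0//; case/andP: sd.
  have s0 : 0 <= s by case/andP: sd.
  rewrite leNgt; apply/negP => hx; apply: (h s); split => //.
  exists (`|x|^-1 *: x); split; last by rewrite normfZV.
  rewrite (sgZ SC)// normrZ normfV normr_id mulrC ltr_pdivlMr ?normr_gt0//.
have [] := @Banach_Steinhauss _ X X (range (fun n => S (s n))) _ _ 1.
- move=> _ [n _ <-]; have [/andP[s0 _] _] := hs n.
  split; last exact: (sg_linear SC).
  have [r r0 hr] := linear_continuous_bounded (sg_linear SC s0)
    (sg_continuous SC s0).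
  move=> k; exists (r * k) => x xk; rewrite (le_trans (hr x))// ler_pM2l//.
- move=> x; have [e e0 he] := sg_right SC x ltr01.
  have [N hN] := hd _ e0.
  exists (`|x| + 1 + \sum_(i < N) `|S (s i) x|) => _ [n _ <-].
  have [/andP[s0 sn] _] := hs n.
  have [nN|nN] := ltnP n N.
    rewrite (bigD1 (Ordinal nN))//= ler_wpDl ?addr_ge0//.
    by rewrite ler_wpDr ?sumr_ge0.
  rewrite ler_wpDr ?sumr_ge0//.
  rewrite -[X in `|X|](subrK x) (le_trans (ler_normD _ _))// addrC lerD2l.
  by apply: he; rewrite s0 (le_trans sn)// hN.
move=> M hM.
have [_ [x [h x1]]] := hs (Num.truncn M).
have := hM _ (ex_intro2 _ _ (Num.truncn M) Logic.I erefl) x x1.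
rewrite leNgt => /negP; apply; apply: lt_trans h.
by have := truncnS_gt M; rewrite -natr1.
Qed.

Lemma sg_bounded T : exists2 M : R, 1 <= M &
  forall s x, 0 <= s <= T -> `|S s x| <= M * `|x|.
Proof.
have [d [M [d0 M1 hM]]] := sg_bounded_near0.
have M0 : 0 <= M by apply: le_trans M1.
have key n : forall s x, 0 <= s <= n%:R * d -> `|S s x| <= M ^+ n * `|x|.
  elim: n => [|n IH] s x /andP[s0 sn].
    have -> : s = 0 by apply/eqP; rewrite eq_le s0 andbT (le_trans sn)// mul0r.
    by rewrite (sg_id SC) expr0 mul1r.
  have [sd|sd] := leP s d.
    rewrite (le_trans (hM _ _ _)) ?s0//.
    by rewrite ler_wpM2r// ler_eXnr.
  have sd0 : 0 <= s - d by rewrite subr_ge0 ltW.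
  rewrite -(subrK d s) (sg_add SC)// ?(ltW d0)//.
  rewrite (le_trans (IH _ _ _))//.
    by move: sn; rewrite sd0 lerBlDr -natr1 mulrDl mul1r.
  by rewrite exprSr -mulrA ler_wpM2l ?exprn_ge0// hM// (ltW d0) lexx.
(* This many steps of length [d] cover [[0, T]]. *)
exists (M ^+ (Num.truncn (T / d)).+1); first exact: exprn_ege1.
move=> s x /andP[s0 sT]; apply: key; rewrite s0/= (le_trans sT)//.
by rewrite -ler_pdivrMr// ltW// truncnS_gt.
Qed.

End LocalBound.

Section Reflexivity.
Context {R : realType} {V : hilbertType R}.

Lemma dot_dualD (v w : V) : dot_dual (v + w) = dot_dual v + dot_dual w.
Proof. by apply: dual_eqP => z; rewrite dual_addE !dot_dualE dotDl. Qed.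

Lemma dot_dualZ a (v : V) : dot_dual (a *: v) = a *: dot_dual v.
Proof. by apply: dual_eqP => z; rewrite dual_scaleE !dot_dualE dotZl. Qed.

(** Pull [F] back to V by the Riesz map and represent it there. This is how a weakly defined
    integral of a V-valued function becomes a vector of V. *)
Lemma reflexive (F : dual V -> R^o) (c : R) : linear F ->
  (forall x, `|F x| <= c * `|x|) -> exists v, forall x : dual V, F x = x v.
Proof.
move=> Fl Fc.
have [f fE] : exists f : dual V, forall w, f w = F (dot_dual w).
  apply: (@dualP _ _ (F \o dot_dual) c) => [a u w /=|w /=].
    by rewrite dot_dualD dot_dualZ Fl.
  by rewrite -norm_dot_dual.
by exists (riesz f) => x; rewrite -{1}(rieszK x) -fE -rieszE dotC rieszE.
Qed.

End Reflexivity.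

(** * Joint continuity in time and vector *)

Section JointContinuity.
Context {R : realType} {X : normedModType R}.
Variable S : R -> X -> X.
Hypothesis SC : C0_semigroup S.
Hypothesis Sbnd : forall T, exists2 M : R, 1 <= M &
  forall s x, 0 <= s <= T -> `|S s x| <= M * `|x|.

Lemma sg_orbit_le T M x a b : (forall s x, 0 <= s <= T -> `|S s x| <= M * `|x|) ->
  0 <= a <= T -> 0 <= b <= T -> `|S a x - S b x| <= M * `|S `|a - b| x - x|.
Proof.
move=> hM; wlog ab : a b / b <= a => [W|].
  by have [/W//|/ltW/W h] := leP b a; move=> aT bT; rewrite distrC (distrC a) h.
move=> /andP[a0 aT] /andP[b0 bT].
rewrite ger0_norm ?subr_ge0//.
have -> : S a x = S b (S (a - b) x).
  by rewrite -(sg_add SC) ?subr_ge0// addrC subrK.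
by rewrite -(sgB SC)// hM// b0.
Qed.

(** The absolute value reflects negative times, so that the map is continuous on a whole product
    space and can be composed, without restriction to nonnegative times, in measurability
    arguments. *)
Lemma sg_joint_continuous : continuous (fun p : R * X => S `|p.1| p.2).
Proof.
move=> [a0 x0]; apply/cvgrPdist_le => e e0 /=.
have [M M1 hM] := Sbnd (`|a0| + 1).
have M0 : 0 < M by apply: lt_le_trans M1.
have e2 : 0 < e / (2 * M) by rewrite divr_gt0// mulr_gt0.
have [d d0 hd] := sg_right SC x0 e2.
have dd0 : 0 < Num.min d 1 by rewrite lt_min d0 ltr01.
exists (ball a0 (Num.min d 1), ball x0 (e / (2 * M))) => /=.
  by split; apply: nbhsx_ballx.
move=> [a x] [/=]; rewrite -!ball_normE/= lt_min => /andP[ad a1] xe.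
have aT : 0 <= `|a| <= `|a0| + 1.
  rewrite normr_ge0/= -lerBlDl; apply/ltW/(le_lt_trans _ a1).
  by rewrite distrC lerB_dist.
have a0T : 0 <= `|a0| <= `|a0| + 1 by rewrite normr_ge0/= lerDl.
rewrite -[_ - _](subrKA (S `|a| x0)) (splitr e) (le_trans (ler_normD _ _))//.
have Mh : M * (e / (2 * M)) = e / 2 by field; rewrite gt_eqF.
apply: lerD.
  rewrite -Mh (le_trans (sg_orbit_le x0 hM a0T aT))// ler_pM2l// hd// normr_ge0/=.
  by rewrite (le_trans (ler_dist_dist _ _))// ltW.
by rewrite -(sgB SC)// -Mh (le_trans (hM _ _ aT))// ler_pM2l// ltW.
Qed.

End JointContinuity.

Lemma itv_integrable_cst (R : realType) (a b c : R) :
  (@lebesgue_measure R).-integrable `[a, b] (EFin \o (fun=> c)).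
Proof.
apply: continuous_compact_integrable; first exact: segment_compact.
by apply: continuous_subspaceT => x; exact: cvg_cst.
Qed.

Lemma growth_locally_bounded (R : realType) (X : normedModType R)
    (S : R -> X -> X) (omega : R) :
  (forall (s : R) (x : X), 0 <= s -> `|S s x| <= expR (omega * s) * `|x|) ->
  forall T : R, exists2 M : R, 1 <= M &
  forall s x, 0 <= s <= T -> `|S s x| <= M * `|x|.
Proof.
move=> growth T.
exists (expR (`|omega| * `|T|)); first by rewrite -expR0 ler_expR mulr_ge0.
move=> s x /andP[s0 sT]; rewrite (le_trans (growth _ _ s0))// ler_wpM2r//.
rewrite ler_expR (le_trans (ler_wpM2r s0 (ler_norm _)))// ler_wpM2l//.
by rewrite (le_trans sT)// ler_norm.
Qed.

(** * From adjoint generators to adjoint semigroups *)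

Section Adjoint.
Context {R : realType} {V : hilbertType R}.
Variables (D : set (dual V)) (A : dual V -> dual V) (S : R -> dual V -> dual V).
Variables (omega : R) (D1 : set V) (A1 : V -> V) (S1 : R -> V -> V).
Hypothesis genA : generates D A S.
Hypothesis growth : forall (s : R) (x : dual V), 0 <= s ->
  `|S s x| <= expR (omega * s) * `|x|.
Hypothesis A1P : is_duality_adjoint D A D1 A1.
Hypothesis genA1 : generates D1 A1 S1.
Local Notation mu := (@lebesgue_measure R).

Let SC : C0_semigroup S := genA.1.
Let S1C : C0_semigroup S1 := genA1.1.

(* Telescoping S(kh)x (S1(T - kh)v) over k: by adjointness of the generators the
   increments are o(h), uniformly in k. *)
Lemma adjoint_on_domains (T : R) (x : dual V) (v : V) :
  0 <= T -> D x -> D1 v -> S T x v = x (S1 T v).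
Proof.
move=> T0 Dx Dv.
have [K K1 hK] := growth_locally_bounded growth T.
have [M M1 hM] := sg_bounded S1C T.
have K0 : 0 <= K by apply: le_trans K1.
have M0 : 0 <= M by apply: le_trans M1.
pose C := K * M * (`|v| + `|x|).
have C0 : 0 <= C by rewrite !mulr_ge0// addr_ge0.
suff key (e : R) : 0 < e -> `|S T x v - x (S1 T v)| <= T * C * e.
  apply/eqP; rewrite -subr_eq0 -normr_le0; apply/ler_addgt0Pr => e e0.
  rewrite add0r (le_trans (key (e / (T * C + 1)) _))//.
    by rewrite divr_gt0// ltr_wpDl// mulr_ge0.
  have TC : 0 <= T * C by rewrite mulr_ge0.
  rewrite mulrCA ler_piMr ?(ltW e0)// ler_pdivrMr ?ltr_wpDl//.
  by rewrite mul1r lerDl.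
move=> e0.
have [d1 d10 hd1] := sg_difference genA Dx e0.
have [d2 d20 hd2] := sg_difference genA1 Dv e0.
have [->|Tneq0] := eqVneq T 0.
  by rewrite (sg_id SC) (sg_id S1C) subrr normr0 !mul0r.
have Tp : 0 < T by rewrite lt_def Tneq0.
pose d := Num.min d1 d2.
have d0 : 0 < d by rewrite lt_min d10.
(* Enough steps for the mesh [T / n] to be at most [d], where both first-order expansions are
   valid. *)
pose n := (Num.truncn (T / d)).+1.
pose h := T / n%:R.
have n0 : 0 < n%:R :> R by rewrite ltr0n.
have h0 : 0 < h by rewrite divr_gt0.
have hd : h <= d.
  rewrite ler_pdivrMr// mulrC -ler_pdivrMr//; apply/ltW; exact: truncnS_gt.
have hn : n%:R * h = T by rewrite /h mulrCA divff ?mulr1// gt_eqF.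
pose phi k := S (k%:R * h) x (S1 (T - k%:R * h) v).
have step k : (k < n)%N -> `|phi k.+1 - phi k| <= h * (e * C).
  move=> kn; rewrite /phi; set s := k%:R * h; set r := T - k.+1%:R * h.
  have s0 : 0 <= s by rewrite mulr_ge0// ltW.
  have r0 : 0 <= r by rewrite subr_ge0 -hn ler_wpM2r ?(ltW h0)// ler_nat.
  have Es : k.+1%:R * h = s + h by rewrite -natr1 mulrDl mul1r.
  have Er : T - s = r + h by rewrite /r Es; ring.
  have sT : 0 <= s <= T.
    by rewrite s0 -hn ler_wpM2r ?(ltW h0)// ler_nat ltnW.
  have rT : 0 <= r <= T by rewrite r0 /r gerBl Es addr_ge0// ltW.
  have h0' := ltW h0.
  rewrite Es Er; clearbody s r; rewrite (sg_add SC)// (sg_add S1C)//.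
  set rx := S h x - x - h *: A x; set rv := S1 h v - v - h *: A1 v.
  have hrx : `|rx| <= e * h by apply: hd1; rewrite h0 (le_trans hd)// ge_min lexx.
  have hrv : `|rv| <= e * h.
    by apply: hd2; rewrite h0 (le_trans hd)// ge_min lexx orbT.
  have -> : S h x = x + h *: A x + rx by rewrite /rx -(addrA (S h x)) -opprD [RHS]addrC subrK.
  have -> : S1 h v = v + h *: A1 v + rv.  by rewrite /rv -(addrA (S1 h v)) -opprD [RHS]addrC subrK.
  clearbody rx rv.
  rewrite !(sgD SC)// !(sgD S1C)// (sgZ SC)// (sgZ S1C)//.
  rewrite !dual_addE !dualD dual_scaleE dualZ.
  have [DS AS] := sg_generator_invariant SC genA s0 Dx.
  have [DS1 AS1] := sg_generator_invariant S1C genA1 r0 Dv.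
  (* The first-order terms of the increment cancel: domains are invariant, so the duality of the
     generators applies at [S s x] and [S1 r v]. Only the two remainders are left. *)
  have adj : S s (A x) (S1 r v) = S s x (S1 r (A1 v)).
    by rewrite -AS -AS1; apply: (A1P _ _).1 DS.
  rewrite adj.
  set a := S s x (S1 r v).
  rewrite (_ : a + _ + _ - _ = S s rx (S1 r v) - S s x (S1 r rv)); last first.
    by rewrite opprD addrACA subrr add0r.
  have -> : h * (e * C) = K * (e * h) * (M * `|v|) + K * `|x| * (M * (e * h)).
    by rewrite /C; ring.
  rewrite (le_trans (ler_normB _ _))//; apply: lerD.
    rewrite (le_trans (dual_le _ _))// ler_pM//; last exact: hM.
    by rewrite (le_trans (hK _ _ sT))// ler_wpM2l.
  rewrite (le_trans (dual_le _ _))// ler_pM//; first exact: hK.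
  by rewrite (le_trans (hM _ _ rT))// ler_wpM2l.
have sum k : (k <= n)%N -> `|phi k - phi 0%N| <= k%:R * (h * (e * C)).
  elim: k => [|k IH] kn; first by rewrite subrr normr0 mul0r.
  rewrite -[phi _ - _](subrKA (phi k)) (le_trans (ler_normD _ _))//.
  by rewrite -natr1 mulrDl mul1r addrC lerD ?step// IH// ltnW.
have := sum n (leqnn n); rewrite /phi hn mul0r subr0 subrr (sg_id SC) (sg_id S1C).
by rewrite mulrA hn mulrAC mulrA; rewrite (mulrAC T).
Qed.

(* A vector annihilated by D(A) is a value of A1 at 0; as A1 is a function, D(A)
   is dense. *)
Lemma domain_annihilator v : (forall x, D x -> x v = 0) -> v = 0.
Proof.
move=> h.
have [_ <-] : D1 0 /\ A1 0 = v.
  by apply/A1P => x Dx; rewrite h// linear0.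
have [_ //] : D1 0 /\ A1 0 = 0.
by apply/A1P => x Dx; rewrite !linear0.
Qed.

(** The defect of the identity is a bounded functional of [x], hence represented by a vector of V.
    It vanishes on [D], so [domain_annihilator] kills it. *)
Lemma adjoint_on_codomain (T : R) (x : dual V) (v : V) : 0 <= T -> D1 v -> S T x v = x (S1 T v).
Proof.
move=> T0 Dv.
have [w wE] : exists w, forall x : dual V, S T x v - x (S1 T v) = x w.
  apply: (@reflexive _ _ (fun x => S T x v - x (S1 T v) : R^o)
    (expR (omega * T) * `|v| + `|S1 T v|)) => [a y z|y].
    rewrite (sgD SC)// (sgZ SC)// !dual_addE !dual_scaleE.
    by rewrite -[_ *: _]/(a * _); ring.
  rewrite (le_trans (ler_normB _ _))// mulrDl lerD//.
    rewrite (le_trans (dual_le _ _))// mulrAC ler_wpM2r//.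
    by rewrite (le_trans (growth _ _)).
  by rewrite mulrC dual_le.
apply/eqP; rewrite -subr_eq0 wE.
rewrite (@domain_annihilator w) ?linear0// => y Dy.
by rewrite -wE adjoint_on_domains// subrr.
Qed.

Lemma orbit_continuous (x : dual V) (v : V) : continuous (fun s : R => S `|s| x v : R^o).
Proof.
move=> s0; apply: (@continuous_comp _ _ _ (fun s => S `|s| x) (fun f : dual V => f v : R^o)).
  have c := @sg_joint_continuous _ _ _ SC (growth_locally_bounded growth) (s0, x).
  have h : (s, x) @[s --> (s0 : R)] --> ((s0 : R), x).
    exact: (cvg_pair cvg_id (cvg_cst x)).
  exact: (cvg_comp _ _ h c).
apply: (@linear_bound_continuous _ _ _ (fun f : dual V => f v : R^o) `|v|) => //.
by move=> f; rewrite mulrC dual_le.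
Qed.

Lemma orbit_integrable (h : R) (x : dual V) (v : V) :
  mu.-integrable `[0, h] (EFin \o (fun s => S s x v)).
Proof.
apply: (@eq_integrable _ _ R mu `[0, h] _ (fun s => (S `|s| x v)%:E)) => //.
  by move=> s; rewrite inE/= in_itv/= => /andP[s0 _]; rewrite /= ger0_norm.
apply: continuous_compact_integrable; first exact: segment_compact.
by apply: continuous_subspaceT; exact: orbit_continuous.
Qed.

(** The generator gives right derivatives only. Forward differences based at [a] have an error
    uniform in [a] on bounded sets of times, so a negative [h] is read as a forward step [- h] from
    [h + s]; continuity of the orbit of [A x] absorbs the move of the base point. *)
Lemma orbit_is_derive (s : R) (x : dual V) (v : V) : 0 < s -> D x ->
  is_derive s (1 : R) (fun r : R => S `|r| x v : R^o) (S s (A x) v).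
Proof.
move=> s0 Dx; set f := fun r : R => _.
suff cv : (h^-1 *: ((f \o shift s) (h *: (1 : R)) - f s) : R^o) @[h --> 0^']
    --> (S s (A x) v : R^o).
  by split; [apply/cvg_ex; exists (S s (A x) v)|apply: cvg_lim].
apply/cvgrPdist_le => e e0.
have [M M1 hM] := growth_locally_bounded growth (s + 1).
have M0 : 0 < M by apply: lt_le_trans M1.
have v1 : 0 < `|v| + 1 by rewrite ltr_wpDl.
have e10 : 0 < e / (2 * M * (`|v| + 1)) by rewrite divr_gt0// !mulr_gt0.
have [d1 d10 hd1] := sg_difference genA Dx e10.
have /(@cvgrPdist_le R R^o)/(_ (e / 2)) := @orbit_continuous (A x) v s.
rewrite divr_gt0// => /(_ isT)[d2 /= d20 hd2].
have key (a k : R) : 0 <= a -> a + k <= s + 1 -> 0 < k <= d1 ->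
    `|S (a + k) x v - S a x v - k * S a (A x) v| <= e / 2 * k.
  move=> a0 ak /andP[k0 kd].
  have aT : 0 <= a <= s + 1 by rewrite a0 (le_trans _ ak)// lerDl ltW.
  rewrite (sg_add SC) ?(ltW k0)// -dual_scaleE -!dual_subE -(sgZ SC)// -!(sgB SC)//.
  rewrite (le_trans (dual_le _ _))//.
  rewrite (le_trans (ler_wpM2r (normr_ge0 v) (hM _ _ aT)))//.
  rewrite (le_trans (ler_wpM2r (normr_ge0 v) (ler_wpM2l (ltW M0) (hd1 _ _))))//.
    by rewrite k0.
  have -> : e / 2 * k = M * (e / (2 * M * (`|v| + 1)) * k) * (`|v| + 1).
    by field; rewrite !gt_eqF.
  rewrite ler_wpM2l ?lerDl//.
  by rewrite mulr_ge0 ?(ltW M0)// mulr_ge0 ?(ltW e10) ?(ltW k0).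
pose d := Num.min (Num.min d1 d2) (Num.min s 1).
have d0 : 0 < d by rewrite !lt_min d10 d20 s0 ltr01.
exists d => //= h; rewrite /ball /= sub0r normrN !lt_min.
move=> /andP[/andP[hd1' hd2'] /andP[hs h1]] hn0.
rewrite [h *: _]mulr1 /f /= (gtr0_norm s0).
have sh : 0 < h + s by move: hs; rewrite ltr_norml => /andP[]; lra.
rewrite (gtr0_norm sh) -[_ *: _]/(h^-1 * _).
have fin a k : 0 < k -> `|s - a| < d2 -> 0 <= a ->
    `|S (a + k) x v - S a x v - k * S a (A x) v| <= e / 2 * k ->
    `|S s (A x) v - k^-1 * (S (a + k) x v - S a x v)| <= e.
  move=> k0 asd a0 hk.
  have := hd2 a asd; rewrite (gtr0_norm s0) (ger0_norm a0) => hk2.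
  rewrite -[_ - _](subrKA (S a (A x) v)) (splitr e) (le_trans (ler_normD _ _))//.
  rewrite lerD// distrC -(ler_pM2r k0); apply: le_trans hk.
  rewrite -[X in _ * X <= _](gtr0_norm k0) -normrM mulrBl mulrAC mulVf ?gt_eqF//.
  by rewrite mul1r (mulrC k).
have [hp|hn] := ltP 0 h.
  rewrite (addrC h); apply: fin => //; rewrite ?subrr ?normr0 ?(ltW s0)//.
  apply: key; rewrite ?(ltW s0)// ?hp/=.
    by rewrite lerD2l -[leLHS](gtr0_norm hp) ltW.
  by rewrite -[leLHS](gtr0_norm hp) ltW.
have hn' : 0 < - h by rewrite oppr_gt0 lt_neqAle hn0.
have -> : h^-1 * (S (h + s) x v - S s x v) =
    (- h)^-1 * (S ((h + s) + - h) x v - S (h + s) x v).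
  by rewrite (addrC h) addrK invrN mulNr -mulrN opprB.
have habs : `|h| = - h by rewrite ler0_norm.
apply: fin => //; rewrite ?(ltW sh)//.
  by rewrite (addrC h) opprD addrA subrr add0r normrN.
apply: key; rewrite ?(ltW sh) ?hn'/=//.
  by rewrite (addrC h) addrK lerDl.
by rewrite -habs ltW.
Qed.

Lemma orbit_FTC (h : R) (x : dual V) (v : V) : 0 < h -> D x ->
  \int[mu]_(s in `[0, h]) (S s (A x) v) = S h x v - x v.
Proof.
move=> h0 Dx; rewrite /Rintegral.
have -> : (\int[mu]_(s in `[0%R, h]) (S s (A x) v)%:E =
    \int[mu]_(s in `[0%R, h]) (S `|s| (A x) v)%:E)%E.
  apply: eq_integral => s; rewrite inE/= in_itv/= => /andP[s0 _].
  by rewrite ger0_norm.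
rewrite (@continuous_FTC2 _ (fun s : R => S `|s| (A x) v) (fun s : R => S `|s| x v))//.
- by rewrite normr0 (gtr0_norm h0) (sg_id SC).
- by apply: continuous_subspaceT; exact: orbit_continuous.
- split => [s||]; rewrite ?in_itv/=.
  + by move=> /andP[s0 _]; case: (orbit_is_derive v s0 Dx).
  + by apply: cvg_at_right_filter; exact: orbit_continuous.
  + by apply: cvg_at_left_filter; exact: orbit_continuous.
- move=> s; rewrite in_itv/= => /andP[s0 _]; rewrite derive1E.
  by have [_ ->] := orbit_is_derive v s0 Dx; rewrite gtr0_norm.
Qed.

(** The integral over [[0, h]] of the orbit of [v] is defined weakly through [S], since adjointness
    is still unknown at [v]. It lies in [D1] because [orbit_FTC] gives [A x z = S h x v - x v],
    which is bounded in [x]. *)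
Lemma orbit_average (h : R) (v : V) : 0 < h -> exists2 z, D1 z &
  forall x : dual V, x z = \int[mu]_(s in `[0, h]) (S s x v).
Proof.
move=> h0.
have [K K1 hK] := growth_locally_bounded growth h.
have mI : measurable (`[0, h] : set R) by [].
have [z zE] : exists z, forall x : dual V,
    \int[mu]_(s in `[0, h]) (S s x v) = x z.
  apply: (@reflexive _ _ (fun x => \int[mu]_(s in `[0, h]) (S s x v) : R^o)
    (K * `|v| * h)).
    move=> a x y.
    rewrite -[a *: Rintegral _ _ _]/(a * _) -RintegralZl//; last exact: orbit_integrable.
    rewrite -RintegralD//; last exact: orbit_integrable.
      apply: eq_Rintegral => s; rewrite inE/= in_itv/= => /andP[s0 _].
      by rewrite (sgD SC)// (sgZ SC).
    apply: (@eq_integrable _ _ R mu `[0, h] _ (fun s => (S s (a *: x) v)%:E)) => //.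
      move=> s; rewrite inE/= in_itv/= => /andP[s0 _].
      by rewrite (sgZ SC).
    exact: orbit_integrable.
  move=> x; rewrite (le_trans (le_normr_Rintegral _ _))//.
    exact: orbit_integrable.
  have -> : K * `|v| * h * `|x| = \int[mu]_(s in `[0, h]) (K * `|v| * `|x|).
    rewrite Rintegral_cst//= lebesgue_measure_itv/= lte_fin h0 -EFinB/= subr0.
    by rewrite mulrAC.
  apply: le_Rintegral => //.
  - by apply: integrable_norm; exact: orbit_integrable.
  - exact: itv_integrable_cst.
  move=> s; rewrite /= in_itv/= => sh.
  rewrite (le_trans (dual_le _ _))// (mulrAC K) ler_wpM2r//.
  exact: hK.
exists z; last by move=> x; rewrite zE.
have [w wE] : exists w, forall x : dual V, S h x v - x v = x w.
  apply: (@reflexive _ _ (fun x => S h x v - x v : R^o) (K * `|v| + `|v|)).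
    move=> a x y; rewrite (sgD SC) ?ltW// (sgZ SC) ?ltW// !dual_addE !dual_scaleE.
    by rewrite -[_ *: _]/(a * _); ring.
  move=> x; rewrite (le_trans (ler_normB _ _))// mulrDl lerD//.
    rewrite (le_trans (dual_le _ _))// mulrAC ler_wpM2r// hK//.
    by rewrite (ltW h0) lexx.
  by rewrite mulrC dual_le.
have [//] : D1 z /\ A1 z = w.
by apply/A1P => x Dx; rewrite -wE -zE orbit_FTC.
Qed.

(** Density of [D1]. As [g] vanishes on orbit averages, [h * g v] is the integral over [[0, h]] of
    [g v - S s g v], which strong continuity of [S] at [g] makes arbitrarily small compared with
    [h]. *)
Lemma adjoint_domain_annihilator (g : dual V) : (forall v, D1 v -> g v = 0) -> g = 0.
Proof.
move=> gD; apply: dual_eqP => v; rewrite dual_zeroE; apply/eqP.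
rewrite -normr_le0; apply/ler_addgt0Pr => e e0; rewrite add0r.
have v1 : 0 < `|v| + 1 by rewrite ltr_wpDl.
have [h h0 hh] := sg_right SC g (divr_gt0 e0 v1).
have [z Dz zE] := orbit_average v h0.
have mI : measurable (`[0, h] : set R) by [].
have ic : forall c : R, mu.-integrable `[0, h] (EFin \o (fun=> c)).
  by move=> c; exact: itv_integrable_cst.
have cst c : \int[mu]_(s in `[0, h]) c = c * h.
  by rewrite Rintegral_cst//= lebesgue_measure_itv/= lte_fin h0 -EFinB/= subr0.
rewrite -(ler_pM2r h0) -[X in _ * X <= _](gtr0_norm h0) -normrM.
have -> : g v * h = \int[mu]_(s in `[0, h]) (g v - S s g v).
  rewrite RintegralB//; last exact: orbit_integrable.
  by rewrite cst -zE (gD z Dz) subr0.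
have ii : mu.-integrable `[0, h] (EFin \o (fun s => g v - S s g v)).
  apply: (@eq_integrable _ _ R mu `[0, h] mI
    ((fun=> (g v)%:E) \- (fun s => (S s g v)%:E))%E) => //.
  by apply: integrableB => //; [exact: ic|exact: orbit_integrable].
rewrite (le_trans (le_normr_Rintegral _ ii))// -cst.
apply: le_Rintegral => //; first exact: integrable_norm.
move=> s; rewrite /= in_itv/= => sh.
rewrite -dual_subE (le_trans (dual_le _ _))// distrC.
rewrite (le_trans (ler_wpM2r (normr_ge0 v) (hh _ sh)))//.
by rewrite -[leRHS](divfK (lt0r_neq0 v1)) ler_wpM2l ?lerDl// divr_ge0 ?ltW.
Qed.

(** The defect argument again, now in [v]: it is a bounded functional on V that vanishes on [D1]. *)
Theorem adjoint_semigroup (T : R) (x : dual V) (v : V) : 0 <= T ->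
  S T x v = x (S1 T v).
Proof.
move=> T0.
have [r r0 hr] := linear_continuous_bounded (sg_linear S1C T0) (sg_continuous S1C T0).
have [g gE] : exists g : dual V, forall v, g v = S T x v - x (S1 T v).
  apply: (@dualP _ _ (fun v => S T x v - x (S1 T v) : R^o)
      (expR (omega * T) * `|x| + `|x| * r)).
    move=> a u w; rewrite (sgD S1C)// (sgZ S1C)// !dualD !dualZ.
    by rewrite -[_ *: _]/(a * _); ring.
  move=> w; rewrite (le_trans (ler_normB _ _))// mulrDl lerD//.
    by rewrite (le_trans (dual_le _ _))// ler_wpM2r// growth.
  by rewrite (le_trans (dual_le _ _))// -mulrA ler_wpM2l.
have g0 : g = 0.
  apply: adjoint_domain_annihilator => w Dw.
  by rewrite gE adjoint_on_codomain// subrr.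
by apply/eqP; rewrite -subr_eq0 -gE g0.
Qed.

Lemma adjoint_growth (s : R) (v : V) : 0 <= s ->
  `|S1 s v| <= expR (omega * s) * `|v|.
Proof.
move=> s0; apply: predual_norm_le => [|f]; first by rewrite mulr_ge0 ?expR_ge0.
rewrite -adjoint_semigroup// (le_trans (dual_le _ _))// mulrAC ler_wpM2r//.
exact: growth.
Qed.

End Adjoint.

(** * Borel functions and Bochner integrals *)

Section Borel.
Context {d} {T : measurableType d} {R : realType}.
Implicit Types D E : set T.

(** The notion of [borel_fun] over an arbitrary measurable domain; products of two time axes occur
    in the Fubini arguments. *)
Definition borel {X : normedModType R} D (f : T -> X) :=
  measurable_fun D (f : T -> g_sigma_algebraType (@open X)).

Lemma borelP {X : normedModType R} D (f : T -> X) : measurable D ->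
  borel D f <-> forall O, open O -> measurable (D `&` f @^-1` O).
Proof.
move=> mD; split=> [bf O oO|bf].
  by apply: bf => //; exact: sub_sigma_algebra.
rewrite /borel; apply: (@measurability _ _ T (g_sigma_algebraType (@open X)) D f
  (@open X) erefl); move=> _ [Q oQ <-].
exact: bf.
Qed.

Lemma borel_comp {X Y : normedModType R} D (f : T -> X) (F : X -> Y) :
  measurable D -> continuous F -> borel D f -> borel D (F \o f).
Proof.
move=> mD cF /(borelP _ mD) bf; apply/(borelP _ mD) => O oO.
by rewrite comp_preimage; apply: bf; apply: open_comp => // x _; exact: cF.
Qed.

Lemma borel_real D (f : T -> R^o) : measurable D ->
  borel D f <-> measurable_fun D (f : T -> R).
Proof.
move=> mD; split=> [/(borelP _ mD) bf|mf].
  apply: (measurability _ (RGenOInfty.measurableE R)) => //; move=> _ [_ [a ->] <-].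
  by apply: bf; exact: interval_open.
by apply/(borelP _ mD) => O oO; apply: mf => //; exact: open_measurable.
Qed.

Lemma borel_subset {X : normedModType R} D E (f : T -> X) : measurable D ->
  measurable E -> E `<=` D -> borel D f -> borel E f.
Proof. by move=> mD mE ED; exact: measurable_funS. Qed.

Lemma borel_cst {X : normedModType R} D (c : X) : borel D (fun=> c).
Proof. exact: measurable_cst. Qed.

Lemma borel_if {X : normedModType R} D E (f g : T -> X) : measurable D ->
  measurable E -> borel D f -> borel D g ->
  borel D (fun r => if `[< E r >] then f r else g r).
Proof.
move=> mD mE /(borelP _ mD) bf /(borelP _ mD) bg; apply/(borelP _ mD) => O oO.
have -> : D `&` (fun r => if `[< E r >] then f r else g r) @^-1` O =
    (E `&` (D `&` f @^-1` O)) `|` ((D `&` g @^-1` O) `\` E).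
  apply/seteqP; split=> r /=.
    by case: asboolP => Er [Dr Or]; [left|right].
  by case=> [[Er [Dr Or]]|[[Dr Or] Er]]; split => //; case: asboolP.
by apply: measurableU; [apply: measurableI => //; exact: bf|
  apply: measurableD => //; exact: bg].
Qed.

Lemma separable_seq {X : normedModType R} : separable X ->
  exists q : nat -> X, forall x e, 0 < e -> exists n, `|x - q n| < e.
Proof.
move=> [Q cQ dQ].
have dQe (x : X) (e : R) : 0 < e -> exists2 y, Q y & `|x - y| < e.
  move=> e0; have [] := dQ (ball x e).
  - by exists x; exact: ballxx.
  - exact: ball_open.
  by move=> y [xy Qy]; exists y => //; move: xy; rewrite -ball_normE.
have /pfcard_geP[Q0|[f]] := cQ.
  by have [y] := dQe 0 1 ltr01; rewrite Q0.
exists f => x e /(dQe x)[y Qy xy].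
by have [n _ fn] := @surj _ _ _ _ f y Qy; exists n; rewrite fn.
Qed.

(* The open preimage is a countable union of products of balls. *)
Lemma borel_pair {X Y Z : normedModType R} D (f : T -> X) (g : T -> Y)
    (F : X * Y -> Z) : separable X -> separable Y -> measurable D ->
  continuous F -> borel D f -> borel D g -> borel D (fun r => F (f r, g r)).
Proof.
move=> /separable_seq[qx hx] /separable_seq[qy hy] mD cF.
move=> /(borelP _ mD) bf /(borelP _ mD) bg; apply/(borelP _ mD) => O oO.
have [e [ep he]] := @vanishing_seq R.
pose W : set (X * Y) := F @^-1` O.
have oW : open W by apply: open_comp => // x _; exact: cF.
pose B (i : nat * nat * nat) : set (X * Y) :=
  ball (qx i.1.1) (e i.2) `*` ball (qy i.1.2) (e i.2).
pose G i := if `[< B i `<=` W >] then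
  (D `&` f @^-1` ball (qx i.1.1) (e i.2)) `&`
  (D `&` g @^-1` ball (qy i.1.2) (e i.2)) else set0.
have -> : D `&` (fun r => F (f r, g r)) @^-1` O = \bigcup_i G i.
  apply/seteqP; split=> r /=.
    move=> [Dr Wr].
    have : nbhs (f r, g r) W by apply: open_nbhs_nbhs; split.
    move=> [[P1 P2] /= [/nbhs_ballP[d1 /= d10 h1] /nbhs_ballP[d2 /= d20 h2]] h].
    have dm : 0 < Num.min d1 d2 / 2 by rewrite divr_gt0// lt_min d10.
    have [k hk] := he _ dm; have [n hn] := hx (f r) _ (ep k).
    have [m hm] := hy (g r) _ (ep k).
    exists (n, m, k) => //; rewrite /G; case: asboolP => [_|[]].
      by split; split => //=; rewrite -ball_normE/= distrC.
    have e2 : e k + e k <= Num.min d1 d2.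
      by have := hk _ (leqnn k); move: (e k) (Num.min _ _) => u v; lra.
    move=> [a b] [/=]; rewrite -!ball_normE/= => ha hb; apply: h; split => /=.
      apply: h1; rewrite -ball_normE/= -[_ - _](subrKA (qx n)).
      rewrite (le_lt_trans (ler_normD _ _))// (lt_le_trans (ltrD hn ha))//.
      by rewrite (le_trans e2)// ge_min lexx.
    apply: h2; rewrite -ball_normE/= -[_ - _](subrKA (qy m)).
    rewrite (le_lt_trans (ler_normD _ _))// (lt_le_trans (ltrD hm hb))//.
    by rewrite (le_trans e2)// ge_min lexx orbT.
  move=> [i _]; rewrite /G; case: asboolP => // BW [[Dr ?] [_ ?]]; split => //.
  by apply: BW; split.
apply: countable_bigcupT_measurable => [|i]; first exact: countableP.
rewrite /G; case: asboolP => // _.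
by apply: measurableI; [apply: bf|apply: bg]; exact: ball_open.
Qed.

(* Pettis: a function into a separable space is Borel as soon as a countable
   norming family of functionals is measurable along it. *)
Lemma pettis {X : normedModType R} (ell : nat -> X -> R) (N : nat -> R) D
    (f : T -> X) : separable X -> measurable D ->
  (forall n x y, ell n (x - y) = ell n x - ell n y) ->
  (forall x c, 0 <= c -> `|x| <= c <-> forall n, `|ell n x| <= c * N n) ->
  (forall n, measurable_fun D (fun r => ell n (f r))) -> borel D f.
Proof.
move=> /separable_seq[q hq] mD ellB ellN mf; apply/(borelP _ mD) => O oO.
have [e [ep he]] := @vanishing_seq R.
(* Closed balls, because by [ellN] their preimages are countable intersections of sets that are
   measurable by hypothesis. *)
pose C (i : nat * nat) : set X := [set x | `|x - q i.1| <= e i.2].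
pose G i := if `[< C i `<=` O >] then D `&` f @^-1` C i else set0.
have -> : D `&` f @^-1` O = \bigcup_i G i.
  apply/seteqP; split=> r /=.
    move=> [Dr Or].
    have /nbhs_ballP[dl /= d0 hd] : nbhs (f r) O by apply: open_nbhs_nbhs.
    have [k hk] := he _ (divr_gt0 d0 (ltr0Sn R 2)).
    have [n hn] := hq (f r) _ (ep k).
    exists (n, k) => //; rewrite /G; case: asboolP => [_|[]].
      by split => //=; rewrite /C/= ltW.
    move=> x; rewrite /C/= => hx; apply: hd; rewrite -ball_normE/=.
    rewrite -[_ - _](subrKA (q n)) (le_lt_trans (ler_normD _ _))// (distrC (q n)).
    apply: (lt_le_trans (ltr_leD hn hx)).
    by have := hk _ (leqnn k); have := ep k; move: (e k) => u; lra.
  by move=> [i _]; rewrite /G; case: asboolP => // CO [Dr /CO].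
apply: countable_bigcupT_measurable => [|i]; first exact: countableP.
rewrite /G; case: asboolP => // _.
have -> : D `&` f @^-1` C i =
    \bigcap_n (D `&` [set r | `|ell n (f r) - ell n (q i.1)| <= e i.2 * N n]).
  apply/seteqP; split=> r /=.
    move=> [Dr Cr] n _; split => //=; rewrite -ellB.
    exact: (ellN _ _ (ltW (ep _))).1.
  move=> h; split; first by have [] := h 0%N Logic.I.
  by apply/(ellN _ _ (ltW (ep _))) => n; rewrite ellB; have [] := h n Logic.I.
apply: bigcap_measurable => [|n _]; first by exists 0%N.
have mg : measurable_fun D (fun r => `|ell n (f r) - ell n (q i.1)|).
  apply: measurableT_comp => //; apply: measurable_funB => //.
rewrite -[X in D `&` X]/((fun r => `|ell n (f r) - ell n (q i.1)|) @^-1`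
  [set x | x <= e i.2 * N n]).
by rewrite -set_itvNyc; apply: mg.
Qed.

End Borel.

(** * Bochner integrals tested by functionals *)

Section Bochner.
Context {R : realType} {X : normedModType R}.
Implicit Types (D E : set R) (f : R -> X) (s : seq (set R * X)).
Local Notation mu := (@lebesgue_measure R).

Lemma simple_val_cons (p : set R * X) s r :
  simple_val (p :: s) r = (\1_(p.1) r : R) *: p.2 + simple_val s r.
Proof. by rewrite /simple_val big_cons. Qed.

Lemma simple_int_cons (p : set R * X) s :
  simple_int (p :: s) = fine (mu p.1) *: p.2 + simple_int s.
Proof. by rewrite /simple_int big_cons. Qed.

Lemma integrable_simple_cons D (p : set R * X) s : integrable_simple D (p :: s) ->
  [/\ measurable p.1, p.1 `<=` D, (mu p.1 < +oo)%E & integrable_simple D s].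
Proof.
move=> h; have [? ? ?] := h p (mem_head _ _); split => // x xs; apply: h.
by rewrite in_cons xs orbT.
Qed.

(** One piece is subtracted at a time, by a case distinction on its support. Sums of two arbitrary
    Borel functions are avoided: they need not be Borel when [X] is not separable. *)
Lemma borel_sub_simple D f s : measurable D ->
  (forall p, p \in s -> measurable p.1) -> borel D f ->
  borel D (fun r => f r - simple_val s r).
Proof.
move=> mD; elim: s f => [|p s IH] f ms bf.
  rewrite [X in borel _ X](_ : _ = f)//.
  by apply/funext => r; rewrite /simple_val big_nil subr0.
have mp : measurable p.1 by apply: ms; exact: mem_head.
rewrite [X in borel _ X](_ : _ = fun r =>
    (if `[< p.1 r >] then f r - p.2 else f r) - simple_val s r); last first.
  apply/funext => r; rewrite simple_val_cons opprD addrA indicE.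
  by case: asboolP => h; [rewrite mem_set// scale1r|rewrite memNset// scale0r subr0].
apply: IH => [x xs|]; first by apply: ms; rewrite in_cons xs orbT.
apply: borel_if => //.
have cB : continuous (fun x : X => x - p.2).
  by move=> x; apply: cvgB; [exact: cvg_id|exact: cvg_cst].
exact: (borel_comp mD cB bf).
Qed.

Lemma borel_norm D f : measurable D -> borel D f ->
  measurable_fun D (fun r => `|f r|).
Proof.
move=> mD bf; apply/(borel_real _ mD).
exact: (borel_comp (Y := R^o) mD (@norm_continuous _ X) bf).
Qed.

Lemma borel_simple D s : measurable D -> (forall p, p \in s -> measurable p.1) ->
  measurable_fun D (fun r => `|simple_val s r|).
Proof.
move=> mD ms; have := borel_norm mD (borel_sub_simple mD ms (@borel_cst _ _ _ X D 0)).
by apply: eq_measurable_fun => r _; rewrite sub0r normrN.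
Qed.

Lemma simple_norm_integrable D s : measurable D -> integrable_simple D s ->
  mu.-integrable D (EFin \o (fun r => `|simple_val s r|)).
Proof.
move=> mD; elim: s => [|p s IH] hs.
  apply: (@eq_integrable _ _ R mu D mD (cst 0%E)) => [r _|].
    by rewrite /= /simple_val big_nil normr0.
  exact: integrable0.
have [mp pD muP hs'] := integrable_simple_cons hs.
have i1 : mu.-integrable D (EFin \o (fun r => (\1_(p.1) r : R) * `|p.2|)).
  apply/integrableP; split.
    apply/measurable_EFinP; apply: measurable_funM => //.
  under eq_integral do rewrite /= ger0_norm ?mulr_ge0// ?EFinM.
  rewrite ge0_integralZr//; last first.
    by apply/measurable_EFinP; exact: measurable_indic.
  rewrite integral_indic// setIidl//.
  by rewrite muleC lte_mul_pinfty// lee_fin.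
apply: (@le_integrable _ _ R mu D mD _
  (EFin \o (fun r => (\1_(p.1) r : R) * `|p.2| + `|simple_val s r|))).
- apply/measurable_EFinP; apply: borel_simple => // x xs.
  by have [] := hs x xs.
- move=> r _; rewrite /= lee_fin normr_id [leRHS]ger0_norm; last first.
    by rewrite addr_ge0// mulr_ge0.
  rewrite simple_val_cons (le_trans (ler_normD _ _))// lerD2r normrZ.
  by rewrite ger0_norm.
rewrite [X in mu.-integrable _ X](_ : _ =
  ((EFin \o (fun r => ((\1_(p.1) r : R) * `|p.2|)%R)) \+
   (EFin \o (fun r => `|simple_val s r|%R)))%E)//.
by apply: integrableD => //; exact: IH.
Qed.

Section Functional.
Variables (ell : X -> R^o) (C : R).
Hypothesis ell_linear : linear ell.
Hypothesis ell_bound : forall x, `|ell x| <= C * `|x|.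

Lemma functionalD x y : ell (x + y) = ell x + ell y.
Proof. by have := ell_linear 1 x y; rewrite !scale1r. Qed.

Lemma functional0 : ell 0 = 0.
Proof. by apply: (addIr (ell 0)); rewrite -functionalD !add0r. Qed.

Lemma functionalZ a x : ell (a *: x) = a * ell x.
Proof. by have := ell_linear a x 0; rewrite !addr0 functional0 addr0. Qed.

Lemma functionalB x y : ell (x - y) = ell x - ell y.
Proof. by rewrite -scaleN1r functionalD functionalZ mulN1r. Qed.

Lemma functional_measurable D f : measurable D -> borel D f ->
  measurable_fun D (fun r => ell (f r) : R).
Proof.
move=> mD bf; apply/(borel_real _ mD).
exact: (borel_comp (Y := R^o) mD (linear_bound_continuous ell_linear ell_bound) bf).
Qed.

Lemma functional_integrable D f : measurable D -> borel D f ->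
  mu.-integrable D (EFin \o (fun r => `|f r|)) ->
  mu.-integrable D (EFin \o (fun r => ell (f r) : R)).
Proof.
move=> mD bf fi.
apply: (@le_integrable _ _ R mu D mD _ (fun r => C%:E * (`|f r|)%:E)%E).
- by apply/measurable_EFinP; exact: functional_measurable.
- move=> r _; rewrite /= lee_fin (le_trans (ell_bound _))//.
  exact: ler_norm.
by apply: integrableZl.
Qed.

Lemma simple_integral D s : measurable D -> integrable_simple D s ->
  mu.-integrable D (EFin \o (fun r => ell (simple_val s r) : R)) /\
  \int[mu]_(r in D) (ell (simple_val s r) : R) = ell (simple_int s).
Proof.
move=> mD; elim: s => [|p s IH] hs.
  rewrite /simple_int big_nil functional0; split.
    apply: (@eq_integrable _ _ R mu D mD (cst 0%E)) => [r _|].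
      by rewrite /= /simple_val big_nil functional0.
    exact: integrable0.
  under eq_Rintegral do rewrite /simple_val big_nil functional0.
  by rewrite Rintegral_cst// mul0r.
have [mp pD muP hs'] := integrable_simple_cons hs.
have [i2 e2] := IH hs'.
have ii : mu.-integrable D (EFin \o (\1_(p.1) : R -> R)).
  apply/integrableP; split; first exact/measurable_EFinP/measurable_indic.
  under eq_integral do rewrite /= ger0_norm//.
  by rewrite integral_indic// setIidl.
have i1 : mu.-integrable D (EFin \o (fun r => (\1_(p.1) r : R) * ell p.2)).
  have := @integrableZr _ _ R mu D mD (ell p.2) _ ii.
  by apply: eq_integrable => // r _; rewrite /= EFinM.
have E r : ell (simple_val (p :: s) r) = (\1_(p.1) r : R) * ell p.2 + ell (simple_val s r).
  by rewrite simple_val_cons functionalD functionalZ.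
split.
  apply: (@eq_integrable _ _ R mu D mD
    ((EFin \o (fun r => ((\1_(p.1) r : R) * ell p.2)%R)) \+
     (EFin \o (fun r => ell (simple_val s r) : R)))%E) => [r _|].
    by rewrite /= E EFinD.
  exact: integrableD.
under eq_Rintegral do rewrite E.
rewrite RintegralD// e2 simple_int_cons functionalD functionalZ; congr (_ + _).
rewrite RintegralZr//; congr (_ * _).
by rewrite /Rintegral integral_indic// setIidl.
Qed.

(** The estimate behind both directions of the comparison: it identifies a given Bochner integral
    with scalar ones in [bochner_weak], and produces a Bochner integral from scalar ones in
    [bochner_exists]. *)
Lemma functional_simple_dist D f s : measurable D -> borel D f ->
  mu.-integrable D (EFin \o (fun r => `|f r|)) -> integrable_simple D s ->
  `|\int[mu]_(r in D) (ell (f r) : R) - ell (simple_int s)| <=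
  C * \int[mu]_(r in D) `|f r - simple_val s r|.
Proof.
move=> mD bf fi hs.
have [i2 <-] := simple_integral mD hs.
have i1 := functional_integrable mD bf fi.
have ms p : p \in s -> measurable p.1 by move=> /hs[].
have bfs := borel_sub_simple mD ms bf.
have ifs : mu.-integrable D (EFin \o (fun r => `|f r - simple_val s r|)).
  apply: (@le_integrable _ _ R mu D mD _
    ((EFin \o (fun r => `|f r|%R)) \+ (EFin \o (fun r => `|simple_val s r|%R)))%E).
  - by apply/measurable_EFinP; exact: borel_norm.
  - move=> r _; rewrite /= !lee_fin normr_id [leRHS]ger0_norm ?addr_ge0//.
    exact: ler_normB.
  by apply: integrableD => //; exact: simple_norm_integrable.
rewrite -RintegralB// -RintegralZl//.
have i3 : mu.-integrable D (EFin \o (fun r => (ell (f r) : R) - ell (simple_val s r))).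
  apply: (@eq_integrable _ _ R mu D mD
    ((EFin \o (fun r => ell (f r) : R)) \-
     (EFin \o (fun r => ell (simple_val s r) : R)))%E) => //.
  exact: integrableB.
rewrite (le_trans (le_normr_Rintegral _ _))//; apply: le_Rintegral => //.
- exact: integrable_norm.
- have := @integrableZl _ _ R mu D mD C _ ifs; by apply: eq_integrable.
by move=> r _; rewrite -functionalB; exact: ell_bound.
Qed.

End Functional.

Lemma bochner_norm_integrable D f v : measurable D -> is_bochner_integral D f v ->
  mu.-integrable D (EFin \o (fun r => `|f r|)).
Proof.
move=> mD [bf [s [hs /fine_cvgP[fins _] _]]].
(* A single approximant at finite distance suffices, being itself integrable. *)
have [N _ hN] := fins; have {hN} /= fN := hN N (leqnn N).
have ms p : p \in s N -> measurable p.1 by move=> /hs[].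
have bfs := borel_sub_simple mD ms bf.
apply: (@le_integrable _ _ R mu D mD _
  ((EFin \o (fun r => `|f r - simple_val (s N) r|%R)) \+
   (EFin \o (fun r => `|simple_val (s N) r|%R)))%E).
- by apply/measurable_EFinP; exact: borel_norm.
- move=> r _; rewrite /= !lee_fin normr_id [leRHS]ger0_norm ?addr_ge0//.
  by rewrite -[X in `|X| <= _](subrK (simple_val (s N) r)) ler_normD.
apply: integrableD => //; last exact: simple_norm_integrable.
apply/integrableP; split; first by apply/measurable_EFinP; exact: borel_norm.
under eq_integral do rewrite /= normr_id.
by rewrite ltey_eq fN.
Qed.

Lemma bochner_weak D f v (ell : X -> R^o) (C : R) : measurable D ->
  is_bochner_integral D f v -> linear ell -> (forall x, `|ell x| <= C * `|x|) ->
  \int[mu]_(r in D) (ell (f r) : R) = ell v.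
Proof.
move=> mD bv ell_linear ell_bound.
have fi := bochner_norm_integrable mD bv.
case: bv => bf [s [hs hd hv]].
have cI : (fun n => ell (simple_int (s n))) @ \oo --> ell v.
  have ec := linear_bound_continuous ell_linear ell_bound.
  exact: (cvg_comp _ _ hv (ec v)).
have cJ : (fun n => ell (simple_int (s n))) @ \oo -->
    (\int[mu]_(r in D) (ell (f r) : R) : R^o).
  apply/cvgrPdist_le => e e0.
  have /fine_cvgP[_ /cvgrPdist_le/(_ (e / (`|C| + 1)))] := hd.
  rewrite divr_gt0 ?ltr_wpDl// => /(_ isT); apply: filterS => n /=.
  rewrite sub0r normrN => hn.
  rewrite (le_trans (functional_simple_dist ell_linear ell_bound mD bf fi (hs n)))//.
  have C1 : 0 < `|C| + 1 by rewrite ltr_wpDl.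
  rewrite (le_trans _ (_ : (`|C| + 1) * (e / (`|C| + 1)) <= e))//; last first.
    by rewrite mulrC divfK// gt_eqF.
  have I0 : 0 <= \int[mu]_(r in D) `|f r - simple_val (s n) r|.
    exact: Rintegral_ge0.
  rewrite (le_trans (ler_wpM2r I0 (_ : C <= `|C| + 1)))//.
    by rewrite ler_wpDr// ler_norm.
  by rewrite ler_pM2l// (le_trans (ler_norm _)).
exact: (@cvg_unique _ (@norm_hausdorff _ R^o) _ _ _ _ cJ cI).
Qed.

End Bochner.

(** * Existence of Bochner integrals *)

Section BochnerExistence.
Context {R : realType} {X : normedModType R}.
Local Notation mu := (@lebesgue_measure R).
Variables (D : set R) (f : R -> X) (q : nat -> X).
Hypothesis mD : measurable D.
Hypothesis bf : borel D f.
Hypothesis fi : mu.-integrable D (EFin \o (fun r => `|f r|)).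
Hypothesis qd : forall x e, 0 < e -> exists n, `|x - q n| < e.

(* Greedy approximation: at stage n the value q n is adopted wherever it is
   closer to f than the current one. *)
Let closer (s : seq (set R * X)) (c : X) : set R :=
  D `&` [set r | `|f r - c| < `|f r - simple_val s r|].

Let step s c := (closer s c, c) :: [seq (p.1 `\` closer s c, p.2) | p <- s].

Fixpoint greedy n := if n is m.+1 then step (greedy m) (q m) else [::].

(** The cut gives every piece finite measure, as [D] is unbounded in the co-state integrals. Each
    point is eventually inside the window, so pointwise convergence survives. *)
Definition truncate n := [seq (p.1 `&` `[- n%:R, n%:R], p.2) | p <- greedy n].

Let simple_val_map (s : seq (set R * X)) (F : set R) r :
  simple_val [seq (p.1 `&` F, p.2) | p <- s] r = (\1_F r : R) *: simple_val s r.
Proof.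
rewrite /simple_val big_map scaler_sumr; apply: eq_bigr => p _ /=.
by rewrite indicI scalerA mulrC.
Qed.

Let simple_val_step s c r :
  simple_val (step s c) r = if `[< closer s c r >] then c else simple_val s r.
Proof.
rewrite /step simple_val_cons /=.
rewrite (eq_map (g := fun p => (p.1 `&` ~` closer s c, p.2))); last first.
  by move=> p; rewrite setDE.
rewrite simple_val_map !indicE.
case: asboolP => h.
  by rewrite mem_set// memNset ?scale1r ?scale0r ?addr0//= => /(_ h).
by rewrite memNset// mem_set// scale1r scale0r add0r.
Qed.

Let greedyD n p : p \in greedy n -> measurable p.1 /\ p.1 `<=` D.
Proof.
elim: n p => [|n IH] p //=; rewrite in_cons.
have mF : measurable (closer (greedy n) (q n)).
  have m1 : measurable_fun D (fun r => `|f r - q n|).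
    apply: borel_norm => //.
    have cB : continuous (fun x : X => x - q n).
      by move=> x; apply: cvgB; [exact: cvg_id|exact: cvg_cst].
    exact: (borel_comp mD cB bf).
  have m2 : measurable_fun D (fun r => `|f r - simple_val (greedy n) r|).
    apply: borel_norm => //; apply: borel_sub_simple => // x xs.
    by have [] := IH _ xs.
  exact: (measurable_fun_ltr m1 m2 mD (Y := [set true])).
case/orP => [/eqP -> /=|/mapP[x xs -> /=]].
  by split => // r [].
have [mx xD] := IH _ xs; split; first exact: measurableD.
by move=> r [/xD].
Qed.

Let greedy_step n r : D r ->
  `|f r - simple_val (greedy n.+1) r| <= `|f r - simple_val (greedy n) r| /\
  `|f r - simple_val (greedy n.+1) r| <= `|f r - q n|.
Proof.
move=> Dr; rewrite [greedy n.+1]/= simple_val_step; case: asboolP => h.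
  by split => //; apply: ltW; case: h.
by split => //; rewrite leNgt; apply/negP => h'; apply: h; split.
Qed.

Let greedy_le m n r : D r -> (m <= n)%N ->
  `|f r - simple_val (greedy n) r| <= `|f r - simple_val (greedy m) r|.
Proof.
move=> Dr; elim: n => [|n IH]; first by rewrite leqn0 => /eqP ->.
rewrite leq_eqVlt => /predU1P[->//|mn].
by apply: le_trans (IH mn); case: (greedy_step n Dr).
Qed.

Let greedy_cvg r e : D r -> 0 < e -> exists N : nat, forall n, (N <= n)%N ->
  `|f r - simple_val (greedy n) r| < e.
Proof.
move=> Dr e0; have [N hN] := qd (f r) e0.
exists N.+1 => n Nn; apply: le_lt_trans (greedy_le Dr Nn) _.
by apply: le_lt_trans hN; case: (greedy_step N Dr).
Qed.

Let truncate_simple n : integrable_simple D (truncate n).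
Proof.
move=> p /mapP[x /greedyD[mx xD] -> /=]; split.
- exact: measurableI.
- by move=> r [/xD].
apply: (@le_lt_trans _ _ (mu `[- n%:R, n%:R])).
  apply: le_measure; rewrite ?inE//; first [exact: subIsetr|exact: measurableI].
by rewrite lebesgue_measure_itv/=; case: ifP; rewrite // -EFinB ltry.
Qed.

(** The greedy construction starts from the empty sum and only improves, so it is never farther from
    [f] than 0 is. This is the domination needed for convergence in the mean. *)
Let truncate_dist n r : D r -> `|f r - simple_val (truncate n) r| <= `|f r|.
Proof.
move=> Dr; rewrite simple_val_map indicE; case: (r \in _); last first.
  by rewrite scale0r subr0.
rewrite scale1r; have := greedy_le Dr (leq0n n).
by rewrite {2}/simple_val big_nil subr0.
Qed.

Let truncate_cvg : (\int[mu]_(r in D) (`|f r - simple_val (truncate n) r|)%:E)%E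
  @[n --> \oo] --> 0%E.
Proof.
have ms n p : p \in truncate n -> measurable p.1 by move=> /truncate_simple[].
pose g n r := (`|f r - simple_val (truncate n) r|)%:E.
have mg n : measurable_fun D (g n).
  apply/measurable_EFinP; apply: borel_norm => //.
  exact: (borel_sub_simple mD (ms n) bf).
have gcv : {ae mu, forall r, D r -> g ^~ r @ \oo --> 0%E}.
  apply/aeW => r Dr; apply/fine_cvgP; split; first by apply: nearW => n.
  apply/cvgrPdist_lt => e e0.
  have [N hN] := greedy_cvg Dr e0.
  near=> n; rewrite /= sub0r normrN normr_id simple_val_map indicE mem_set.
    by rewrite scale1r; apply: hN; near: n; exact: nbhs_infty_ge.
  rewrite /= in_itv/= -ler_norml; near: n; exact: nbhs_infty_ger.
have gle : {ae mu, forall r n, D r -> (`|g n r| <= (`|f r|)%:E)%E}.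
  by apply/aeW => r n Dr; rewrite /= normr_id lee_fin; exact: truncate_dist.
have [_ _] := @dominated_convergence _ _ R mu D mD g (cst 0%E)
  (fun r => (`|f r|)%:E) mg (measurable_cst _) gcv fi gle.
by rewrite integral0.
Unshelve. all: by end_near. Qed.

(** Tested by [ell j], the integral of the approximant differs from [v] by at most [N j] times the
    mean distance; the norming property turns this into convergence in norm. Existence thus reduces
    to finding [v] with the right scalar integrals. *)
Theorem bochner_exists {J : Type} (ell : J -> X -> R^o) (N : J -> R) (v : X) :
  (forall j, linear (ell j)) -> (forall j, 0 <= N j) ->
  (forall j x, `|ell j x| <= N j * `|x|) ->
  (forall x c, 0 <= c -> (forall j, `|ell j x| <= c * N j) -> `|x| <= c) ->
  (forall j, \int[mu]_(r in D) (ell j (f r) : R) = ell j v) ->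
  is_bochner_integral D f v.
Proof.
move=> ell_linear N0 ell_bound ell_norming ell_v; split => //.
exists truncate; split => //.
apply/cvgrPdist_le => e e0.
have /fine_cvgP[_ /cvgrPdist_le/(_ e e0)] := truncate_cvg.
apply: filterS => n /=; rewrite sub0r normrN => hn.
apply: ell_norming => [|j]; first exact: ltW.
rewrite functionalB// -ell_v.
have := functional_simple_dist (ell_linear j) (ell_bound j) mD bf fi
  (@truncate_simple n).
move=> /le_trans; apply; rewrite mulrC ler_wpM2r//.
by apply: le_trans hn; exact: ler_norm.
Qed.

End BochnerExistence.

(** * Weighted integrability *)

Section ExponentialIntegrals.
Context {R : realType}.
Local Notation mu := (@lebesgue_measure R).
Implicit Types (c t s r : R).

Lemma is_derive_exp c s r : c != 0 ->
  is_derive r (1 : R) (fun x : R => c^-1 * expR (c * (x - s)) : R^o)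
    (expR (c * (r - s))).
Proof.
move=> c0.
have h : is_derive r (1 : R) (fun x : R => c * (x - s) : R^o) c.
  by apply: is_derive_eq; rewrite subr0 -[LHS]/(c * 1) mulr1.
have h2 := @is_derive1_comp R expR (fun x => c * (x - s)) r _ _
  (is_derive_expR _) h.
have h3 := is_deriveZ (c^-1) h2.
apply: (is_derive_eq h3).
by rewrite -[_ *: _]/(c^-1 * _) mulrCA mulVf ?mulr1.
Qed.

Lemma exp_continuous c s : continuous (fun x : R => expR (c * (x - s)) : R^o).
Proof.
move=> x; apply: (@continuous_comp _ _ _ (fun x : R => c * (x - s)) expR).
  by apply: cvgM; [exact: cvg_cst|apply: cvgB; [exact: cvg_id|exact: cvg_cst]].
exact: continuous_expR.
Qed.

Lemma integral_exp_le c t s : 0 < c ->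
  (\int[mu]_(r in `[t, s]) (expR (c * (r - s)))%:E <= (c^-1)%:E)%E.
Proof.
move=> c0; have [ts|st] := ltP t s; last first.
  rewrite (integral_Sset1 s) ?lee_fin ?invr_ge0 ?(ltW c0)//.
  move=> r /=; rewrite in_itv/= => /andP[tr rs].
  by apply/eqP; rewrite eq_le rs (le_trans st).
have Fc : continuous (fun x : R => c^-1 * expR (c * (x - s)) : R^o).
  by move=> x; apply: cvgM; [exact: cvg_cst|exact: exp_continuous].
rewrite (@continuous_FTC2 _ _ (fun x => c^-1 * expR (c * (x - s))))//.
- rewrite subrr mulr0 expR0 mulr1 -EFinB lee_fin gerBl mulr_ge0 ?expR_ge0//.
  by rewrite invr_ge0 ltW.
- by apply: continuous_subspaceT; exact: exp_continuous.
- split => [r _||].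
  + by case: (@is_derive_exp c s r); rewrite ?gt_eqF.
  + by apply: cvg_at_right_filter; exact: Fc.
  + by apply: cvg_at_left_filter; exact: Fc.
- move=> r _; rewrite derive1E.
  by have [|_ ->] := @is_derive_exp c s r; rewrite ?gt_eqF.
Qed.

Lemma integral_exp_tail c s : 0 < c ->
  (\int[mu]_(r in `[s, +oo[) (expR (- c * (r - s)))%:E = (c^-1)%:E)%E.
Proof.
move=> c0.
have nc0 : - c != 0 by rewrite oppr_eq0 gt_eqF.
have Fc : continuous (fun x : R => (- c)^-1 * expR (- c * (x - s)) : R^o).
  by move=> x; apply: cvgM; [exact: cvg_cst|exact: exp_continuous].
rewrite (@ge0_continuous_FTC2y _ _ (fun x => (- c)^-1 * expR (- c * (x - s))) s 0).
- by rewrite subrr mulr0 expR0 mulr1 -EFinB sub0r invrN opprK.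
- by move=> x _; exact: expR_ge0.
- by apply: continuous_subspaceT; exact: exp_continuous.
- rewrite -[X in _ --> X](mulr0 ((- c)^-1)); apply: cvgM; first exact: cvg_cst.
  have h : (c * (x - s)) @[x --> +oo%R] --> +oo%R.
    apply/cvgryPge => A; near=> x.
    have : c^-1 * A + s <= x by near: x; apply: nbhs_pinfty_ge; exact: num_real.
    by rewrite -lerBrDr ler_pdivrMl.
  have := cvg_comp _ _ h (@cvgr_expR R).
  by apply: cvg_trans; apply: near_eq_cvg; apply: nearW => x /=; rewrite mulNr.
- by move=> x _; case: (is_derive_exp s x nc0).
- by apply: cvg_at_right_filter; exact: Fc.
- move=> r _; rewrite derive1E.
  by have [_ ->] := is_derive_exp s r nc0.
Unshelve. all: by end_near. Qed.

End ExponentialIntegrals.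

(** * Schur's test: bounds for integral operators with nonnegative kernels *)

Section Schur.
Context {R : realType}.
Local Notation mu := (@lebesgue_measure R).
Variables (K : R -> R -> R) (M p q : R).
Hypothesis mK : measurable_fun setT
  (fun z : measurableTypeR R * measurableTypeR R => K z.1 z.2).
Hypothesis K0 : forall x y, 0 <= K x y.
Hypothesis K1 : forall x y, K x y <= 1.
Hypothesis M0 : 0 < M.
Hypothesis KM1 : forall x, (\int[mu]_y (K x y)%:E <= M%:E)%E.
Hypothesis KM2 : forall y, (\int[mu]_x (K x y)%:E <= M%:E)%E.
Hypotheses (p0 : 0 < p) (q0 : 0 < q) (pq : p^-1 + q^-1 = 1).
Implicit Types a b : R -> R.

Let mKl x : measurable_fun setT (K x).
Proof. exact: (measurableT_comp mK (measurable_pair1 x)). Qed.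

Let mKr y : measurable_fun setT (K ^~ y).
Proof. exact: (measurableT_comp mK (measurable_pair2 y)). Qed.

Let mpow a : measurable_fun setT a -> measurable_fun setT (fun x => a x `^ p).
Proof. exact: measurableT_comp (measurable_powR _). Qed.

Lemma kernel_swap a : measurable_fun setT a -> (forall x, 0 <= a x) ->
  (\int[mu]_x \int[mu]_y (K x y * a y)%:E <= M%:E * \int[mu]_y (a y)%:E)%E.
Proof.
move=> ma a0.
have m2 : measurable_fun setT
    (fun z : measurableTypeR R * measurableTypeR R => (K z.1 z.2 * a z.2)%:E).
  apply/measurable_EFinP; apply: measurable_funM => //.
  exact: (measurableT_comp ma measurable_snd).
rewrite (fubini_tonelli (fun z : measurableTypeR R * measurableTypeR R =>
  (K z.1 z.2 * a z.2)%:E))//=; last by move=> z; rewrite lee_fin mulr_ge0.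
rewrite -ge0_integralZl//=; last 3 first.
- exact/measurable_EFinP.
- by move=> y _; rewrite lee_fin.
- by rewrite lee_fin ltW.
apply: ge0_le_integral => //=.
- by move=> y _; apply: integral_ge0 => x _; rewrite lee_fin mulr_ge0.
- apply: (measurable_fun_fubini_tonelli_G (fun z : measurableTypeR R * measurableTypeR R =>
    (K z.1 z.2 * a z.2)%:E)) => // z; by rewrite lee_fin mulr_ge0.
- by apply: measurable_funeM; exact/measurable_EFinP.
move=> y _.
under eq_integral do rewrite EFinM.
rewrite ge0_integralZr//=; last 3 first.
- by apply/measurable_EFinP; exact: mKr.
- by move=> x _; rewrite lee_fin.
- by rewrite lee_fin.
by rewrite lee_wpmul2r// lee_fin.
Qed.

Lemma kernel_cst x c : 0 <= c -> (\int[mu]_y (K x y * c)%:E <= (M * c)%:E)%E.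
Proof.
move=> c0; under eq_integral do rewrite EFinM.
rewrite ge0_integralZr//=; last 2 first.
- by apply/measurable_EFinP; exact: mKl.
- by move=> y _; rewrite lee_fin.
by rewrite EFinM lee_wpmul2r// lee_fin.
Qed.

(** Young's inequality [a b <= a^p / p + b^q / q] under the kernel separates the two functions; the
    first term uses the mass of [K] in [x], the second its mass in [y]. *)
Lemma kernel_pairing a b : measurable_fun setT a -> measurable_fun setT b ->
  (forall x, 0 <= a x) -> (forall x, 0 <= b x) ->
  (\int[mu]_y (a y `^ p)%:E < +oo)%E -> (\int[mu]_x (b x `^ q)%:E < +oo)%E ->
  (\int[mu]_x \int[mu]_y (K x y * (a y * b x))%:E < +oo)%E.
Proof.
move=> ma mb a0 b0 ia ib.
have mbq : measurable_fun setT (fun x => b x `^ q).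
  exact: measurableT_comp (measurable_powR _) mb.
have map : measurable_fun setT (fun x => a x `^ p) by exact: mpow.
pose F (z : measurableTypeR R * measurableTypeR R) := (K z.1 z.2 * (a z.2 `^ p / p))%:E.
have mF : measurable_fun setT F.
  apply/measurable_EFinP; apply: measurable_funM => //.
  apply: measurable_funM => //; exact: (measurableT_comp map measurable_snd).
have F0 z : (0 <= F z)%E by rewrite lee_fin mulr_ge0// divr_ge0 ?powR_ge0 ?ltW.
have mi : measurable_fun setT (fun x => \int[mu]_y (K x y * (a y `^ p / p))%:E)%E.
  exact: (measurable_fun_fubini_tonelli_F F).
apply: (@le_lt_trans _ _ (\int[mu]_x (\int[mu]_y (K x y * (a y `^ p / p))%:E +
    (M * (b x `^ q / q))%:E))%E).
  apply: ge0_le_integral => //=.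
  - by move=> x _; apply: integral_ge0 => y _; rewrite lee_fin !mulr_ge0.
  - apply: (measurable_fun_fubini_tonelli_F (fun z : measurableTypeR R *
      measurableTypeR R => (K z.1 z.2 * (a z.2 * b z.1))%:E)) => //=.
      apply/measurable_EFinP; apply: measurable_funM => //.
      apply: measurable_funM.
        exact: (measurableT_comp ma measurable_snd).
      exact: (measurableT_comp mb measurable_fst).
    by move=> z; rewrite lee_fin !mulr_ge0.
  - apply: emeasurable_funD => //; apply/measurable_EFinP.
    by apply: measurable_funM => //; exact: measurable_funM.
  move=> x _.
  apply: (@le_trans _ _ (\int[mu]_y ((K x y * (a y `^ p / p))%:E +
      (K x y * (b x `^ q / q))%:E))%E).
    apply: ge0_le_integral => //=.
    - by move=> y _; rewrite lee_fin !mulr_ge0.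
    - apply/measurable_EFinP; apply: measurable_funM; first exact: mKl.
      exact: measurable_funM.
    - apply: emeasurable_funD; apply/measurable_EFinP; apply: measurable_funM => //.
      + exact: mKl.
      + exact: measurable_funM.
      + exact: mKl.
    move=> y _; rewrite -EFinD lee_fin -mulrDr ler_wpM2l//.
    exact: conjugate_powR.
  rewrite ge0_integralD//=; last 4 first.
  - by move=> y _; rewrite lee_fin mulr_ge0// divr_ge0 ?powR_ge0 ?ltW.
  - apply/measurable_EFinP; apply: measurable_funM; first exact: mKl.
    exact: measurable_funM.
  - by move=> y _; rewrite lee_fin mulr_ge0// divr_ge0 ?powR_ge0 ?ltW.
  - by apply/measurable_EFinP; apply: measurable_funM => //; exact: mKl.
  by rewrite leeD2l// kernel_cst// divr_ge0 ?powR_ge0 ?ltW.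
rewrite ge0_integralD//=; last 3 first.
- by move=> x _; apply: integral_ge0 => y _; exact: (F0 (x, y)).
- by move=> y _; rewrite lee_fin mulr_ge0 ?(ltW M0)// divr_ge0 ?powR_ge0 ?ltW.
- by apply/measurable_EFinP; apply: measurable_funM => //; exact: measurable_funM.
apply: lte_add_pinfty.
  apply: (le_lt_trans (kernel_swap _ _)) => //=.
  - exact: measurable_funM.
  - by move=> x; rewrite divr_ge0 ?powR_ge0 ?ltW.
  under eq_integral do rewrite EFinM.
  rewrite ge0_integralZr//=; last 3 first.
  - exact/measurable_EFinP.
  - by move=> x _; rewrite lee_fin powR_ge0.
  - by rewrite lee_fin invr_ge0 ltW.
  rewrite lte_mul_pinfty ?lee_fin ?(ltW M0)// muleC lte_mul_pinfty//.
  by rewrite lee_fin invr_ge0 ltW.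
under eq_integral do rewrite EFinM.
rewrite ge0_integralZl//=; last 3 first.
- by apply/measurable_EFinP; exact: measurable_funM.
- by move=> x _; rewrite lee_fin divr_ge0 ?powR_ge0 ?ltW.
- by rewrite lee_fin ltW.
rewrite lte_mul_pinfty ?lee_fin ?(ltW M0)//.
under eq_integral do rewrite EFinM.
rewrite ge0_integralZr//=; last 3 first.
- exact/measurable_EFinP.
- by move=> x _; rewrite lee_fin powR_ge0.
- by rewrite lee_fin invr_ge0 ltW.
rewrite muleC lte_mul_pinfty//.
by rewrite lee_fin invr_ge0 ltW.
Qed.

Let p1 : 1 < p.
Proof. by rewrite -invf_lt1// -pq ltrDl invr_gt0. Qed.

Let ge0_le1powR c : 0 <= c -> c <= 1 + c `^ p.
Proof.
move=> c0; have [c1|c1] := leP c 1; first by rewrite ler_wpDr// powR_ge0.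
rewrite ler_wpDl//; have := @ler_powR _ c (ltW c1) 1 p.
by rewrite powRr1// => -> //; exact: ltW.
Qed.

Section Convolution.
Variable a : R -> R.
Hypotheses (ma : measurable_fun setT a) (a0 : forall x, 0 <= a x).
Hypothesis ia : (\int[mu]_y (a y `^ p)%:E < +oo)%E.

Let map : measurable_fun setT (fun x => a x `^ p). Proof. exact: mpow. Qed.

Lemma kernel_powR_le x :
  (\int[mu]_y (K x y * a y `^ p)%:E <= \int[mu]_y (a y `^ p)%:E)%E.
Proof.
apply: ge0_le_integral => //=.
- by move=> y _; rewrite lee_fin mulr_ge0// powR_ge0.
- by apply/measurable_EFinP; apply: measurable_funM => //; exact: mKl.
- exact/measurable_EFinP.
by move=> y _; rewrite lee_fin ler_piMl// powR_ge0.
Qed.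

(** By [a <= 1 + a^p]: the first term integrates to the mass of [K], the second to at most the
    integral of [a^p] as [K <= 1]. *)
Lemma kernel_fin x : (\int[mu]_y (K x y * a y)%:E < +oo)%E.
Proof.
apply: (@le_lt_trans _ _ (\int[mu]_y ((K x y * 1)%:E + (K x y * a y `^ p)%:E))%E).
  apply: ge0_le_integral => //=.
  - by move=> y _; rewrite lee_fin mulr_ge0.
  - by apply/measurable_EFinP; apply: measurable_funM => //; exact: mKl.
  - apply: emeasurable_funD; apply/measurable_EFinP; apply: measurable_funM => //;
      exact: mKl.
  by move=> y _; rewrite -EFinD lee_fin -mulrDr ler_wpM2l// ge0_le1powR.
rewrite ge0_integralD//=; last 4 first.
- by move=> y _; rewrite lee_fin mulr_ge0.
- by apply/measurable_EFinP; apply: measurable_funM => //; exact: mKl.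
- by move=> y _; rewrite lee_fin mulr_ge0// powR_ge0.
- by apply/measurable_EFinP; apply: measurable_funM => //; exact: mKl.
apply: lte_add_pinfty; first by rewrite (le_lt_trans (kernel_cst _ _))// ltry.
by rewrite (le_lt_trans (kernel_powR_le _)).
Qed.

(* Jensen's inequality, by integrating Young's inequality
   a m^(p-1) <= a^p / p + m^p / q against K at the mean m = (int K a) / M. *)
Lemma kernel_jensen x : ((M * (fine (\int[mu]_y (K x y * a y)%:E) / M) `^ p)%:E <=
  \int[mu]_y (K x y * a y `^ p)%:E)%E.
Proof.
set A := (\int[mu]_y (K x y * a y)%:E)%E.
have A0 : (0 <= A)%E by apply: integral_ge0 => y _; rewrite lee_fin mulr_ge0.
have Af : A \is a fin_num by rewrite ge0_fin_numE// kernel_fin.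
set G := (\int[mu]_y (K x y * a y `^ p)%:E)%E.
have G0 : (0 <= G)%E.
  by apply: integral_ge0 => y _; rewrite lee_fin mulr_ge0// powR_ge0.
have Gf : G \is a fin_num by rewrite ge0_fin_numE// (le_lt_trans (kernel_powR_le _)).
pose m := fine A / M.
have m0 : 0 <= m by rewrite divr_ge0 ?fine_ge0 ?(ltW M0).
have AE : A = (M * m)%:E.
  by rewrite /m mulrCA divff ?gt_eqF// mulr1 fineK.
have mp0 : 0 <= m `^ (p - 1) by exact: powR_ge0.
have : (A * (m `^ (p - 1))%:E <= G * (p^-1)%:E + (M * (m `^ p / q))%:E)%E.
  rewrite /A -ge0_integralZr//=; last 2 first.
  - by apply/measurable_EFinP; apply: measurable_funM => //; exact: mKl.
  - by move=> y _; rewrite lee_fin mulr_ge0.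
  rewrite /G -ge0_integralZr//=; last 3 first.
  - by apply/measurable_EFinP; apply: measurable_funM => //; exact: mKl.
  - by move=> y _; rewrite lee_fin mulr_ge0// powR_ge0.
  - by rewrite lee_fin invr_ge0 ltW.
  apply: (@le_trans _ _ (\int[mu]_y ((K x y * a y `^ p)%:E * (p^-1)%:E +
      (K x y * (m `^ p / q))%:E))%E).
    apply: ge0_le_integral => //=.
    - by move=> y _; rewrite -EFinM lee_fin !mulr_ge0.
    - apply: emeasurable_funM => //; apply/measurable_EFinP.
      by apply: measurable_funM => //; exact: mKl.
    - apply: emeasurable_funD.
        apply: emeasurable_funM => //; apply/measurable_EFinP.
        by apply: measurable_funM => //; exact: mKl.
      by apply/measurable_EFinP; apply: measurable_funM => //; exact: mKl.
    move=> y _; rewrite -!EFinM -EFinD lee_fin -!mulrA -mulrDr ler_wpM2l//.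
    have := conjugate_powR (a0 y) mp0 p0 q0 pq.
    rewrite -powRrM (_ : (p - 1) * q = p)//.
    move: pq => /(congr1 (fun z => p * q * z)).
    by rewrite mulrDr mulrAC divff ?gt_eqF// mulfK ?gt_eqF// mulr1 mul1r; lra.
  rewrite ge0_integralD//=; last 4 first.
  - by move=> y _; rewrite -EFinM lee_fin !mulr_ge0 ?powR_ge0// invr_ge0 ltW.
  - apply: emeasurable_funM => //; apply/measurable_EFinP.
    by apply: measurable_funM => //; exact: mKl.
  - by move=> y _; rewrite lee_fin mulr_ge0// divr_ge0 ?powR_ge0 ?ltW.
  - by apply/measurable_EFinP; apply: measurable_funM => //; exact: mKl.
  by rewrite leeD2l// kernel_cst// divr_ge0 ?powR_ge0 ?ltW.
rewrite -/m AE -(fineK Gf) -!EFinM -EFinD !lee_fin.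
rewrite -mulrA mulr_powRB1//.
have qE : q^-1 = 1 - p^-1 by move: pq; lra.
(* The integrated inequality reads [M m^p <= G / p + M m^p (1 - 1/p)]; what remains after
   cancellation is the claim divided by [p]. *)
rewrite qE; set X := m `^ p; set g := fine G => h.
have : M * X * p^-1 <= g * p^-1 by move: h; rewrite mulrBr mulr1 mulrBr mulrA; lra.
by rewrite ler_pM2r ?invr_gt0.
Qed.

Lemma kernel_conv_measurable :
  measurable_fun setT (fun x => \int[mu]_y (K x y * a y)%:E)%E.
Proof.
apply: (measurable_fun_fubini_tonelli_F (fun z : measurableTypeR R *
  measurableTypeR R => (K z.1 z.2 * a z.2)%:E)) => //=.
  apply/measurable_EFinP; apply: measurable_funM => //.
  exact: (measurableT_comp ma measurable_snd).
by move=> z; rewrite lee_fin mulr_ge0.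
Qed.

Lemma kernel_conv :
  (\int[mu]_x (fine (\int[mu]_y (K x y * a y)%:E) `^ p)%:E < +oo)%E.
Proof.
pose A x := fine (\int[mu]_y (K x y * a y)%:E).
have A0 x : 0 <= A x.
  by apply: fine_ge0; apply: integral_ge0 => y _; rewrite lee_fin mulr_ge0.
have mA : measurable_fun setT (fun x => A x `^ p).
  apply: (measurableT_comp (measurable_powR _)).
  apply: measurableT_comp => //; exact: kernel_conv_measurable.
have mG : measurable_fun setT (fun x => \int[mu]_y (K x y * a y `^ p)%:E)%E.
  apply: (measurable_fun_fubini_tonelli_F (fun z : measurableTypeR R *
    measurableTypeR R => (K z.1 z.2 * a z.2 `^ p)%:E)) => //=.
    apply/measurable_EFinP; apply: measurable_funM => //.
    exact: (measurableT_comp map measurable_snd).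
  by move=> z; rewrite lee_fin mulr_ge0// powR_ge0.
have c0 : 0 <= M `^ p / M by rewrite divr_ge0 ?powR_ge0 ?ltW.
(* Jensen bounds [M (A x / M)^p], and [A x ^ p] is [M^p / M] times that. Swapping the integrals then
   bounds the whole by the integral of [a^p]. *)
apply: (@le_lt_trans _ _ (\int[mu]_x ((M `^ p / M)%:E *
    \int[mu]_y (K x y * a y `^ p)%:E))%E).
  apply: ge0_le_integral => //=.
  - by move=> x _; rewrite lee_fin powR_ge0.
  - exact/measurable_EFinP.
  - exact: measurable_funeM.
  move=> x _; apply: (@le_trans _ _ ((M `^ p / M)%:E *
      (M * (A x / M) `^ p)%:E)%E).
    rewrite -EFinM lee_fin mulrA divfK ?gt_eqF// -powRM ?divr_ge0 ?(ltW M0)//.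
    by rewrite (mulrC M) divfK ?gt_eqF.
  by rewrite lee_wpmul2l ?lee_fin// kernel_jensen.
rewrite ge0_integralZl//=.
- rewrite lte_mul_pinfty// ?lee_fin//.
  apply: (le_lt_trans (kernel_swap _ _)) => //.
    by move=> x; exact: powR_ge0.
  by rewrite lte_mul_pinfty ?lee_fin ?ltW.
- by move=> x _; apply: integral_ge0 => y _; rewrite lee_fin mulr_ge0// powR_ge0.
Qed.

End Convolution.

End Schur.

(** * Weighted spaces of scalar functions *)

Section Weighted.
Context {R : realType}.
Local Notation mu := (@lebesgue_measure R).
Implicit Types (a b : R -> R) (c x y s : R).

Lemma integral_if (D : set R) (P : R -> bool) (g : R -> R) :
  (forall y, D y <-> P y) ->
  (\int[mu]_y (if P y then g y else 0%R)%:E = \int[mu]_(y in D) (g y)%:E)%E.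
Proof.
move=> DP; rewrite [RHS]integral_mkcond; apply: eq_integral => y _.
rewrite patchE; case: ifPn => [/DP Dy|nP]; first by rewrite mem_set.
by rewrite memNset// => /DP; exact/negP.
Qed.

(** The kernel [e^(omega (x - y))] of the state once the weight [e^(- lam s / p)] has been moved
    inside, which leaves the rate [c = lam / p - omega]. Its mass is at most [1 / c] in each
    variable; transposed, it serves the co-state. *)
Definition causal (t c x y : R) : R :=
  if (t <= y) && (y <= x) then expR (- c * (x - y)) else 0.

Lemma measurable_if_fun d (T : measurableType d) (P : T -> bool) (g : T -> R) :
  measurable_fun setT P -> measurable_fun setT g ->
  measurable_fun setT (fun z => if P z then g z else 0).
Proof. by move=> mP mg; apply: measurable_fun_ifT => //; exact: measurable_cst. Qed.

Lemma measurable_triangle t :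
  measurable_fun setT (fun z : measurableTypeR R * measurableTypeR R =>
    (t <= z.2) && (z.2 <= z.1)).
Proof.
by apply: measurable_and; apply: measurable_fun_ler => //; exact: measurable_snd.
Qed.

Lemma causal_measurable t c :
  measurable_fun setT
    (fun z : measurableTypeR R * measurableTypeR R => causal t c z.1 z.2).
Proof.
apply: measurable_if_fun; first exact: measurable_triangle.
apply: measurableT_comp => //; apply: measurable_funM => //.
by apply: measurable_funB; [exact: measurable_fst|exact: measurable_snd].
Qed.

Lemma causal_ge0 t c x y : 0 <= causal t c x y.
Proof. by rewrite /causal; case: ifP => // _; exact: expR_ge0. Qed.

Lemma causal_le1 t c x y : 0 < c -> causal t c x y <= 1.
Proof.
move=> c0; rewrite /causal; case: ifPn => // /andP[_ yx].
by rewrite -expR0 ler_expR mulNr oppr_le0 mulr_ge0 ?subr_ge0// ltW.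
Qed.

Lemma causal_int1 t c x : 0 < c ->
  (\int[mu]_y (causal t c x y)%:E <= (c^-1)%:E)%E.
Proof.
move=> c0; rewrite (integral_if (D := `[t, x])); last first.
  by move=> y /=; rewrite in_itv.
under eq_integral do rewrite mulNr -mulrN opprB.
exact: integral_exp_le.
Qed.

Lemma causal_int2 t c y : 0 < c ->
  (\int[mu]_x (causal t c x y)%:E <= (c^-1)%:E)%E.
Proof.
move=> c0; have [ty|yt] := leP t y; last first.
  rewrite integral0_eq ?lee_fin ?invr_ge0 ?(ltW c0)// => x _.
  by rewrite /causal leNgt yt.
under eq_integral do rewrite /causal ty andTb.
rewrite (integral_if (D := `[y, +oo[)); first by rewrite integral_exp_tail.
by move=> x /=; rewrite in_itv/= andbT.
Qed.

Lemma causal_swap_measurable t c :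
  measurable_fun setT
    (fun z : measurableTypeR R * measurableTypeR R => causal t c z.2 z.1).
Proof.
have := measurableT_comp (causal_measurable t c)
  (@measurable_swap _ _ (measurableTypeR R) (measurableTypeR R)).
by apply: eq_measurable_fun.
Qed.

Variables (t lam : R).

(** Scalar counterpart of [Lweighted], with the weight outside the power; vector-valued functions
    enter through their norm, by [Lweighted_Lw]. *)
Definition Lw p a := measurable_fun `[t, +oo[ a /\
  (\int[mu]_(s in `[t, +oo[) (expR (- lam * s) * `|a s| `^ p)%:E < +oo)%E.

(** Weighted modulus extended by 0 to the line, where the kernel bounds apply; by [wext_integral]
    its [p]-th power has the integral that defines [Lw]. *)
Definition wext p a s : R := if t <= s then expR (- lam * s / p) * `|a s| else 0.

Lemma expR_powR c p : expR c `^ p = expR (c * p).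
Proof. by rewrite expRM. Qed.

Lemma weightE p (z : R) s : 0 < p ->
  (expR (- lam * s / p) * `|z|) `^ p = expR (- lam * s) * `|z| `^ p.
Proof.
move=> p0; rewrite powRM ?expR_ge0// expR_powR divfK ?gt_eqF//.
Qed.

Lemma wext_ge0 p a s : 0 <= wext p a s.
Proof. by rewrite /wext; case: ifP => // _; rewrite mulr_ge0 ?expR_ge0. Qed.

Let mD : measurable (`[t, +oo[ : set R). Proof. by []. Qed.

Lemma measurable_ext (g : R -> R) : measurable_fun `[t, +oo[ g <->
  measurable_fun setT (fun s => if t <= s then g s else 0).
Proof.
have E : (fun s => if t <= s then g s else 0) = g \_ `[t, +oo[.
  apply/funext => s; rewrite patchE; case: ifPn => h.
    by rewrite mem_set//= in_itv/= h.
  by rewrite memNset//= in_itv/= andbT; exact/negP.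
by rewrite E; apply: measurable_restrictT.
Qed.

Lemma measurable_weight c : measurable_fun `[t, +oo[ (fun s : R => expR (c * s)).
Proof.
by apply: measurable_funTS; apply: measurableT_comp.
Qed.

Lemma measurable_weight' c p : measurable_fun `[t, +oo[ (fun s : R => expR (c * s / p)).
Proof.
apply: measurable_funTS; apply: measurableT_comp => //.
by apply: measurable_funM => //; exact: measurable_funM.
Qed.

Lemma wext_measurable p a : measurable_fun `[t, +oo[ a ->
  measurable_fun setT (wext p a).
Proof.
move=> ma; apply/(measurable_ext (fun s => expR (- lam * s / p) * `|a s|)).
apply: measurable_funM; first exact: measurable_weight'.
exact: measurableT_comp.
Qed.

Lemma wext_integral p a : 0 < p ->
  (\int[mu]_s (wext p a s `^ p)%:E =
   \int[mu]_(s in `[t, +oo[) (expR (- lam * s) * `|a s| `^ p)%:E)%E.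
Proof.
move=> p0; rewrite -(integral_if (P := fun s => t <= s) (D := `[t, +oo[)); last first.
  by move=> s /=; rewrite in_itv/= andbT.
apply: eq_integral => s _; rewrite /wext; case: ifP => // _.
  by rewrite weightE.
by rewrite powR0// gt_eqF.
Qed.

Lemma Lw_measurable_weight p a : measurable_fun `[t, +oo[ a ->
  measurable_fun `[t, +oo[ (fun s => expR (- lam * s) * `|a s| `^ p).
Proof.
move=> ma; apply: measurable_funM; first exact: measurable_weight.
apply: (measurableT_comp (measurable_powR _)).
exact: measurableT_comp.
Qed.

Lemma Lw_le p a b : 0 < p -> measurable_fun `[t, +oo[ a ->
  (forall s, t <= s -> `|a s| <= `|b s|) -> Lw p b -> Lw p a.
Proof.
move=> p0 ma ab [mb ib]; split; [exact: ma|apply: le_lt_trans ib].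
apply: ge0_le_integral => //=.
- by apply/measurable_EFinP; exact: Lw_measurable_weight.
- by apply/measurable_EFinP; exact: Lw_measurable_weight.
move=> s; rewrite in_itv/= andbT => ts; rewrite lee_fin ler_wpM2l ?expR_ge0//.
by rewrite ge0_ler_powR ?nnegrE ?ab// ltW.
Qed.

Lemma Lw_scale p c a : 0 < p -> Lw p a -> Lw p (fun s => c * a s).
Proof.
move=> p0 [ma ia]; split; first exact: measurable_funM.
under eq_integral do rewrite normrM powRM// mulrCA EFinM.
rewrite ge0_integralZl//=; last first.
  by apply/measurable_EFinP; exact: Lw_measurable_weight.
by rewrite lte_mul_pinfty// lee_fin powR_ge0.
Qed.

Lemma powRD_le p c x : 0 < p -> 0 <= c -> 0 <= x ->
  (c + x) `^ p <= 2 `^ p * (c `^ p + x `^ p).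
Proof.
move=> p0; wlog cx : c x / c <= x => [W|] c0 x0.
  have [/W/(_ c0 x0)//|/ltW/W/(_ x0 c0)] := leP c x.
  by rewrite addrC (addrC (x `^ p)).
apply: (@le_trans _ _ ((2 * x) `^ p)).
  by rewrite ge0_ler_powR ?nnegrE ?addr_ge0 ?mulr_ge0 ?(ltW p0)//; lra.
by rewrite powRM// ler_wpM2l ?powR_ge0// lerDr powR_ge0.
Qed.

Lemma Lw_add p a b : 0 < p -> Lw p a -> Lw p b -> Lw p (fun s => a s + b s).
Proof.
move=> p0 [ma ia] [mb ib]; split; first exact: measurable_funD.
have w0 g s : 0 <= expR (- lam * s) * `|g s : R| `^ p.
  by rewrite mulr_ge0 ?expR_ge0// powR_ge0.
apply: (@le_lt_trans _ _ (\int[mu]_(s in `[t, +oo[) ((2 `^ p)%:E *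
   ((expR (- lam * s) * `|a s| `^ p)%:E + (expR (- lam * s) * `|b s| `^ p)%:E)))%E).
  apply: ge0_le_integral => //=.
  - apply/measurable_EFinP; apply: Lw_measurable_weight; exact: measurable_funD.
  - apply: measurable_funeM; apply: emeasurable_funD;
      apply/measurable_EFinP; exact: Lw_measurable_weight.
  move=> s _; rewrite -EFinD -EFinM lee_fin -mulrDr mulrCA ler_wpM2l ?expR_ge0//.
  rewrite (le_trans _ (powRD_le _ _ _))// ge0_ler_powR ?nnegrE ?(ltW p0) ?addr_ge0//.
  exact: ler_normD.
rewrite ge0_integralZl//=; last 2 first.
- by apply: emeasurable_funD; apply/measurable_EFinP; exact: Lw_measurable_weight.
- by move=> s _; rewrite adde_ge0// lee_fin w0.
rewrite lte_mul_pinfty ?lee_fin ?powR_ge0// ge0_integralD//=.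
- exact: (lte_add_pinfty ia ib).
- by apply/measurable_EFinP; exact: Lw_measurable_weight.
- by apply/measurable_EFinP; exact: Lw_measurable_weight.
Qed.

Lemma Lw_exp p c : 0 < p -> c * p < lam -> Lw p (fun s => expR (c * (s - t))).
Proof.
move=> p0 cp; split.
  apply: measurable_funTS; apply: measurableT_comp => //.
  by apply: measurable_funM => //; exact: measurable_funB.
have d0 : 0 < lam - c * p by rewrite subr_gt0.
have E s : (expR (- lam * s) * `|expR (c * (s - t))| `^ p)%:E =
    ((expR (- lam * t))%:E * (expR (- (lam - c * p) * (s - t)))%:E)%E.
  rewrite ger0_norm ?expR_ge0// expR_powR -EFinM -!expRD.
  by congr (expR _)%:E; ring.
under eq_integral do rewrite E.
rewrite ge0_integralZl//=.
- by rewrite integral_exp_tail// -EFinM ltry.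
- apply/measurable_EFinP; apply: measurable_funTS; apply: measurableT_comp => //.
  by apply: measurable_funM => //; exact: measurable_funB.
Qed.

Lemma Lw_cst p c : 0 < p -> 0 < lam -> Lw p (fun=> c).
Proof.
move=> p0 l0; apply: (Lw_le p0 _ _ (Lw_scale c p0 (@Lw_exp p 0 p0 _))) => //.
  by move=> s _; rewrite mul0r expR0 mulr1.
by rewrite mul0r.
Qed.

(** For [lam > 0] the weight has finite mass on the half-line, so [|a|^r <= 1 + |a|^p] is enough. *)
Lemma Lw_exponent p r a : 0 < lam -> 0 < r -> r <= p -> Lw p a -> Lw r a.
Proof.
move=> l0 r0 rp [ma ia]; split; first exact: ma.
have p0 : 0 < p by apply: lt_le_trans rp.
have [_ i1] := Lw_cst 1 p0 l0.
apply: (@le_lt_trans _ _ (\int[mu]_(s in `[t, +oo[)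
   ((expR (- lam * s) * `|(1 : R)| `^ p)%:E + (expR (- lam * s) * `|a s| `^ p)%:E))%E).
  apply: ge0_le_integral => //=.
  - by apply/measurable_EFinP; apply: Lw_measurable_weight.
  - apply: emeasurable_funD; apply/measurable_EFinP; exact: Lw_measurable_weight.
  move=> s _; rewrite -EFinD lee_fin -mulrDr ler_wpM2l ?expR_ge0//.
  rewrite normr1 powR1; have [a1|a1] := leP `|a s| 1.
    apply: ler_wpDr; first exact: powR_ge0.
    have := @ge0_ler_powR _ r (ltW r0) `|a s| 1; rewrite powR1 !nnegrE.
    by apply.
  by rewrite ler_wpDl// ler_powR// ltW.
rewrite ge0_integralD//=.
- exact: (lte_add_pinfty i1 ia).
- by apply/measurable_EFinP; exact: Lw_measurable_weight.
- by apply/measurable_EFinP; exact: Lw_measurable_weight.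
Qed.

End Weighted.

(** * Convolution with exponentials in weighted spaces *)

Section Convolutions.
Context {R : realType}.
Local Notation mu := (@lebesgue_measure R).
Variables (t lam p q omega : R).
Hypotheses (p0 : 0 < p) (q0 : 0 < q) (pq : p^-1 + q^-1 = 1).
Implicit Types (a b : R -> R) (x y s : R).

Let mD : measurable (`[t, +oo[ : set R). Proof. by []. Qed.

(** Removes the weight: [A] is the kernel operator applied to the weighted function, [I] the
    unweighted convolution. On the half-line they differ by a positive finite factor, so finiteness
    and integrability pass from [A] to [I]. *)
Let transfer (A I : R -> \bar R) :
  (forall x, t <= x -> (A x = (expR (- lam * x / p))%:E * I x)%E) ->
  (forall x, t <= x -> (0 <= I x)%E) -> (forall x, (A x < +oo)%E) ->
  measurable_fun setT A -> (\int[mu]_x (fine (A x) `^ p)%:E < +oo)%E ->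
  (forall x, t <= x -> (I x < +oo)%E) /\ Lw t lam p (fine \o I).
Proof.
move=> AI I0 Af mA iA.
have If x : t <= x -> (I x < +oo)%E.
  move=> tx; have := Af x; rewrite AI//.
  case: (I x) (I0 x tx) => [r _ _|_|//]; first exact: ltry.
  by rewrite gt0_muley// lte_fin expR_gt0.
split => //.
have E x : t <= x -> fine (A x) = expR (- lam * x / p) * fine (I x).
  by move=> tx; rewrite AI// fineM// ge0_fin_numE ?I0 ?If.
split.
  apply: (@eq_measurable_fun _ _ _ _ _
    (fun x => (expR (- lam * x / p))^-1 * fine (A x))).
    move=> x; rewrite inE/= in_itv/= andbT => tx.
    by rewrite E// mulKf// gt_eqF// expR_gt0.
  apply: measurable_funM.
    apply: (@eq_measurable_fun _ _ _ _ _ (fun x => expR (lam * x / p))).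
      by move=> x _; rewrite /= -expRN -2!mulNr opprK.
    exact: measurable_weight'.
  by apply: measurable_funTS; exact: measurableT_comp.
apply: le_lt_trans iA.
apply: (@le_trans _ _ (\int[mu]_(x in `[t, +oo[) (fine (A x) `^ p)%:E)%E).
  rewrite le_eqVlt; apply/orP; left; apply/eqP.
  apply: eq_integral => x; rewrite inE/= in_itv/= andbT => tx.
  by rewrite E// -weightE//= (@ger0_norm _ (fine (I x))) ?fine_ge0 ?I0.
apply: ge0_subset_integral => //=.
  apply/measurable_EFinP; apply: (measurableT_comp (measurable_powR _)).
  exact: measurableT_comp.
by move=> x _; rewrite lee_fin powR_ge0.
Qed.

Section One.
Variable a : R -> R.
Hypothesis La : Lw t lam p a.

Let ma := La.1.
Let mw : measurable_fun setT (wext t lam p a). Proof. exact: wext_measurable. Qed.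
Let w0 := wext_ge0 t lam p a.
Let iw : (\int[mu]_s (wext t lam p a s `^ p)%:E < +oo)%E.
Proof. by rewrite wext_integral//; exact: La.2. Qed.

Lemma Lw_causal : omega * p < lam ->
  (forall x, t <= x ->
    (\int[mu]_(y in `[t, x]) (expR (omega * (x - y)) * `|a y|)%:E < +oo)%E) /\
  Lw t lam p (fun x => fine
    (\int[mu]_(y in `[t, x]) (expR (omega * (x - y)) * `|a y|)%:E)%E).
Proof.
move=> h; pose c := lam / p - omega.
have c0 : 0 < c by rewrite subr_gt0 ltr_pdivlMr.
have ci0 : 0 < c^-1 by rewrite invr_gt0.
apply: (@transfer (fun x => \int[mu]_y (causal t c x y * wext t lam p a y)%:E)%E).
- move=> x tx; rewrite -ge0_integralZl//=; last first.
    apply/measurable_EFinP; apply: measurable_funM.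
      apply: measurable_funTS; apply: measurableT_comp => //.
      by apply: measurable_funM => //; exact: measurable_funB.
    apply: measurableT_comp => //; apply: measurable_funS ma => //.
    by move=> y /=; rewrite !in_itv/= => /andP[-> _].
  rewrite -(@integral_if _ `[t, x] (fun y => (t <= y) && (y <= x))); last first.
    by move=> y /=; rewrite in_itv.
  apply: eq_integral => y _; rewrite /causal /wext; congr EFin.
  case: (leP t y) => ty/=; last by rewrite mul0r.
  case: ifP => _; last by rewrite mul0r.
  by rewrite !mulrA -!expRD; congr (expR _ * _); rewrite /c; ring.
- by move=> x _; apply: integral_ge0 => y _; rewrite lee_fin mulr_ge0 ?expR_ge0.
- move=> x; apply: (kernel_fin (M := c^-1) (p := p) (q := q) (causal_measurable t c)) => //.
  + by move=> *; exact: causal_ge0.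
  + by move=> *; exact: causal_le1.
  + by move=> *; exact: causal_int1.
- exact: (kernel_conv_measurable (K := causal t c) (causal_measurable t c)
    (causal_ge0 t c) mw w0).
apply: (kernel_conv (M := c^-1) (p := p) (q := q) (causal_measurable t c)) => //.
- by move=> *; exact: causal_ge0.
- by move=> *; exact: causal_le1.
- by move=> *; exact: causal_int1.
- by move=> *; exact: causal_int2.
Qed.

Lemma Lw_anticausal : omega < lam / q ->
  (forall x, t <= x -> (\int[mu]_(y in `[x, +oo[)
    (expR ((omega - lam) * (y - x)) * `|a y|)%:E < +oo)%E) /\
  Lw t lam p (fun x => fine (\int[mu]_(y in `[x, +oo[)
    (expR ((omega - lam) * (y - x)) * `|a y|)%:E)%E).
Proof.
(* The co-state kernel decays at rate [lam - omega], and the weight takes back [lam / p]; since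
   [1 - 1/p = 1/q], this rate is what remains. *)
move=> h; pose c := lam / q - omega.
have c0 : 0 < c by rewrite subr_gt0.
have cE : c = lam - lam / p - omega.
  rewrite /c; have -> : q^-1 = 1 - p^-1 by move: pq; lra.
  by rewrite mulrBr mulr1.
have ci0 : 0 < c^-1 by rewrite invr_gt0.
apply: (@transfer (fun x => \int[mu]_y (causal t c y x * wext t lam p a y)%:E)%E).
- move=> x tx; rewrite -ge0_integralZl//=; last first.
    apply/measurable_EFinP; apply: measurable_funM.
      apply: measurable_funTS; apply: measurableT_comp => //.
      by apply: measurable_funM => //; exact: measurable_funB.
    apply: measurableT_comp => //; apply: measurable_funS ma => //.
    by move=> y /=; rewrite !in_itv/= !andbT; exact: le_trans.
  rewrite -(@integral_if _ `[x, +oo[ (fun y => x <= y)); last first.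
    by move=> y /=; rewrite in_itv/= andbT.
  apply: eq_integral => y _; rewrite /causal /wext; congr EFin.
  rewrite tx/=; case: (leP x y) => xy/=; last by rewrite mul0r.
  rewrite (le_trans tx xy).
  by rewrite !mulrA -!expRD; congr (expR _ * _); rewrite cE; ring.
- by move=> x _; apply: integral_ge0 => y _; rewrite lee_fin mulr_ge0 ?expR_ge0.
- exact: (kernel_fin (K := fun x y => causal t c y x) (M := c^-1)
    (causal_swap_measurable t c) (fun x y => causal_ge0 t c y x)
    (fun x y => causal_le1 t y x c0) (fun x => causal_int2 t x c0) p0 q0 pq mw w0 iw).
- exact: (kernel_conv_measurable (K := fun x y => causal t c y x)
    (causal_swap_measurable t c) (fun x y => causal_ge0 t c y x) mw w0).
exact: (kernel_conv (K := fun x y => causal t c y x) (M := c^-1)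
  (causal_swap_measurable t c) (fun x y => causal_ge0 t c y x)
  (fun x y => causal_le1 t y x c0) ci0 (fun x => causal_int2 t x c0)
  (fun x => causal_int1 t x c0) p0 q0 pq mw w0 iw).
Qed.

End One.

(** Absolute integrability for the Fubini argument of [duality]. The weight [e^(- lam x)] splits
    between the exponents: [e^(- lam x / q)] goes to [b], and the rest, carried from [x] to [y], to
    [a] and the kernel. *)
Lemma Lw_pairing a b : Lw t lam p a -> Lw t lam q b -> omega * p < lam ->
  (\int[mu]_x \int[mu]_y (if (t <= y) && (y <= x) then
    (expR (- lam * x) * (expR (omega * (x - y)) * (`|a y| * `|b x|)))%R
    else 0%R)%:E < +oo)%E.
Proof.
move=> [ma ia] [mb ib] h; pose c := lam / p - omega.
have c0 : 0 < c by rewrite subr_gt0 ltr_pdivlMr.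
have ci0 : 0 < c^-1 by rewrite invr_gt0.
have := @kernel_pairing _ (causal t c) c^-1 p q (causal_measurable t c)
  (causal_ge0 t c) ci0 (fun x => causal_int1 t x c0) (fun x => causal_int2 t x c0)
  p0 q0 pq (wext t lam p a) (wext t lam q b) (wext_measurable _ _ ma)
  (wext_measurable _ _ mb) (wext_ge0 t lam p a) (wext_ge0 t lam q b).
rewrite !wext_integral// => /(_ ia ib).
congr (_ < _)%E; apply: eq_integral => x _; apply: eq_integral => y _.
congr EFin; rewrite /causal /wext.
case: (leP t y) => ty/=; last by rewrite mul0r.
case: (leP y x) => yx/=; last by rewrite mul0r.
rewrite (le_trans ty yx) [X in X = _](_ : _ =
  (expR (- c * (x - y)) * expR (- lam * y / p) * expR (- lam * x / q)) *
  (`|a y| * `|b x|)); last by ring.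
rewrite -!expRD mulrA -expRD; congr (expR _ * _).
have -> : q^-1 = 1 - p^-1 by move: pq; lra.
by rewrite /c; ring.
Qed.

End Convolutions.

(** * Convex differentiable functions and conjugates *)

Section ConvexDifferentiable.
Context {R : realType} {X : normedModType R}.
Variable f : X -> R.
Hypothesis fconv : @convex_function R X setT f.

Lemma convexE (x y : X) (h : R) : 0 <= h -> h <= 1 ->
  f (h *: x + (1 - h) *: y) <= h * f x + (1 - h) * f y.
Proof.
move=> h0 h1; have := fconv (Itv01 h0 h1) (x := x) (y := y).
by rewrite !inE => /(_ Logic.I Logic.I).
Qed.

Lemma gradient_ineq x z : differentiable (f : X -> R^o) x ->
  f x + 'd (f : X -> R^o) x (z - x) <= f z.
Proof.
move=> df; have /cvg_ex[l hl] : derivable (f : X -> R^o) x (z - x).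
  exact: diff_derivable.
have lE : l = 'd (f : X -> R^o) x (z - x).
  by rewrite -deriveE//; apply/esym/cvg_lim.
rewrite -lE -lerBrDl; apply/ler_addgt0Pr => e e0.
have /(@cvgrPdist_le R R^o)/(_ e e0)[d /= d0 hd] := hl.
pose h := Num.min (d / 2) 1.
have h0 : 0 < h by rewrite lt_min divr_gt0//= ltr01.
have h1 : h <= 1 by rewrite ge_min lexx orbT.
have hh : h < d.
  by rewrite gt_min ltr_pdivrMr// ltr_pMr// ltr1n.
have := hd h; rewrite /ball/= sub0r normrN gtr0_norm// => /(_ hh (lt0r_neq0 h0)).
rewrite ler_norml => /andP[_]; rewrite lerBlDr => /le_trans; apply.
rewrite addrC lerD2r -[_ *: _]/(h^-1 * _) ler_pdivrMl//.
have -> : h *: (z - x) + x = h *: z + (1 - h) *: x.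
  by rewrite scalerBr scalerBl scale1r addrAC -addrA.
have := convexE z x (ltW h0) h1; lra.
Qed.

(** Apply the gradient inequality at [z] instead of [x], then compare the two differentials. The
    constant is [k] and not [k / 2], but nothing has to be integrated along the segment. *)
Lemma descent_ineq (k : R) x z : (forall x, differentiable (f : X -> R^o) x) ->
  (forall x y h : X, `|'d (f : X -> R^o) x h - 'd (f : X -> R^o) y h| <=
    k * `|x - y| * `|h|) ->
  f z <= f x + 'd (f : X -> R^o) x (z - x) + k * `|z - x| ^+ 2.
Proof.
move=> df dk; have := gradient_ineq x (df z).
have := dk z x (z - x); rewrite ler_norml => /andP[_].
rewrite -(opprB z x) linearN -mulrA -expr2; move: ('d _ _ _) ('d _ _ _) => A B; lra.
Qed.

Lemma differential_bounded x : differentiable (f : X -> R^o) x ->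
  exists2 r, 0 < r & forall v : X, `|'d (f : X -> R^o) x v| <= r * `|v|.
Proof.
move=> df; apply: linear_continuous_bounded.
  by move=> a u v; exact: linearP.
exact: diff_continuous.
Qed.

End ConvexDifferentiable.

Section Gradient.
Context {R : realType} {V : hilbertType R}.
Variables (g : dual V -> R) (dg : dual V -> V).
Hypothesis gS : Sigma0 g.
Hypothesis dgP : is_predual_derivative g dg.

Lemma predual_gradient : exists2 k : R, 0 <= k &
  [/\ forall x y, `|dg x - dg y| <= k * `|x - y|,
      forall x z, g x + (z - x) (dg x) <= g z &
      forall x z, g z <= g x + (z - x) (dg x) + k * `|z - x| ^+ 2].
Proof.
case: gS => gc gd [k hk]; exists `|k| => //; split.
- move=> x y; apply: predual_norm_le => [|f]; first by rewrite mulr_ge0.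
  rewrite dualB -!dgP (le_trans (hk _ _ _))// ler_wpM2r// ler_wpM2r//.
  exact: ler_norm.
- by move=> x z; rewrite -dgP; exact: gradient_ineq.
move=> x z; rewrite -dgP (le_trans (descent_ineq gc x z gd hk))//.
by rewrite lerD2l ler_wpM2r ?sqr_ge0// ler_norm.
Qed.

Lemma Sigma0_continuous : continuous (g : dual V -> R^o).
Proof. by case: gS => _ gd _ x; exact: differentiable_continuous. Qed.

End Gradient.

(** * The gradient of the conjugate inverts the subdifferential *)

Section Conjugate.
Context {R : realType} {U : hilbertType R}.
Variable h0 : U -> R.
Hypothesis h0_lsc : lower_semicontinuous (fun u => (h0 u)%:E).
Hypothesis conj0 : convex_conjugate h0 0 = 0%E.
Hypothesis conj_fin : forall s : U, convex_conjugate h0 s \is a fin_num.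
Hypothesis conjS : Sigma0 (fun s : U => fine (convex_conjugate h0 s)).
Let hs (s : U) : R := fine (convex_conjugate h0 s).

Lemma fenchel_young s u : dot s u - h0 u <= hs s.
Proof.
rewrite -lee_fin fineK//; apply: ereal_sup_ubound.
by exists u.
Qed.

Let almost_maximizer s e : 0 < e -> exists u, hs s - e <= dot s u - h0 u.
Proof.
move=> e0; apply: contrapT => /forallNP h.
have : (convex_conjugate h0 s <= (hs s - e)%:E)%E.
  apply: ge_ereal_sup => _ [u _ <-]; rewrite lee_fin.
  by have /negP := h u; rewrite -ltNge => /ltW.
by rewrite -(fineK (conj_fin s)) lee_fin /hs; move: (fine _) => z; lra.
Qed.

Lemma cost_ge0 u : 0 <= h0 u.
Proof. by have := fenchel_young 0 u; rewrite /hs conj0 /= dot0l sub0r oppr_le0. Qed.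

Let gradient_ex s : exists v, forall w,
  'd (hs : U -> R^o) s w = dot v w.
Proof.
case: conjS => hc hd _; have [r r0 hr] := differential_bounded (hd s).
have [f fE] : exists f : dual U, forall w, f w = 'd (hs : U -> R^o) s w.
  apply: (@dualP _ _ ('d (hs : U -> R^o) s : U -> R^o) r) => //.
  by move=> a u v; exact: linearP.
by exists (riesz f) => w; rewrite rieszE fE.
Qed.

(** The gradient of the conjugate as a vector. By [subdifferential_gradient] and
    [gradient_subdifferential], it is the only point at which [s] is a subgradient of [h0]. *)
Definition conj_gradient s : U := sval (cid (gradient_ex s)).
Local Notation G := conj_gradient.

Let GE s w : 'd (hs : U -> R^o) s w = dot (G s) w.
Proof. by rewrite /G; case: cid. Qed.

Lemma conj_gradient_props : exists2 k : R, 0 <= k &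
  (forall x y, `|G x - G y| <= k * `|x - y|) /\
  (forall x z, hs z <= hs x + dot (G x) (z - x) + k * `|z - x| ^+ 2).
Proof.
case: conjS => hc hd [k hk]; exists `|k| => //; split.
  move=> x y; apply: dot_norm_le => [|w]; first by rewrite mulr_ge0.
  rewrite dotBl -!GE (le_trans (hk _ _ _))// ler_wpM2r// ler_wpM2r//.
  exact: ler_norm.
move=> x z; rewrite -GE (le_trans (descent_ineq hc x z hd hk))//.
by rewrite lerD2l ler_wpM2r ?sqr_ge0// ler_norm.
Qed.

(* Almost maximizers of dot s u - h0 u are close to the gradient: perturb s in
   the direction u - G s. *)
Let maximizer_close s : exists2 k : R, 0 <= k & forall u (e d : R), 0 < d ->
  hs s - e <= dot s u - h0 u -> d * `|u - G s| <= k * d ^+ 2 + e.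
Proof.
have [k k0 [_ hk]] := conj_gradient_props; exists k => // u e d d0 hu.
have [->|uG] := eqVneq u (G s).
  rewrite subrr normr0 mulr0; have := fenchel_young s u.
  by have := mulr_ge0 k0 (sqr_ge0 d); lra.
have n0 : 0 < `|u - G s| by rewrite normr_gt0 subr_eq0.
pose w := (d / `|u - G s|) *: (u - G s).
have nw : `|w| = d.
  by rewrite normrZ normrM normfV normr_id gtr0_norm// divfK// gt_eqF.
have := hk s (s + w); have := fenchel_young (s + w) u.
have -> : s + w - s = w by rewrite addrAC subrr add0r.
rewrite dotDl nw => h1 h2.
have wE : dot w u - dot (G s) w = d * `|u - G s|.
  rewrite (dotC _ w) -dotBr dotZl dotxx expr2 mulrA divfK//.
  by rewrite gt_eqF.
by rewrite -wE; lra.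
Qed.

(** A subgradient makes [u] an exact maximizer, so [maximizer_close] holds with error 0 and [d] can
    tend to 0. *)
Lemma subdifferential_gradient s u :
  subdifferential h0 u s -> u = G s.
Proof.
move=> us; have [k k0 hk] := maximizer_close s.
have hu : hs s - 0 <= dot s u - h0 u.
  rewrite subr0; apply/ler_addgt0Pr => e e0.
  have [v hv] := almost_maximizer s e0.
  by have := us v; rewrite dotBr; lra.
apply/eqP; rewrite -subr_eq0 -normr_le0; apply/ler_addgt0Pr => e e0.
have d0 : 0 < e / (k + 1) by rewrite divr_gt0// ltr_wpDl.
have := hk u 0 _ d0 hu; rewrite addr0 expr2 mulrCA ler_pM2l// add0r => /le_trans; apply.
rewrite mulrCA ler_piMr ?(ltW e0)// ler_pdivrMr ?ltr_wpDl// mul1r lerDl//.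
Qed.

(** Almost maximizers converge in norm to [G s] by [maximizer_close], so lower semicontinuity of
    [h0] in norm is enough for the supremum to be attained. By contradiction, with the level [al]
    halfway across the supposed gap between [c] and [h0 (G s)]. *)
Lemma gradient_attains s : hs s <= dot s (G s) - h0 (G s).
Proof.
have [k k0 hk] := maximizer_close s.
rewrite leNgt; apply/negP => gap.
pose c := dot s (G s) - hs s.
have ch : c < h0 (G s) by rewrite /c; move: gap; lra.
pose al := (c + h0 (G s)) / 2.
have [|W WG hW] := h0_lsc (x := G s) (a := al).
  by rewrite lte_fin /al; move: ch; lra.
have /nbhs_ballP[rho /= rho0 hrho] := WG.
(* With [d] and [e] below, [k d] and [e / d] are at most [r / 4], so [u] is within [r] of [G s]. The
   error in [dot s] is at most a quarter of the gap and [e] at most an eighth: [h0 u] stays below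
   [c] plus three eighths of the gap, under [al]. *)
pose r := Num.min rho ((h0 (G s) - c) / (4 * (`|s| + 1))).
have s1 : 0 < `|s| + 1 by rewrite ltr_wpDl.
have r0 : 0 < r by rewrite lt_min rho0 divr_gt0 ?subr_gt0// mulr_gt0.
pose d := r / (4 * (k + 1)).
have k1 : 0 < k + 1 by rewrite ltr_wpDl.
have d0 : 0 < d by rewrite divr_gt0// mulr_gt0.
pose e := Num.min (d * (r / 4)) ((h0 (G s) - c) / 8).
have gc0 : 0 < h0 (G s) - c by rewrite subr_gt0.
have e0 : 0 < e.
  by rewrite lt_min (divr_gt0 gc0)// andbT mulr_gt0// divr_gt0.
have [u hu] := almost_maximizer s e0.
have := hk u e d d0 hu.
have e1 : e <= d * (r / 4) by rewrite ge_min lexx.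
have kd : k * d <= r / 4.
  rewrite /d mulrCA ler_pM2l// ler_pdivrMr ?mulr_gt0// mulrA mulVf ?mul1r ?lerDl//.
rewrite expr2 mulrA => h1.
have h2 : `|u - G s| <= r / 4 + r / 4.
  rewrite -(ler_pM2l d0) (le_trans h1)// mulrDr lerD// mulrC.
  by rewrite ler_pM2l.
have ur : `|u - G s| < r by apply: le_lt_trans h2 _; move: r0; lra.
have Wu : W u.
  apply: hrho; rewrite -ball_normE/= distrC (lt_le_trans ur)//.
  by rewrite ge_min lexx.
have := hW u Wu; rewrite lte_fin /al => hal.
have h3 : dot s (u - G s) <= (h0 (G s) - c) / 4.
  rewrite (le_trans (ler_norm _))// (le_trans (CauchySchwarz _ _))//.
  have ur2 : `|u - G s| <= (h0 (G s) - c) / (4 * (`|s| + 1)).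
    by rewrite (le_trans (ltW ur))// ge_min lexx orbT.
  rewrite (le_trans (ler_wpM2l (normr_ge0 s) ur2))//.
  have g0 : 0 <= (h0 (G s) - c) / 4 by rewrite divr_ge0// subr_ge0 ltW.
  move: s1 g0; move: `|s| (h0 (G s) - c) => S gg s1 g0.
  have -> : S * (gg / (4 * (S + 1))) = gg / 4 * (S / (S + 1)).
    by field; rewrite gt_eqF.
  by rewrite ler_piMr// ler_pdivrMr// mul1r lerDl.
have e2 : e <= (h0 (G s) - c) / 8 by rewrite ge_min lexx orbT.
have cE : c = dot s (G s) - hs s by [].
move: h3; rewrite dotBr; clearbody c e; lra.
Qed.

Lemma gradient_subdifferential s : subdifferential h0 (G s) s.
Proof.
move=> w; have := gradient_attains s; have := fenchel_young s w.
by rewrite dotBr; lra.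
Qed.

Lemma cost_gradient0 : h0 (G 0) = 0.
Proof.
apply/eqP; rewrite eq_le cost_ge0 andbT.
by have := gradient_attains 0; rewrite /hs conj0/= dot0l sub0r oppr_ge0.
Qed.

End Conjugate.

(** * States, co-states and duality *)

Lemma separable_real (R : realType) : separable R^o.
Proof.
exists (range (@ratr R)).
  by apply: (sub_countable (card_image_le _ _)); exact: countableP.
exact: dense_rat.
Qed.

(** Positive and negative parts are handled separately, so no integrability is required of the
    sections. *)
Lemma measurable_integral_param d1 d2 (T1 : measurableType d1)
    (T2 : measurableType d2) (R : realType)
    (m2 : {sigma_finite_measure set T2 -> \bar R}) (f : T1 * T2 -> \bar R) :
  measurable_fun setT f ->
  measurable_fun setT (fun x => \int[m2]_y f (x, y))%E.
Proof.
move=> mf.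
have -> : (fun x => \int[m2]_y f (x, y))%E =
    ((fun x => \int[m2]_y f^\+ (x, y)) \- (fun x => \int[m2]_y f^\- (x, y)))%E.
  apply/funext => x; rewrite [LHS]integralE.
  under eq_integral do rewrite funepos_comp/=.
  by under [X in (_ - X = _)%E]eq_integral do rewrite funeneg_comp/=.
apply: emeasurable_funB.
  by apply: measurable_fun_fubini_tonelli_F => //; exact: measurable_funepos.
by apply: measurable_fun_fubini_tonelli_F => //; exact: measurable_funeneg.
Qed.

Lemma continuous_comp_pair (R : realType) (X Y Z : normedModType R) (W : topologicalType)
    (f : W -> X) (g : W -> Y) (F : X * Y -> Z) :
  continuous f -> continuous g -> continuous F ->
  continuous (fun w => F (f w, g w)).
Proof.
move=> cf cg cF w.
have h : (f z, g z) @[z --> w] --> (f w, g w) by exact: (cvg_pair (cf w) (cg w)).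
exact: (cvg_comp _ _ h (cF _)).
Qed.

Lemma dot_continuous (R : realType) (U : hilbertType R) :
  continuous (fun z : U * U => dot z.1 z.2 : R^o).
Proof.
move=> [a0 b0]; apply/cvgrPdist_le => e e0 /=.
pose M := `|a0| + `|b0| + 1.
have M0 : 0 < M by rewrite ltr_wpDl// addr_ge0.
have e2 : 0 < Num.min 1 (e / (2 * M)) by rewrite lt_min ltr01 divr_gt0// mulr_gt0.
exists (ball a0 (Num.min 1 (e / (2 * M))), ball b0 (Num.min 1 (e / (2 * M)))) => /=.
  by split; apply: nbhsx_ballx.
move=> [a b] [/=]; rewrite -!ball_normE/= !lt_min => /andP[a1 ae] /andP[b1 be].
have -> : dot a0 b0 - dot a b = dot (a0 - a) b0 + dot a (b0 - b).
  by rewrite dotBl dotBr; lra.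
have Me : M * (e / (2 * M)) = e / 2 by field; rewrite gt_eqF.
rewrite (splitr e) (le_trans (ler_normD _ _))// lerD//.
  rewrite (le_trans (CauchySchwarz _ _))// mulrC -Me ler_pM ?(ltW ae)//.
  by rewrite /M addrAC lerDr addr_ge0.
rewrite (le_trans (CauchySchwarz _ _))// -Me ler_pM ?(ltW be)//.
have : `|a| <= `|a0| + `|a0 - a|.
  by rewrite -{1}(subKr a0 a) ler_normB.
by have := normr_ge0 b0; rewrite /M; move: a1; lra.
Qed.

Lemma dual_norming (R : realType) (V : normedModType R) (q : nat -> V) (f : dual V) c :
  (forall x (e : R), 0 < e -> exists n, `|x - q n| < e) -> 0 <= c ->
  `|f| <= c <-> forall n, `|f (q n)| <= c * `|q n|.
Proof.
move=> qd c0; split=> [fc n|h].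
  by rewrite (le_trans (dual_le _ _))// ler_wpM2r.
apply: dual_norm_le => // v; apply/ler_addgt0Pr => e e0.
have d0 : 0 < e / (`|f| + c + 1) by rewrite divr_gt0// ltr_wpDl// addr_ge0.
have [n hn] := qd v _ d0.
have h1 : `|f (v - q n)| <= `|f| * `|v - q n| by exact: dual_le.
have h2 : `|q n| <= `|v| + `|v - q n| by rewrite -{1}(subKr v (q n)) ler_normB.
have h3 : `|f v| <= `|f (v - q n)| + `|f (q n)|.
  have -> : f v = f (v - q n) + f (q n) by rewrite -dualD subrK.
  exact: ler_normD.
have h4 : (`|f| + c) * `|v - q n| <= e.
  rewrite (le_trans (ler_wpM2l _ (ltW hn))) ?addr_ge0//.
  rewrite mulrCA ler_piMr ?(ltW e0)// ler_pdivrMr ?mul1r ?lerDl//.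
  by rewrite ltr_wpDl// addr_ge0.
have := h n; have := ler_wpM2l c0 h2; rewrite mulrDr; move: h4; rewrite mulrDl; lra.
Qed.

Lemma borel_ext (R : realType) (X : normedModType R) (t : R) (f : R -> X) :
  borel `[t, +oo[ f -> borel setT (fun s => if t <= s then f s else 0).
Proof.
have mD : measurable (`[t, +oo[ : set R) by [].
move=> /(borelP _ mD) bf; apply/(borelP _ measurableT) => O oO.
have -> : [set: R] `&` (fun s => if t <= s then f s else 0) @^-1` O =
    (`[t, +oo[ `&` f @^-1` O) `|` (`]-oo, t[ `&` (fun=> 0 : X) @^-1` O).
  apply/seteqP; split=> s /=; rewrite !in_itv/= andbT; last first.
    by case=> [[-> //]|[st Os]]; split => //; rewrite leNgt st.
  by move=> [_]; case: leP => h Os; [left|right].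
apply: measurableU; first exact: bf.
by apply: measurableI => //; rewrite preimage_cst; case: ifP.
Qed.

(** * Weak form of states and co-states *)

Section Operators.
Context {R : realType} {V U : hilbertType R}.
Variables (S : R -> dual V -> dual V) (S1 : R -> V -> V).
Variables (B : U -> dual V) (Bs : V -> U) (omega beta : R).
Hypothesis SC : C0_semigroup S.
Hypothesis S1C : C0_semigroup S1.
Hypothesis adj : forall (s : R) x v, 0 <= s -> S s x v = x (S1 s v).
Hypothesis gS : forall (s : R) x, 0 <= s -> `|S s x| <= expR (omega * s) * `|x|.
Hypothesis gS1 : forall (s : R) v, 0 <= s -> `|S1 s v| <= expR (omega * s) * `|v|.
Hypothesis B_linear : linear B.
Hypothesis beta0 : 0 <= beta.
Hypothesis B_bound : forall u, `|B u| <= beta * `|u|.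
Hypothesis BsP : is_control_adjoint B Bs.
Hypothesis sepV : separable V.
Hypothesis sepU : separable U.
Local Notation mu := (@lebesgue_measure R).

Lemma Bs_linear : linear Bs.
Proof.
move=> a v w; apply: dot_eqP => u.
by rewrite dotDl dotZl -!BsP dualD dualZ.
Qed.

Lemma Bs_bound v : `|Bs v| <= beta * `|v|.
Proof.
apply: dot_norm_le => [|u]; first by rewrite mulr_ge0.
rewrite -BsP (le_trans (dual_le _ _))// mulrAC ler_wpM2r//.
Qed.

Lemma Bs_continuous : continuous Bs.
Proof. exact: (linear_bound_continuous Bs_linear Bs_bound). Qed.

Lemma B_continuous : continuous B.
Proof. exact: (linear_bound_continuous B_linear B_bound). Qed.

Lemma input_adjoint s u v : 0 <= s -> S s (B u) v = dot (Bs (S1 s v)) u.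
Proof. by move=> s0; rewrite adj// BsP. Qed.

Lemma S1_joint_continuous : continuous (fun p : R^o * V => S1 `|p.1| p.2).
Proof. exact: (sg_joint_continuous S1C (growth_locally_bounded gS1)). Qed.

Lemma input_continuous : continuous (fun p : R^o * U => S `|p.1| (B p.2)).
Proof.
have c := sg_joint_continuous SC (growth_locally_bounded gS).
apply: (@continuous_comp_pair R R^o _ _ _ (fst : R^o * U -> R^o)
  (fun p : R^o * U => B p.2) _ _ _ c) => p; first exact: cvg_fst.
by apply: (cvg_comp _ _ cvg_snd); exact: B_continuous.
Qed.

Section JointMeasurability.
Context d (T : measurableType d).
Implicit Types (D : set T) (a : T -> R) (G : T -> V) (w : T -> U).

Lemma borel_costate D a G : measurable D -> measurable_fun D a -> borel D G ->
  borel D (fun z => S1 `|a z| (G z)).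
Proof.
move=> mD ma bG; apply: (borel_pair (f := a : T -> R^o) _ sepV mD S1_joint_continuous _ bG).
  exact: separable_real.
exact/borel_real.
Qed.

Lemma borel_input D a w : measurable D -> measurable_fun D a -> borel D w ->
  borel D (fun z => S `|a z| (B (w z))).
Proof.
move=> mD ma bw; apply: (borel_pair (f := a : T -> R^o) _ sepU mD input_continuous _ bw).
  exact: separable_real.
exact/borel_real.
Qed.

Lemma measurable_dual_costate D a G (x : dual V) : measurable D ->
  measurable_fun D a -> borel D G ->
  measurable_fun D (fun z => x (S1 `|a z| (G z)) : R).
Proof.
move=> mD ma bG; apply/(borel_real _ mD).
by apply: (borel_comp (Y := R^o) mD (@dual_continuous _ _ x)); exact: borel_costate.
Qed.

Lemma measurable_kernel D a G w : measurable D ->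
  measurable_fun D a -> borel D G -> borel D w ->
  measurable_fun D (fun z => dot (Bs (S1 `|a z| (G z))) (w z) : R).
Proof.
move=> mD ma bG bw; apply/(borel_real _ mD).
apply: (borel_pair (Z := R^o) (F := fun z => dot z.1 z.2) sepU sepU mD
  (@dot_continuous R U) _ bw).
by apply: (borel_comp mD Bs_continuous); exact: borel_costate.
Qed.

End JointMeasurability.

Variables (t lam m m' : R).
Hypotheses (m0 : 0 < m) (m'0 : 0 < m') (mm' : m^-1 + m'^-1 = 1).
Hypothesis om : omega * m < lam.

Section State.
Variable u : R -> U.
Hypothesis bu : borel `[t, +oo[ u.
Hypothesis Lu : Lw t lam m (fun r => `|u r|).

(** Majorant, up to [beta], of the part of the state due to the control. The repeated norm matches
    [Lw_causal] applied to the scalar function [|u|]. *)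
Definition input_bound s : R := fine
  (\int[mu]_(r in `[t, s]) (expR (omega * (s - r)) * `| `|u r| |)%:E)%E.

Lemma state_integrand s : borel `[t, s] (fun r => S (s - r) (B (u r))).
Proof.
have mI : measurable (`[t, s] : set R) by [].
have bI : borel `[t, s] (fun r => S `|s - r| (B (u r))).
  apply: borel_input => //; first exact: measurable_funB.
  apply: borel_subset bu => // r /=.
  by rewrite !in_itv/= => /andP[-> _].
apply: eq_measurable_fun bI => r; rewrite inE/= in_itv/= => /andP[_ rs].
by rewrite ger0_norm ?subr_ge0.
Qed.

Lemma input_bound_fin s : t <= s ->
  mu.-integrable `[t, s] (EFin \o (fun r => expR (omega * (s - r)) * `|u r|)).
Proof.
move=> ts; have mI : measurable (`[t, s] : set R) by [].
have mu_ : measurable_fun `[t, s] (fun r => `|u r|).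
  apply: borel_norm => //; apply: borel_subset bu => // r /=.
  by rewrite !in_itv/= => /andP[-> _].
apply/integrableP; split.
  apply/measurable_EFinP; apply: measurable_funM => //.
  apply: measurableT_comp => //; apply: measurable_funM => //.
  exact: measurable_funB.
have [h _] := Lw_causal m0 m'0 mm' Lu om.
apply: le_lt_trans (h s ts); rewrite le_eqVlt; apply/orP; left; apply/eqP.
by apply: eq_integral => r _ /=; rewrite normrM normr_id (ger0_norm (expR_ge0 _)).
Qed.

Lemma input_boundE s : t <= s ->
  input_bound s = \int[mu]_(r in `[t, s]) (expR (omega * (s - r)) * `|u r|).
Proof. by move=> ts; rewrite /input_bound; under eq_integral do rewrite normr_id. Qed.

Lemma input_bound_ge0 s : 0 <= input_bound s.
Proof.
by apply: fine_ge0; apply: integral_ge0 => r _; rewrite lee_fin mulr_ge0 ?expR_ge0.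
Qed.

Lemma state_norm_le s r : r <= s ->
  `|S (s - r) (B (u r))| <= beta * (expR (omega * (s - r)) * `|u r|).
Proof.
move=> rs; rewrite (le_trans (gS _ _))// ?subr_ge0// mulrCA.
by rewrite ler_wpM2l ?expR_ge0.
Qed.

Lemma state_integrable s : t <= s ->
  mu.-integrable `[t, s] (EFin \o (fun r => `|S (s - r) (B (u r))|)).
Proof.
move=> ts; have mI : measurable (`[t, s] : set R) by [].
apply: (@le_integrable _ _ R mu `[t, s] mI _
  (fun r => beta%:E * (expR (omega * (s - r)) * `|u r|)%:E)%E).
- by apply/measurable_EFinP; apply: borel_norm => //; exact: state_integrand.
- move=> r; rewrite /= in_itv/= => /andP[_ rs]; rewrite lee_fin normr_id.
  by rewrite (le_trans (state_norm_le rs))// ler_norm.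
by apply: integrableZl => //; exact: input_bound_fin.
Qed.

Lemma eval_linear (v : V) : linear (fun f : dual V => f v : R^o).
Proof. by []. Qed.

Lemma eval_bound (v : V) (f : dual V) : `|(f v : R^o)| <= `|v| * `|f|.
Proof. by rewrite mulrC dual_le. Qed.

Lemma state_weak_integrable s v : t <= s ->
  mu.-integrable `[t, s] (EFin \o (fun r => dot (Bs (S1 (s - r) v)) (u r))).
Proof.
move=> ts; have mI : measurable (`[t, s] : set R) by [].
have := functional_integrable (eval_linear v) (eval_bound v) mI (@state_integrand s)
  (state_integrable ts).
apply: eq_integrable => // r; rewrite inE/= in_itv/= => /andP[_ rs].
by rewrite /= input_adjoint// subr_ge0.
Qed.

Lemma state_weak s (z : dual V) : t <= s ->
  is_bochner_integral `[t, s] (fun r => S (s - r) (B (u r))) z ->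
  forall v, z v = \int[mu]_(r in `[t, s]) dot (Bs (S1 (s - r) v)) (u r).
Proof.
move=> ts hz v; have mI : measurable (`[t, s] : set R) by [].
rewrite -(bochner_weak mI hz (eval_linear v) (eval_bound v)).
apply: eq_Rintegral => r; rewrite inE/= in_itv/= => /andP[_ rs].
by rewrite input_adjoint// subr_ge0.
Qed.

Lemma state_bochner s (z : dual V) : t <= s ->
  (forall v, z v = \int[mu]_(r in `[t, s]) dot (Bs (S1 (s - r) v)) (u r)) ->
  is_bochner_integral `[t, s] (fun r => S (s - r) (B (u r))) z.
Proof.
move=> ts hz; have mI : measurable (`[t, s] : set R) by [].
have [q qd] := separable_seq (separable_dual sepV).
apply: (@bochner_exists _ _ _ _ q mI (@state_integrand s) (state_integrable ts) qd V
  (fun v (f : dual V) => f v : R^o) (fun v => `|v|)).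
- exact: eval_linear.
- by [].
- exact: eval_bound.
- by move=> f c c0 h; exact: dual_norm_le.
move=> v; rewrite hz; apply: eq_Rintegral => r; rewrite inE/= in_itv/= => /andP[_ rs].
by rewrite input_adjoint// subr_ge0.
Qed.

Lemma state_weak_bound s v : t <= s ->
  `|\int[mu]_(r in `[t, s]) dot (Bs (S1 (s - r) v)) (u r)| <=
  beta * input_bound s * `|v|.
Proof.
move=> ts; have mI : measurable (`[t, s] : set R) by [].
rewrite (le_trans (le_normr_Rintegral _ _))//.
  exact: state_weak_integrable.
rewrite input_boundE// mulrAC -RintegralZl//; last exact: input_bound_fin.
apply: le_Rintegral => //.
- by apply: integrable_norm; exact: state_weak_integrable.
- apply: (@eq_integrable _ _ R mu `[t, s] mI (fun r => (beta * `|v|)%:E *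
    (expR (omega * (s - r)) * `|u r|)%:E)%E) => //.
  by apply: integrableZl => //; exact: input_bound_fin.
move=> r; rewrite /= in_itv/= => /andP[_ rs].
rewrite -input_adjoint ?subr_ge0// (le_trans (dual_le _ _))//.
by rewrite mulrAC ler_wpM2r// state_norm_le.
Qed.

Lemma state_exists s : t <= s -> exists z : dual V,
  forall v, z v = \int[mu]_(r in `[t, s]) dot (Bs (S1 (s - r) v)) (u r).
Proof.
move=> ts; have mI : measurable (`[t, s] : set R) by [].
apply: (@dualP _ _ (fun v => \int[mu]_(r in `[t, s]) dot (Bs (S1 (s - r) v)) (u r) : R^o)
  (beta * input_bound s)) => [a v w|v]; last exact: state_weak_bound.
rewrite -[a *: Rintegral _ _ _]/(a * _) -RintegralZl//; last exact: state_weak_integrable.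
rewrite -RintegralD//; last first.
- exact: state_weak_integrable.
- apply: (@eq_integrable _ _ R mu `[t, s] mI (fun r => a%:E *
    (dot (Bs (S1 (s - r) v)) (u r))%:E)%E) => //.
  by apply: integrableZl => //; exact: state_weak_integrable.
apply: eq_Rintegral => r; rewrite inE/= in_itv/= => /andP[_ rs].
by rewrite -!input_adjoint ?subr_ge0// dualD dualZ.
Qed.

Lemma state_bound s (z : dual V) : t <= s ->
  (forall v, z v = \int[mu]_(r in `[t, s]) dot (Bs (S1 (s - r) v)) (u r)) ->
  `|z| <= beta * input_bound s.
Proof.
move=> ts hz; apply: dual_norm_le => [|v]; last by rewrite hz state_weak_bound.
by rewrite mulr_ge0// input_bound_ge0.
Qed.

(** By [pettis] it is enough to look at [y s] on a dense sequence of V. There it is an integral with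
    parameter [s] of a jointly measurable kernel, once the control is extended by 0, the elapsed
    time replaced by its absolute value and the integrand cut to the triangle. *)
Lemma state_trajectory_borel (x : dual V) (y : R -> dual V) :
  (forall s, t <= s -> forall v, y s v = S (s - t) x v +
    \int[mu]_(r in `[t, s]) dot (Bs (S1 (s - r) v)) (u r)) ->
  borel `[t, +oo[ y.
Proof.
move=> hy; have [q qd] := separable_seq sepV.
have mD : measurable (`[t, +oo[ : set R) by [].
apply: (@pettis _ _ _ _ (fun n (f : dual V) => f (q n)) (fun n => `|q n|)) => //.
- exact: separable_dual.
- by move=> f c c0; exact: dual_norming.
move=> n; set v := q n.
pose ue r := if t <= r then u r else 0.
have bue : borel setT ue by exact: borel_ext.
pose f (z : measurableTypeR R * measurableTypeR R) : \bar R :=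
  (if (t <= z.2) && (z.2 <= z.1) then dot (Bs (S1 `|z.1 - z.2| v)) (ue z.2) else 0)%:E.
have mf : measurable_fun setT f.
  apply/measurable_EFinP; apply: measurable_if_fun; first exact: measurable_triangle.
  apply: measurable_kernel => //.
  - by apply: measurable_funB; [exact: measurable_fst|exact: measurable_snd].
  - exact: borel_cst.
  exact: (measurableT_comp bue measurable_snd).
have m1 := measurable_integral_param mu mf.
have m2 : measurable_fun setT (fun s : R => x (S1 `|s - t| v) : R).
  apply: (measurable_dual_costate (a := fun s : R => s - t) (G := fun=> v) x) => //.
  - exact: measurable_funB.
  - exact: borel_cst.
have m3 : measurable_fun `[t, +oo[ (fun s : R => x (S1 `|s - t| v) +
    fine (\int[mu]_r f (s, r))%E : R).
  by apply: measurable_funTS; apply: measurable_funD => //; exact: measurableT_comp.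
apply: eq_measurable_fun m3 => s; rewrite inE/= in_itv/= andbT => ts.
rewrite hy// ger0_norm ?subr_ge0// adj ?subr_ge0//; congr (_ + fine _).
rewrite /f (integral_if (D := `[t, s])); last by move=> r /=; rewrite in_itv.
apply: eq_integral => r; rewrite inE/= in_itv/= => /andP[tr rs].
by rewrite ger0_norm ?subr_ge0// /ue tr.
Qed.

Lemma state_trajectory_Lw (x : dual V) (y : R -> dual V) :
  (forall s, t <= s -> forall v, y s v = S (s - t) x v +
    \int[mu]_(r in `[t, s]) dot (Bs (S1 (s - r) v)) (u r)) ->
  Lw t lam m (fun s => `|y s|).
Proof.
move=> hy; have mD : measurable (`[t, +oo[ : set R) by [].
have [_ L1] := Lw_causal m0 m'0 mm' Lu om.
have L2 := Lw_add m0 (Lw_scale `|x| m0 (Lw_exp t m0 om)) (Lw_scale beta m0 L1).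
apply: (Lw_le m0 _ _ L2).
  by apply: borel_norm => //; exact: state_trajectory_borel hy.
move=> s ts; rewrite normr_id -/(input_bound s) ger0_norm; last first.
  by rewrite addr_ge0// mulr_ge0 ?expR_ge0 ?input_bound_ge0.
have [z hz] := state_exists ts.
have -> : y s = S (s - t) x + z.
  by apply: dual_eqP => v; rewrite dual_addE hy// hz.
rewrite (le_trans (ler_normD _ _))// lerD//; last exact: state_bound.
by rewrite mulrC gS// subr_ge0.
Qed.

End State.

Section Costate.
Variable G : R -> V.
Hypothesis bG : borel `[t, +oo[ G.
Hypothesis LG : Lw t lam m' (fun r => `|G r|).

Let mm'C : m'^-1 + m^-1 = 1. Proof. by rewrite addrC. Qed.
Let om' : omega < lam / m. Proof. by rewrite ltr_pdivlMr. Qed.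

Definition costate_bound s : R := fine
  (\int[mu]_(r in `[s, +oo[) (expR ((omega - lam) * (r - s)) * `| `|G r| |)%:E)%E.

Lemma costate_integrand s : t <= s ->
  borel `[s, +oo[ (fun r => expR (- lam * (r - s)) *: S1 (r - s) (G r)).
Proof.
move=> ts; have mI : measurable (`[s, +oo[ : set R) by [].
have mE : measurable_fun `[s, +oo[ (fun r : R => expR (- lam * (r - s))).
  apply: measurable_funTS; apply: measurableT_comp => //.
  by apply: measurable_funM => //; exact: measurable_funB.
have b1 : borel `[s, +oo[ (fun r => S1 `|r - s| (G r)).
  apply: borel_costate => //; first exact: measurable_funB.
  apply: borel_subset bG => // r /=.
  by rewrite !in_itv/= !andbT; exact: le_trans.
have bI : borel `[s, +oo[ (fun r => expR (- lam * (r - s)) *: S1 `|r - s| (G r)).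
  have bE : borel `[s, +oo[ (fun r : R => expR (- lam * (r - s)) : R^o).
    exact/borel_real.
  have cS : continuous (fun z : R^o * V => z.1 *: z.2) by exact: scale_continuous.
  exact: (borel_pair (@separable_real R) sepV mI cS bE b1).
apply: eq_measurable_fun bI => r; rewrite inE/= in_itv/= andbT => sr.
by rewrite ger0_norm ?subr_ge0.
Qed.

Lemma costate_bound_fin s : t <= s -> mu.-integrable `[s, +oo[
  (EFin \o (fun r => expR ((omega - lam) * (r - s)) * `|G r|)).
Proof.
move=> ts; have mI : measurable (`[s, +oo[ : set R) by [].
have mG : measurable_fun `[s, +oo[ (fun r => `|G r|).
  apply: borel_norm => //; apply: borel_subset bG => // r /=.
  by rewrite !in_itv/= !andbT; exact: le_trans.
apply/integrableP; split.
  apply/measurable_EFinP; apply: measurable_funM => //.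
  apply: measurableT_comp => //; apply: measurable_funM => //.
  exact: measurable_funB.
have [h _] := Lw_anticausal m'0 m0 mm'C LG om'.
apply: le_lt_trans (h s ts); rewrite le_eqVlt; apply/orP; left; apply/eqP.
by apply: eq_integral => r _ /=; rewrite normrM normr_id (ger0_norm (expR_ge0 _)).
Qed.

Lemma costate_boundE s : t <= s -> costate_bound s =
  \int[mu]_(r in `[s, +oo[) (expR ((omega - lam) * (r - s)) * `|G r|).
Proof. by move=> ts; rewrite /costate_bound; under eq_integral do rewrite normr_id. Qed.

Lemma costate_bound_ge0 s : 0 <= costate_bound s.
Proof.
by apply: fine_ge0; apply: integral_ge0 => r _; rewrite lee_fin mulr_ge0 ?expR_ge0.
Qed.

Lemma costate_norm_le s r : s <= r ->
  `|expR (- lam * (r - s)) *: S1 (r - s) (G r)| <=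
  expR ((omega - lam) * (r - s)) * `|G r|.
Proof.
move=> sr; rewrite normrZ ger0_norm ?expR_ge0//.
have -> : (omega - lam) * (r - s) = - lam * (r - s) + omega * (r - s) by ring.
rewrite expRD -mulrA.
by rewrite ler_wpM2l ?expR_ge0// gS1// subr_ge0.
Qed.

Lemma costate_integrable s : t <= s -> mu.-integrable `[s, +oo[
  (EFin \o (fun r => `|expR (- lam * (r - s)) *: S1 (r - s) (G r)|)).
Proof.
move=> ts; have mI : measurable (`[s, +oo[ : set R) by [].
apply: (@le_integrable _ _ R mu `[s, +oo[ mI _
  (EFin \o (fun r => expR ((omega - lam) * (r - s)) * `|G r|))).
- by apply/measurable_EFinP; apply: borel_norm => //; exact: costate_integrand.
- move=> r; rewrite /= in_itv/= andbT => sr; rewrite lee_fin normr_id.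
  by rewrite (le_trans (costate_norm_le sr))// ler_norm.
exact: costate_bound_fin.
Qed.

Lemma dual_bound (x : dual V) v : `|(x v : R^o)| <= `|x| * `|v|.
Proof. exact: dual_le. Qed.

Lemma costate_weak_integrable s (x : dual V) : t <= s -> mu.-integrable `[s, +oo[
  (EFin \o (fun r => x (expR (- lam * (r - s)) *: S1 (r - s) (G r)) : R)).
Proof.
move=> ts; have mI : measurable (`[s, +oo[ : set R) by [].
exact: (functional_integrable (@dual_linear _ _ x) (dual_bound x) mI
  (costate_integrand ts) (costate_integrable ts)).
Qed.

Lemma costate_weak s (v : V) : t <= s -> is_bochner_integral `[s, +oo[
    (fun r => expR (- lam * (r - s)) *: S1 (r - s) (G r)) v ->
  forall x : dual V, x v =
    \int[mu]_(r in `[s, +oo[) (x (expR (- lam * (r - s)) *: S1 (r - s) (G r)) : R).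
Proof.
move=> ts hv x; have mI : measurable (`[s, +oo[ : set R) by [].
by rewrite -(bochner_weak mI hv (@dual_linear _ _ x) (dual_bound x)).
Qed.

Lemma costate_bochner s (v : V) : t <= s -> (forall x : dual V, x v =
    \int[mu]_(r in `[s, +oo[) (x (expR (- lam * (r - s)) *: S1 (r - s) (G r)) : R)) ->
  is_bochner_integral `[s, +oo[
    (fun r => expR (- lam * (r - s)) *: S1 (r - s) (G r)) v.
Proof.
move=> ts hv; have mI : measurable (`[s, +oo[ : set R) by [].
have [q qd] := separable_seq sepV.
apply: (@bochner_exists _ _ _ _ q mI (costate_integrand ts) (costate_integrable ts)
  qd (dual V) (fun x => x : V -> R^o) (fun x => `|x|)).
- by move=> x; exact: dual_linear.
- by [].
- exact: dual_bound.
- by move=> w c c0 h; exact: predual_norm_le.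
by move=> x; rewrite -hv.
Qed.

Lemma costate_weak_bound s (x : dual V) : t <= s ->
  `|\int[mu]_(r in `[s, +oo[) (x (expR (- lam * (r - s)) *: S1 (r - s) (G r)) : R)|
  <= costate_bound s * `|x|.
Proof.
move=> ts; have mI : measurable (`[s, +oo[ : set R) by [].
rewrite (le_trans (le_normr_Rintegral _ _))//.
  exact: costate_weak_integrable.
rewrite costate_boundE// mulrC -RintegralZl//; last exact: costate_bound_fin.
apply: le_Rintegral => //.
- by apply: integrable_norm; exact: costate_weak_integrable.
- apply: (@eq_integrable _ _ R mu `[s, +oo[ mI (fun r => (`|x|)%:E *
    (expR ((omega - lam) * (r - s)) * `|G r|)%:E)%E) => //.
  by apply: integrableZl => //; exact: costate_bound_fin.
move=> r; rewrite /= in_itv/= andbT => sr.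
by rewrite (le_trans (dual_le _ _))// ler_wpM2l// costate_norm_le.
Qed.

Lemma costate_exists s : t <= s -> exists v : V, forall x : dual V, x v =
  \int[mu]_(r in `[s, +oo[) (x (expR (- lam * (r - s)) *: S1 (r - s) (G r)) : R).
Proof.
move=> ts; have mI : measurable (`[s, +oo[ : set R) by [].
have [|x|v hv] := @reflexive _ _ (fun x : dual V => \int[mu]_(r in `[s, +oo[)
    (x (expR (- lam * (r - s)) *: S1 (r - s) (G r)) : R) : R^o) (costate_bound s).
- move=> a x y.
  rewrite -[a *: Rintegral _ _ _]/(a * _) -RintegralZl//; last first.
    exact: costate_weak_integrable.
  rewrite -RintegralD//; last exact: costate_weak_integrable.
  apply: (@eq_integrable _ _ R mu `[s, +oo[ mI (fun r => a%:E *
    (x (expR (- lam * (r - s)) *: S1 (r - s) (G r)))%:E)%E) => //.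
  by apply: integrableZl => //; exact: costate_weak_integrable.
- exact: costate_weak_bound.
by exists v => x; rewrite hv.
Qed.

Lemma costate_le s (v : V) : t <= s -> (forall x : dual V, x v =
    \int[mu]_(r in `[s, +oo[) (x (expR (- lam * (r - s)) *: S1 (r - s) (G r)) : R)) ->
  `|v| <= costate_bound s.
Proof.
move=> ts hv; apply: predual_norm_le => [|x]; first exact: costate_bound_ge0.
by rewrite hv costate_weak_bound.
Qed.

Section Trajectory.
Variable pi : R -> V.
Hypothesis hpi : forall s, t <= s -> forall x : dual V, x (pi s) =
  \int[mu]_(r in `[s, +oo[) (x (expR (- lam * (r - s)) *: S1 (r - s) (G r)) : R).

Lemma costate_borel : borel `[t, +oo[ pi.
Proof.
have [q qd] := separable_seq sepV.
have mD : measurable (`[t, +oo[ : set R) by [].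
apply: (@pettis _ _ _ _ (fun n v => dot (q n) v) (fun n => `|q n|)) => //.
- by move=> n v w; rewrite dotBr.
- move=> v c c0; rewrite -norm_dot_dual (dual_norming _ qd c0).
  by split=> h n; have := h n; rewrite dot_dualE dotC.
move=> n; set x := dot_dual (q n).
pose Ge r := if t <= r then G r else 0.
have bGe : borel setT Ge by exact: borel_ext.
pose f (z : measurableTypeR R * measurableTypeR R) : \bar R :=
  (if z.1 <= z.2 then expR (- lam * (z.2 - z.1)) * x (S1 `|z.2 - z.1| (Ge z.2)) else 0)%:E.
have mf : measurable_fun setT f.
  have mB : measurable_fun setT
      (fun z : measurableTypeR R * measurableTypeR R => z.2 - z.1).
    by apply: measurable_funB; [exact: measurable_snd|exact: measurable_fst].
  apply/measurable_EFinP; apply: measurable_if_fun.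
    by apply: measurable_fun_ler; [exact: measurable_fst|exact: measurable_snd].
  apply: measurable_funM.
    by apply: measurableT_comp => //; exact: measurable_funM.
  apply: measurable_dual_costate => //.
  exact: (measurableT_comp bGe measurable_snd).
have m1 := measurable_integral_param mu mf.
have m3 : measurable_fun `[t, +oo[ (fun s : R => fine (\int[mu]_r f (s, r))%E : R).
  by apply: measurable_funTS; exact: measurableT_comp.
apply: eq_measurable_fun m3 => s; rewrite inE/= in_itv/= andbT => ts.
rewrite -dot_dualE hpi//; congr fine.
rewrite /f (integral_if (D := `[s, +oo[)); last first.
  by move=> r /=; rewrite in_itv/= andbT.
apply: eq_integral => r; rewrite inE/= in_itv/= andbT => sr.
by rewrite dualZ ger0_norm ?subr_ge0// /Ge (le_trans ts).
Qed.

Lemma costate_Lw : Lw t lam m' (fun s => `|pi s|).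
Proof.
have mD : measurable (`[t, +oo[ : set R) by [].
have [_ L1] := Lw_anticausal m'0 m0 mm'C LG om'.
apply: (Lw_le m'0 _ _ L1); first by apply: borel_norm => //; exact: costate_borel.
move=> s ts; rewrite normr_id -/(costate_bound s) ger0_norm ?costate_bound_ge0//.
by apply: costate_le => //; exact: hpi.
Qed.

(** [e^((omega - lam) T) |pi T|] is at most [e^((omega - lam) t)] times the integral over [[T, +oo[]
    of the fixed integrable function [g]. The cut-offs [h n] show by dominated convergence that
    these tails vanish. *)
Lemma costate_limit : expR ((omega - lam) * T) *: pi T @[T --> +oo] --> (0 : V).
Proof.
have mI : measurable (`[t, +oo[ : set R) by [].
pose g r := expR ((omega - lam) * (r - t)) * `|G r|.
have gi : mu.-integrable `[t, +oo[ (EFin \o g) by exact: costate_bound_fin.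
have g0 r : 0 <= g r by rewrite mulr_ge0 ?expR_ge0.
have mg : measurable_fun `[t, +oo[ g by apply/measurable_EFinP; exact: measurable_int gi.
pose h (n : nat) r := (if n%:R <= r then g r else 0)%:E.
have mh n : measurable_fun `[t, +oo[ (h n).
  apply/measurable_EFinP; apply: measurable_fun_if => //.
  - exact: measurable_fun_ler.
  - by apply: measurable_funS mg => // r [].
have hcv : {ae mu, forall r, `[t, +oo[%classic r -> h ^~ r @ \oo --> 0%E}.
  apply/aeW => r _; apply: cvg_near_cst; near=> n.
  rewrite /h ifN// -ltNge.
  by near: n; exact: nbhs_infty_gtr.
have hle : {ae mu, forall r n, `[t, +oo[%classic r -> (`|h n r| <= (g r)%:E)%E}.
  apply/aeW => r n _; rewrite /h/= lee_fin; case: ifP => _.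
    by rewrite ger0_norm.
  by rewrite normr0.
have [_ _] := @dominated_convergence _ _ R mu `[t, +oo[ mI h (cst 0%E)
  (fun r => (g r)%:E) mh (measurable_cst _) hcv gi hle.
rewrite integral0 => /fine_cvgP[hfin /cvgrPdist_le hlim].
apply/cvgrPdist_le => e e0.
have e1 : 0 < e / expR ((omega - lam) * t) by rewrite divr_gt0 ?expR_gt0.
have [N _ hN] := hlim _ e1.
near=> T.
have tT : t <= T by near: T; apply: nbhs_pinfty_ge; exact: num_real.
have NT : N%:R <= T by near: T; apply: nbhs_pinfty_ge; exact: num_real.
have := hN N (leqnn N); rewrite /= sub0r normrN => hN2.
rewrite sub0r normrN normrZ ger0_norm ?expR_ge0//.
have mT : measurable (`[T, +oo[ : set R) by [].
rewrite (le_trans (ler_wpM2l (expR_ge0 _) (costate_le tT (hpi tT))))//.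
have giT : mu.-integrable `[T, +oo[ (EFin \o g).
  apply: (@integrableS _ _ _ mu _ _ _ mI mT _ gi) => r /=.
  by rewrite !in_itv/= !andbT; exact: le_trans.
have -> : expR ((omega - lam) * T) * costate_bound T =
    expR ((omega - lam) * t) * \int[mu]_(r in `[T, +oo[) g r.
  have gT : mu.-integrable `[T, +oo[ (EFin \o g) by exact: giT.
  rewrite costate_boundE// -RintegralZl//; last exact: costate_bound_fin.
  rewrite -RintegralZl//.
    by apply: eq_Rintegral => r _; rewrite /g !mulrA -!expRD; congr (expR _ * _); ring.
rewrite mulrC -ler_pdivlMr ?expR_gt0//; apply: le_trans hN2.
rewrite ger0_norm; last first.
  by apply: fine_ge0; apply: integral_ge0 => r _; rewrite /h lee_fin; case: ifP.
apply: fine_le.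
- exact: integrable_fin_num giT.
- rewrite ge0_fin_numE; last first.
    by apply: integral_ge0 => r _; rewrite /h lee_fin; case: ifP.
  apply: (@le_lt_trans _ _ (\int[mu]_(r in `[t, +oo[) (g r)%:E)%E).
    by apply: ge0_le_integral => //=; first [exact: mh|exact/measurable_EFinP|
      by move=> r _; rewrite /h lee_fin; case: ifP].
  have /integrableP[_] := gi; apply: le_lt_trans.
  rewrite le_eqVlt; apply/orP; left; apply/eqP.
  by apply: eq_integral => r _ /=; rewrite ger0_norm.
apply: (@le_trans _ _ (\int[mu]_(r in `[T, +oo[) (h N r))%E).
  rewrite le_eqVlt; apply/orP; left; apply/eqP.
  apply: eq_integral => r; rewrite inE/= in_itv/= andbT => Tr.
  by rewrite /h (le_trans NT Tr).
apply: ge0_subset_integral => //=; first [exact: mh|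
  by move=> r _; rewrite /h lee_fin; case: ifP|
  by move=> r /=; rewrite !in_itv/= !andbT; exact: le_trans].
Unshelve. all: by end_near. Qed.

End Trajectory.

End Costate.

(** * The duality identity by Fubini *)

Section Duality.
Variables (w : R -> U) (G : R -> V) (zeta : R -> dual V) (pi : R -> V).
Hypotheses (bw : borel `[t, +oo[ w) (bG : borel `[t, +oo[ G).
Hypotheses (Lww : Lw t lam m (fun r => `|w r|)) (LG : Lw t lam m' (fun r => `|G r|)).
Hypothesis hzeta : forall s, t <= s -> forall v, zeta s v =
  \int[mu]_(r in `[t, s]) dot (Bs (S1 (s - r) v)) (w r).
Hypothesis hpi : forall s, t <= s -> forall x : dual V, x (pi s) =
  \int[mu]_(r in `[s, +oo[) (x (expR (- lam * (r - s)) *: S1 (r - s) (G r)) : R).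

Let we r := if t <= r then w r else 0.
Let Ge r := if t <= r then G r else 0.

(** Double integrand on the triangle: [z.1] is the time at which the source acts, [z.2] that of the
    control. Integrating out [z.2] gives the state side ([inner1]), integrating out [z.1] the
    co-state side ([inner2]). *)
Let f (z : measurableTypeR R * measurableTypeR R) : R :=
  if (t <= z.2) && (z.2 <= z.1) then
    expR (- lam * z.1) * dot (Bs (S1 `|z.1 - z.2| (Ge z.1))) (we z.2) else 0.

Let bwe : borel setT we. Proof. exact: borel_ext. Qed.
Let bGe : borel setT Ge. Proof. exact: borel_ext. Qed.

Let mB : measurable_fun setT
  (fun z : measurableTypeR R * measurableTypeR R => z.1 - z.2).
Proof. by apply: measurable_funB; [exact: measurable_fst|exact: measurable_snd]. Qed.

Let mexp : measurable_fun setT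
  (fun z : measurableTypeR R * measurableTypeR R => expR (- lam * z.1)).
Proof.
apply: measurableT_comp => //; apply: measurable_funM => //; exact: measurable_fst.
Qed.

Let mf : measurable_fun setT (EFin \o f).
Proof.
apply/measurable_EFinP; apply: measurable_if_fun; first exact: measurable_triangle.
apply: measurable_funM; first exact: mexp.
apply: measurable_kernel => //.
- exact: (measurableT_comp bGe measurable_fst).
- exact: (measurableT_comp bwe measurable_snd).
Qed.

Let a r := beta * `|we r|.
Let b r := `|Ge r|.

Let ma : measurable_fun setT a.
Proof. by apply: measurable_funM => //; exact: borel_norm. Qed.
Let mb : measurable_fun setT b. Proof. exact: borel_norm. Qed.

Let La : Lw t lam m a.
Proof.
apply: (Lw_scale beta m0); apply: (Lw_le m0 _ _ Lww).
  by apply: measurable_funTS; exact: borel_norm.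
by move=> s ts; rewrite /we ts.
Qed.

Let Lb : Lw t lam m' b.
Proof.
apply: (Lw_le m'0 _ _ LG); first exact: measurable_funTS.
by move=> s ts; rewrite /b /Ge ts.
Qed.

Let P (z : measurableTypeR R * measurableTypeR R) : R :=
  if (t <= z.2) && (z.2 <= z.1) then
    expR (- lam * z.1) * (expR (omega * (z.1 - z.2)) * (`|a z.2| * `|b z.1|)) else 0.

Let mP : measurable_fun setT (EFin \o P).
Proof.
apply/measurable_EFinP; apply: measurable_if_fun; first exact: measurable_triangle.
apply: measurable_funM => //; apply: measurable_funM.
  by apply: measurableT_comp => //; exact: measurable_funM.
apply: measurable_funM; apply: measurableT_comp => //.
- exact: (measurableT_comp ma measurable_snd).
- exact: (measurableT_comp mb measurable_fst).
Qed.

Let P0 z : 0 <= P z.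
Proof. by rewrite /P; case: ifP => // _; rewrite !mulr_ge0 ?expR_ge0. Qed.

Let fP z : `|f z| <= P z.
Proof.
rewrite /f /P; case: ifPn => [/andP[tr rs]|]; last by rewrite normr0.
rewrite normrM (ger0_norm (expR_ge0 _)) ler_wpM2l ?expR_ge0//.
have -> : `|a z.2| = beta * `|we z.2| by rewrite ger0_norm ?mulr_ge0.
rewrite /b normr_id (le_trans (CauchySchwarz _ _))//.
rewrite (le_trans (ler_wpM2r _ (Bs_bound _)))//.
rewrite (le_trans (ler_wpM2r _ (ler_wpM2l beta0 (gS1 _ _))))//.
rewrite (ger0_norm (_ : 0 <= z.1 - z.2)) ?subr_ge0//.
by rewrite le_eqVlt; apply/orP; left; apply/eqP; ring.
Qed.

Let imf : (mu \x mu)%E.-integrable setT (EFin \o f).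
Proof.
apply: (@integrable12ltyP _ _ _ _ R mu mu (EFin \o f) mf).2.
apply: le_lt_trans (Lw_pairing m0 m'0 mm' La Lb om).
have mPF := measurable_fun_fubini_tonelli_F (EFin \o P) mP
  (fun z => ltac:(rewrite lee_fin; exact: P0)).
have mfa : measurable_fun setT (fun z => `|(f z)%:E|)%E.
  exact: (measurableT_comp (@abse_measurable R setT)).
have mfF := measurable_fun_fubini_tonelli_F (fun z => `|(f z)%:E|)%E mfa
  (fun z => abse_ge0 _).
apply: ge0_le_integral => //=.
- by move=> x _; apply: integral_ge0 => y _; rewrite lee_fin.
- exact: mfF.
- exact: mPF.
move=> x _; apply: ge0_le_integral => //=.
- apply: (measurableT_comp mfa); exact: measurable_pair1.
- by have := measurableT_comp mP (measurable_pair1 x); apply: eq_measurable_fun.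
by move=> y _; rewrite lee_fin fP.
Qed.

Let inner1 x : (\int[mu]_y (f (x, y))%:E)%E =
  (if t <= x then expR (- lam * x) * zeta x (G x) else 0)%:E.
Proof.
have [tx|xt] := leP t x; last first.
  rewrite integral0_eq// => y _; rewrite /f/=; case: ifP => // /andP[ty yx].
  by have := le_trans ty yx; rewrite leNgt xt.
have mI : measurable (`[t, x] : set R) by [].
rewrite /f (integral_if (D := `[t, x])); last by move=> r /=; rewrite in_itv.
have ii := state_weak_integrable bw Lww (G x) tx.
rewrite hzeta// -RintegralZl// /Rintegral fineK.
  apply: eq_integral => r; rewrite inE/= in_itv/= => /andP[tr rs].
  by rewrite ger0_norm ?subr_ge0// /Ge /we tx tr.
apply: integrable_fin_num => //.
apply: (@eq_integrable _ _ R mu `[t, x] mI (fun r => (expR (- lam * x))%:E *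
  (dot (Bs (S1 (x - r) (G x))) (w r))%:E)%E) => //.
exact: integrableZl.
Qed.

Let inner2 y : (\int[mu]_x (f (x, y))%:E)%E =
  (if t <= y then expR (- lam * y) * dot (Bs (pi y)) (w y) else 0)%:E.
Proof.
have [ty|yt] := leP t y; last first.
  by rewrite integral0_eq// => x _; rewrite /f/= leNgt yt.
have mI : measurable (`[y, +oo[ : set R) by [].
rewrite /f/= (integral_if (D := `[y, +oo[)); last first.
  by move=> r /=; rewrite in_itv/= andbT ty.
have ii := costate_weak_integrable bG LG (B (w y)) ty.
rewrite -BsP hpi// -RintegralZl// /Rintegral fineK.
  apply: eq_integral => r; rewrite inE/= in_itv/= andbT => yr.
  rewrite ger0_norm ?subr_ge0// /Ge /we (le_trans ty yr) ty -BsP dualZ mulrA -expRD.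
  by congr (expR _ * _)%:E; ring.
apply: integrable_fin_num => //.
apply: (@eq_integrable _ _ R mu `[y, +oo[ mI (fun r => (expR (- lam * y))%:E *
  ((B (w y) (expR (- lam * (r - y)) *: S1 (r - y) (G r))) : R)%:E)%E) => //.
exact: integrableZl.
Qed.

Let restrict (h : R -> R) :
  mu.-integrable setT (fun s => (if t <= s then h s else 0)%:E) ->
  mu.-integrable `[t, +oo[ (EFin \o h).
Proof.
move=> hi; have mI : measurable (`[t, +oo[ : set R) by [].
have := @integrableS _ _ R mu setT `[t, +oo[ _ measurableT mI (@subsetT _ _) hi.
apply: eq_integrable => // s; rewrite inE/= in_itv/= andbT => ts.
by rewrite ts.
Qed.

Let integrableG : mu.-integrable setT (fun y => \int[mu]_x (f (x, y))%:E)%E.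
Proof.
apply/integrableP; split; first exact: (measurable_fubini_G imf).
apply: (@le_lt_trans _ _ (\int[mu]_y \int[mu]_x `|(f (x, y))%:E|)%E); last first.
  exact: (@integrable21ltyP _ _ _ _ R mu mu (EFin \o f) mf).1 imf.
have mfa : measurable_fun setT (fun z => `|(f z)%:E|)%E.
  exact: (measurableT_comp (@abse_measurable R setT)).
apply: ge0_le_integral => //.
- apply: (measurableT_comp (@abse_measurable R setT)).
  exact: (measurable_fubini_G imf).
- exact: (measurable_fun_fubini_tonelli_G (fun z => `|(f z)%:E|)%E mfa
    (fun z => abse_ge0 _)).
move=> y _; apply: le_abse_integral => //.
exact: (measurableT_comp mf (measurable_pair2 y)).
Qed.

Theorem duality :
  [/\ mu.-integrable `[t, +oo[ (EFin \o (fun s => expR (- lam * s) * zeta s (G s))),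
      mu.-integrable `[t, +oo[
        (EFin \o (fun s => expR (- lam * s) * dot (Bs (pi s)) (w s))) &
      \int[mu]_(s in `[t, +oo[) (expR (- lam * s) * zeta s (G s)) =
      \int[mu]_(s in `[t, +oo[) (expR (- lam * s) * dot (Bs (pi s)) (w s))].
Proof.
have tD s : `[t, +oo[%classic s <-> t <= s by rewrite /= in_itv/= andbT.
split.
- apply: restrict; have := integrable_fubini_F imf.
  by apply: eq_integrable => // x _; rewrite -inner1.
- apply: restrict; have := integrableG.
  by apply: eq_integrable => // x _; rewrite -inner2.
rewrite /Rintegral; congr fine.
rewrite -(integral_if _ tD) -[RHS](integral_if _ tD).
under eq_integral do rewrite -inner1.
under [RHS]eq_integral do rewrite -inner2.
exact: (Fubini imf).
Qed.

End Duality.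

End Operators.

(** * Comparison of costs *)

Lemma ae_imply (R : realType) (P Q : R -> Prop) : (forall s, P s -> Q s) ->
  {ae @lebesgue_measure R, forall s, P s} -> {ae @lebesgue_measure R, forall s, Q s}.
Proof.
by move=> PQ; apply: filterS => //; exact: (ae_filter_ringOfSetsType lebesgue_measure).
Qed.

Section Comparison.
Context {R : realType}.
Local Notation mu := (@lebesgue_measure R).
Variable D : set R.
Hypothesis mD : measurable D.
Implicit Types f g phi : R -> R.

(* The integral of f is that of its positive part minus that of its negative
   part, with +oo - +oo = -oo: if the negative part of g is not integrable then
   neither is that of f. *)
Lemma integral_le_perturbed f g phi : measurable_fun D f -> measurable_fun D g ->
  mu.-integrable D (EFin \o phi) -> \int[mu]_(r in D) phi r = 0 ->
  {ae mu, forall r, D r -> f r + phi r <= g r} ->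
  (\int[mu]_(r in D) (f r)%:E <= \int[mu]_(r in D) (g r)%:E)%E.
Proof.
move=> mf mg iphi phi0 fg.
have mphi : measurable_fun D phi.
  by apply/measurable_EFinP; exact: measurable_int iphi.
have iap : (\int[mu]_(r in D) (`|phi r|)%:E < +oo)%E by have /integrableP[] := iphi.
pose fp r := (Num.max (f r : R) (0 : R))%:E; pose fn r := (Num.max (- f r : R) (0 : R))%:E.
pose gp r := (Num.max (g r : R) (0 : R))%:E; pose gn r := (Num.max (- g r : R) (0 : R))%:E.
have mx (h : R -> R) : measurable_fun D h ->
    measurable_fun D (fun r => (Num.max (h r : R) (0 : R))%:E).
  by move=> mh; apply/measurable_EFinP; exact: measurable_maxr.
have mfp : measurable_fun D fp by exact: mx.
have mgp : measurable_fun D gp by exact: mx.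
have mfn : measurable_fun D fn by apply: mx; exact: measurableT_comp.
have mgn : measurable_fun D gn by apply: mx; exact: measurableT_comp.
have pos (c : R) : (0 <= (Num.max c (0 : R))%:E :> \bar R)%E by rewrite lee_fin le_max lexx orbT.
have E (h : R -> R) : (\int[mu]_(r in D) (h r)%:E =
    \int[mu]_(r in D) (Num.max (h r : R) (0 : R))%:E -
    \int[mu]_(r in D) (Num.max (- h r : R) (0 : R))%:E)%E.
  rewrite integralE; congr (_ - _)%E; apply: eq_integral => r _.
    by rewrite funeposE EFin_max.
  by rewrite funenegE EFin_max.
have mphia : measurable_fun D (fun r => (`|phi r|)%:E).
  by apply/measurable_EFinP; exact: measurableT_comp.
have le1 : (\int[mu]_(r in D) gn r <= \int[mu]_(r in D) fn r +
    \int[mu]_(r in D) (`|phi r|)%:E)%E.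
  rewrite -ge0_integralD//; last by move=> r _; exact: pos.
  apply: ae_ge0_le_integral => //.
  - by move=> r _; exact: pos.
  - by move=> r _; rewrite adde_ge0// ?lee_fin//; exact: pos.
  - exact: emeasurable_funD.
  apply: (ae_imply _ fg) => r h Dr; rewrite -EFinD lee_fin.
  have := h Dr; have := ler_norm (- phi r); rewrite normrN.
  move: (normr_ge0 (phi r)); move: `|phi r| (phi r) (f r) (g r) => P0 p0 a b.
  by move=> *; rewrite ge_max; apply/andP; split; case: (leP (- a) 0) => *; lra.
have le2 : (\int[mu]_(r in D) fp r <= \int[mu]_(r in D) gp r +
    \int[mu]_(r in D) (`|phi r|)%:E)%E.
  rewrite -ge0_integralD//; last by move=> r _; exact: pos.
  apply: ae_ge0_le_integral => //.
  - by move=> r _; exact: pos.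
  - by move=> r _; rewrite adde_ge0 ?lee_fin//; exact: pos.
  - exact: emeasurable_funD.
  apply: (ae_imply _ fg) => r h Dr; rewrite -EFinD lee_fin.
  have := h Dr; have := ler_norm (- phi r); rewrite normrN.
  move: (normr_ge0 (phi r)); move: `|phi r| (phi r) (f r) (g r) => P0 p0 a b.
  by move=> *; rewrite ge_max; apply/andP; split; case: (leP b 0) => *; lra.
have I0 (h : R -> R) : (0 <= \int[mu]_(r in D) (Num.max (h r : R) (0 : R))%:E :> \bar R)%E.
  by apply: integral_ge0 => r _.
rewrite (E f) (E g).
(* The left side is then [-oo], whatever its positive part. *)
have [fnoo|fnoo] := eqVneq (\int[mu]_(r in D) fn r)%E +oo%E.
  by rewrite [X in (_ - X <= _)%E]fnoo addeNy leNye.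
have fnf : (\int[mu]_(r in D) fn r < +oo)%E by rewrite ltey.
have gnf : (\int[mu]_(r in D) gn r < +oo)%E.
  by rewrite (le_lt_trans le1)// lte_add_pinfty.
(* The negative part of [g] being integrable by now, the right side is then [+oo]. In the remaining
   case everything is integrable and subtraction is allowed. *)
have [gpoo|gpoo] := eqVneq (\int[mu]_(r in D) gp r)%E +oo%E.
  rewrite [X in (_ <= X - _)%E]gpoo addye ?leey//.
  by rewrite gt_eqF// lteNr/=.
have gpf : (\int[mu]_(r in D) gp r < +oo)%E by rewrite ltey.
have fpf : (\int[mu]_(r in D) fp r < +oo)%E.
  by rewrite (le_lt_trans le2)// lte_add_pinfty.
have int (h : R -> R) : measurable_fun D h ->
    (\int[mu]_(r in D) (Num.max (h r : R) (0 : R))%:E < +oo)%E ->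
    (\int[mu]_(r in D) (Num.max (- h r : R) (0 : R))%:E < +oo)%E ->
    mu.-integrable D (EFin \o h).
  move=> mh i1 i2; apply/integrableP; split; first exact/measurable_EFinP.
  have -> : (\int[mu]_(r in D) `|(EFin \o h) r| = \int[mu]_(r in D)
      ((Num.max (h r : R) (0 : R))%:E + (Num.max (- h r : R) (0 : R))%:E))%E.
    apply: eq_integral => r _; rewrite -EFinD /=; congr EFin.
    have [h0|h0] := leP 0 (h r).
      by rewrite ger0_norm// (max_r (x := - h r)) ?addr0 ?oppr_le0.
    by rewrite ltr0_norm// (max_l (x := - h r)) ?add0r// oppr_ge0 ltW.
  rewrite ge0_integralD//; first exact: lte_add_pinfty.
  - exact: mx.
  - by apply: mx; exact: measurableT_comp.
have fi := int f mf fpf fnf; have gi := int g mg gpf gnf.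
rewrite -(E f) -(E g).
have -> : (\int[mu]_(r in D) (f r)%:E = \int[mu]_(r in D) (f r + phi r)%:E)%E.
  under [RHS]eq_integral do rewrite EFinD.
  rewrite integralD//.
  have -> : (\int[mu]_(r in D) (phi r)%:E = 0)%E.
    by rewrite -[LHS]fineK ?integrable_fin_num// -/(Rintegral mu D phi) phi0.
  by rewrite adde0.
pose e r := g r - (f r + phi r).
have me : measurable_fun D e by apply: measurable_funB => //; exact: measurable_funD.
have e0 : (0 <= \int[mu]_(r in D) (e r)%:E)%E.
  have en : (\int[mu]_(r in D) (Num.max (- e r : R) (0 : R))%:E <= \int[mu]_(r in D) 0)%E.
    apply: ae_ge0_le_integral => //.
    - by apply: mx; exact: measurableT_comp.
    apply: (ae_imply _ fg) => r h Dr; rewrite lee_fin ge_max lexx andbT oppr_le0 subr_ge0.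
    exact: h.
  rewrite E; apply: (le_trans (I0 e)).
  rewrite leeDl// leeNr oppe0.
  by rewrite integral0 in en.
have fphii : mu.-integrable D (EFin \o (fun r => f r + phi r)).
  apply: (@eq_integrable _ _ R mu D mD ((EFin \o f) \+ (EFin \o phi))%E) => //.
  exact: integrableD.
rewrite -[leLHS]fineK ?integrable_fin_num// -[leRHS]fineK ?integrable_fin_num//.
rewrite lee_fin -subr_ge0 -RintegralB//.
exact: fine_ge0.
Qed.

End Comparison.

Section WeightedAE.
Context {R : realType}.
Local Notation mu := (@lebesgue_measure R).
Implicit Types (a b : R -> R) (t lam p q c : R).

Lemma Lw_le_ae t lam p a b : 0 < p -> measurable_fun `[t, +oo[ a ->
  {ae mu, forall s, t <= s -> `|a s| <= `|b s|} -> Lw t lam p b -> Lw t lam p a.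
Proof.
move=> p0 ma ab [mb ib]; split; [exact: ma|apply: le_lt_trans ib].
apply: ae_ge0_le_integral => //=.
- by apply/measurable_EFinP; exact: Lw_measurable_weight.
- by apply/measurable_EFinP; exact: Lw_measurable_weight.
apply: (ae_imply _ ab) => s h; rewrite /= in_itv/= andbT => ts.
rewrite lee_fin ler_wpM2l ?expR_ge0//.
by rewrite ge0_ler_powR ?nnegrE ?h// ltW.
Qed.

(** The weight is at least 1 on the half-line, and at each time one of the two functions is at least
    [c / 2]: a positive constant [k] would be integrable. The two exponents may differ, as for a
    control and a co-state. *)
Lemma Lw_const_absurd t lam p q c a b : 0 <= t -> lam <= 0 -> 0 < p -> 0 < q ->
  0 < c -> Lw t lam p a -> Lw t lam q b ->
  {ae mu, forall s, t <= s -> c <= `|a s| + `|b s|} -> False.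
Proof.
move=> t0 l0 p0 q0 c0 [ma ia] [mb ib] h.
pose k := Num.min ((c / 2) `^ p) ((c / 2) `^ q).
have c2 : 0 < c / 2 by rewrite divr_gt0.
have k0 : 0 < k by rewrite lt_min !powR_gt0.
have : (\int[mu]_(s in `[t, +oo[) k%:E < +oo)%E.
  apply: (@le_lt_trans _ _ (\int[mu]_(s in `[t, +oo[)
    ((expR (- lam * s) * `|a s| `^ p)%:E + (expR (- lam * s) * `|b s| `^ q)%:E))%E).
    apply: ae_ge0_le_integral => //=.
    - by move=> s _; rewrite lee_fin ltW.
    - by move=> s _; rewrite adde_ge0// lee_fin mulr_ge0 ?expR_ge0// powR_ge0.
    - by apply: emeasurable_funD; apply/measurable_EFinP; exact: Lw_measurable_weight.
    apply: (ae_imply _ h) => s hs; rewrite /= in_itv/= andbT => ts.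
    rewrite -EFinD lee_fin -mulrDr.
    have w1 : 1 <= expR (- lam * s).
      by rewrite -expR0 ler_expR mulr_ge0 ?oppr_ge0// (le_trans t0).
    have kab : k <= `|a s| `^ p + `|b s| `^ q.
      have [ca|ca] := leP (c / 2) `|a s|.
        apply: (@le_trans _ _ ((c / 2) `^ p)); first by rewrite ge_min lexx.
        rewrite ler_wpDr ?powR_ge0// ge0_ler_powR ?nnegrE// ?(ltW p0)//.
        exact: ltW.
      have cb : c / 2 <= `|b s| by have := hs ts; lra.
      apply: (@le_trans _ _ ((c / 2) `^ q)); first by rewrite ge_min lexx orbT.
      rewrite ler_wpDl ?powR_ge0// ge0_ler_powR ?nnegrE// ?(ltW q0)//.
      exact: ltW.
    by rewrite (le_trans kab)// ler_peMl// (le_trans (ltW k0)).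
  rewrite ge0_integralD//=.
  - exact: (lte_add_pinfty ia ib).
  - by apply/measurable_EFinP; exact: Lw_measurable_weight.
  - by apply/measurable_EFinP; exact: Lw_measurable_weight.
have mI : mu (`[t, +oo[ : set R) = +oo%E.
  by rewrite lebesgue_measure_itv/= ltry.
by rewrite integral_cst// [X in (_ * X < _)%E]mI gt0_muley ?ltxx// lte_fin.
Qed.

Lemma Lweighted_Lw (X : normedModType R) (r lam t : R) (f : R -> X) : 0 < r ->
  Lweighted r lam t f <-> borel `[t, +oo[ f /\ Lw t lam r (fun s => `|f s|).
Proof.
move=> r0.
have E : (\int[mu]_(s in `[t, +oo[) (`|expR (- lam * s / r) *: f s| `^ r)%:E =
    \int[mu]_(s in `[t, +oo[) (expR (- lam * s) * `| `|f s| | `^ r)%:E)%E.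
  apply: eq_integral => s _.
  by rewrite normrZ ger0_norm ?expR_ge0// -{1}(normr_id (f s)) weightE.
split=> [[bf i]|[bf [_ i]]]; split => //; last by rewrite E.
by split; [exact: borel_norm|rewrite -E].
Qed.

Lemma lsc_measurable d (T : measurableType d) (U : normedModType R) (h : U -> R)
    (D : set T) (u : T -> U) : measurable D ->
  lower_semicontinuous (fun w => (h w)%:E) -> borel D u ->
  measurable_fun D (fun s => h (u s)).
Proof.
move=> mD /lower_semicontinuousP hl /(borelP _ mD) bu.
apply: (measurability _ (RGenOInfty.measurableE R)) => //; move=> _ [_ [x ->] <-].
have := bu _ (hl x); congr (measurable (_ `&` _)).
by apply/seteqP; split=> s /=; rewrite in_itv/= andbT lte_fin.
Qed.

End WeightedAE.

Lemma lipschitz_continuous (R : realType) (X Y : normedModType R) (f : X -> Y)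
    (k : R) :
  (forall x y, `|f x - f y| <= k * `|x - y|) -> continuous f.
Proof.
move=> h x; apply/cvgrPdist_le => e e0.
have k0 : 0 < `|k| + 1 by rewrite ltr_wpDl.
apply/nbhs_ballP; exists (e / (`|k| + 1)); first by rewrite /= divr_gt0.
move=> y; rewrite -ball_normE /= => xy; rewrite (le_trans (h _ _))//.
apply: (@le_trans _ _ ((`|k| + 1) * `|x - y|)).
  by rewrite ler_wpM2r// (le_trans (ler_norm k))// lerDl.
by rewrite mulrC -ler_pdivlMr// ltW.
Qed.

Lemma borel_combination (R : realType) (X : normedModType R) (D : set R)
    (a b : R) (f g : R -> X) : separable X -> measurable D ->
  borel D f -> borel D g -> borel D (fun s => a *: f s + b *: g s).
Proof.
move=> sX mD bf bg.
apply: (borel_pair (F := fun z : X * X => a *: z.1 + b *: z.2) sX sX mD _ bf bg).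
move=> z; apply: (@cvgD _ _ _ (nbhs z) _ (fun z : X * X => a *: z.1)
  (fun z : X * X => b *: z.2)).
  by apply: (cvg_comp _ _ cvg_fst); exact: scaler_continuous.
by apply: (cvg_comp _ _ cvg_snd); exact: scaler_continuous.
Qed.

Lemma Lw_combination (R : realType) (X : normedModType R) (t lam m a b : R)
    (f g : R -> X) : separable X -> 0 < m ->
  borel `[t, +oo[ f -> borel `[t, +oo[ g ->
  Lw t lam m (fun s => `|f s|) -> Lw t lam m (fun s => `|g s|) ->
  Lw t lam m (fun s => `|a *: f s + b *: g s|).
Proof.
move=> sX m0 bf bg Lf Lg.
apply: (Lw_le m0 _ _ (Lw_add m0 (Lw_scale `|a| m0 Lf) (Lw_scale `|b| m0 Lg))).
  by apply: borel_norm => //; exact: borel_combination.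
move=> s _; rewrite normr_id ger0_norm ?addr_ge0 ?mulr_ge0//.
by rewrite (le_trans (ler_normD _ _))// !normrZ.
Qed.

(** * Trajectories, variations and sufficiency *)

Section Optimality.
Context {R : realType} {V U : hilbertType R}.
Variables (S : R -> dual V -> dual V) (S1 : R -> V -> V).
Variables (B : U -> dual V) (Bs : V -> U) (omega beta : R).
Hypothesis SC : C0_semigroup S.
Hypothesis S1C : C0_semigroup S1.
Hypothesis adj : forall (s : R) x v, 0 <= s -> S s x v = x (S1 s v).
Hypothesis gS : forall (s : R) x, 0 <= s -> `|S s x| <= expR (omega * s) * `|x|.
Hypothesis gS1 : forall (s : R) v, 0 <= s -> `|S1 s v| <= expR (omega * s) * `|v|.
Hypothesis B_linear : linear B.
Hypothesis beta0 : 0 <= beta.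
Hypothesis B_bound : forall u, `|B u| <= beta * `|u|.
Hypothesis BsP : is_control_adjoint B Bs.
Hypothesis sepV : separable V.
Hypothesis sepU : separable U.
Variables (g0 : dual V -> R) (dg0 : dual V -> V) (h0 : U -> R).
Hypothesis g0S : Sigma0 g0.
Hypothesis dg0P : is_predual_derivative g0 dg0.
Hypothesis h0_lsc : lower_semicontinuous (fun u => (h0 u)%:E).
Variables (t lam : R).
Local Notation mu := (@lebesgue_measure R).

(** The mild equation tested on V, with the semigroup moved to the test vector: scalar integrals
    only, and linear in the data. [mild_trajectory] and [trajectory_mild] relate it to
    [mild_state]. *)
Definition trajectory x (u : R -> U) (y : R -> dual V) :=
  forall s, t <= s -> forall v, y s v =
    S (s - t) x v + \int[mu]_(r in `[t, s]) dot (Bs (S1 (s - r) v)) (u r).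

Definition costate (G : R -> V) (pi : R -> V) := forall s, t <= s ->
  forall x : dual V, x (pi s) =
  \int[mu]_(r in `[s, +oo[) (x (expR (- lam * (r - s)) *: S1 (r - s) (G r)) : R).

Lemma mild_trajectory x u y : mild_state S B t x u y -> trajectory x u y.
Proof.
move=> h s ts v; rewrite -(state_weak adj BsP ts (h s ts) v).
by rewrite -dual_addE addrC subrK.
Qed.

Lemma trajectory_borel x u y : borel `[t, +oo[ u -> trajectory x u y ->
  borel `[t, +oo[ y.
Proof.
move=> bu hy.
exact: (state_trajectory_borel S1C adj gS1 beta0 B_bound BsP sepV sepU bu hy).
Qed.

Section Exponent.
Variables (m m' : R).
Hypotheses (m0 : 0 < m) (m'0 : 0 < m') (mm' : m^-1 + m'^-1 = 1).
Hypothesis om : omega * m < lam.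

Lemma trajectory_mild x u y : borel `[t, +oo[ u -> Lw t lam m (fun s => `|u s|) ->
  trajectory x u y -> mild_state S B t x u y.
Proof.
move=> bu Lu hy s ts.
apply: (state_bochner SC adj gS B_linear B_bound BsP sepV sepU m0 m'0 mm' om bu Lu ts).
by move=> v; rewrite dual_subE hy// addrC addKr.
Qed.

Lemma trajectory_Lw x u y : borel `[t, +oo[ u -> Lw t lam m (fun s => `|u s|) ->
  trajectory x u y -> Lw t lam m (fun s => `|y s|).
Proof.
move=> bu Lu hy; exact: (state_trajectory_Lw SC S1C adj gS gS1 B_linear beta0 B_bound
  BsP sepV sepU m0 m'0 mm' om bu Lu hy).
Qed.

Lemma trajectory_combination a b x x' u u' y y' :
  borel `[t, +oo[ u -> Lw t lam m (fun s => `|u s|) ->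
  borel `[t, +oo[ u' -> Lw t lam m (fun s => `|u' s|) ->
  trajectory x u y -> trajectory x' u' y' ->
  trajectory (a *: x + b *: x') (fun s => a *: u s + b *: u' s)
    (fun s => a *: y s + b *: y' s).
Proof.
move=> bu Lu bu' Lu' hy hy' s ts v; have mI : measurable (`[t, s] : set R) by [].
have st0 : 0 <= s - t by rewrite subr_ge0.
have iu := state_weak_integrable SC adj gS B_linear B_bound BsP sepU m0 m'0 mm' om bu Lu v ts.
have iu' := state_weak_integrable SC adj gS B_linear B_bound BsP sepU m0 m'0 mm' om bu' Lu' v ts.
have -> : \int[mu]_(r in `[t, s]) dot (Bs (S1 (s - r) v)) (a *: u r + b *: u' r) =
    a * (\int[mu]_(r in `[t, s]) dot (Bs (S1 (s - r) v)) (u r)) +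
    b * (\int[mu]_(r in `[t, s]) dot (Bs (S1 (s - r) v)) (u' r)).
  rewrite -RintegralZl// -[b * _]RintegralZl// -RintegralD//.
  - by apply: eq_Rintegral => r _; rewrite dotDr !dotZr.
  - exact: (@integrableZl _ _ R mu `[t, s] mI a _ iu).
  - exact: (@integrableZl _ _ R mu `[t, s] mI b _ iu').
rewrite dual_addE !dual_scaleE hy// hy'// (sgD SC)// !(sgZ SC)//.
by rewrite dual_addE !dual_scaleE; lra.
Qed.

Lemma trajectory_exists x u : borel `[t, +oo[ u -> Lw t lam m (fun s => `|u s|) ->
  exists y, trajectory x u y.
Proof.
move=> bu Lu.
have h s : exists z : dual V, t <= s -> forall v, z v =
    \int[mu]_(r in `[t, s]) dot (Bs (S1 (s - r) v)) (u r).
  have [ts|st] := leP t s; last by exists 0.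
  by have [z hz] := state_exists SC adj gS B_linear B_bound BsP sepU m0 m'0 mm' om bu Lu ts;
    exists z.
exists (fun s => S (s - t) x + sval (cid (h s))) => s ts v.
by rewrite dual_addE; case: cid => z /= ->.
Qed.

Lemma drift_borel y : borel `[t, +oo[ y -> borel `[t, +oo[ (fun s => dg0 (y s)).
Proof.
move=> bY; have [k _ [Lip _ _]] := predual_gradient g0S dg0P.
exact: (borel_comp (F := dg0) _ (lipschitz_continuous Lip) bY).
Qed.

Lemma running_cost_measurable u y : borel `[t, +oo[ u -> borel `[t, +oo[ y ->
  measurable_fun `[t, +oo[ (fun s => expR (- lam * s) * (g0 (y s) + h0 (u s))).
Proof.
move=> bu bY; apply: measurable_funM; first exact: measurable_weight.
apply: measurable_funD; last exact: lsc_measurable.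
have mD : measurable (`[t, +oo[ : set R) by [].
apply/(borel_real _ mD).
exact: (borel_comp (Y := R^o) mD (Sigma0_continuous g0S) bY).
Qed.

(** Both trajectories start from [x], so [z - y] is a state issued from 0 with control [v - u] and
    [duality] applies. With [G] the gradient of [g0] along [y], [phi] is the linear term in the
    comparison of costs. *)
Lemma variation_duality x u v y z G pi :
  borel `[t, +oo[ u -> Lw t lam m (fun s => `|u s|) ->
  borel `[t, +oo[ v -> Lw t lam m (fun s => `|v s|) ->
  trajectory x u y -> trajectory x v z ->
  borel `[t, +oo[ G -> Lw t lam m' (fun s => `|G s|) -> costate G pi ->
  let phi s := expR (- lam * s) * ((z s - y s) (G s) - dot (Bs (pi s)) (v s - u s)) in
  mu.-integrable `[t, +oo[ (EFin \o phi) /\ \int[mu]_(s in `[t, +oo[) phi s = 0.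
Proof.
move=> bu Lu bv Lv hy hz bG LG hpi phi.
have mD : measurable (`[t, +oo[ : set R) by [].
have EW : (fun s => 1 *: v s + -1 *: u s) = (fun s => v s - u s).
  by apply/funext => s; rewrite scale1r scaleN1r.
have bw : borel `[t, +oo[ (fun s => v s - u s).
  by rewrite -EW; exact: borel_combination.
have Lww : Lw t lam m (fun s => `|v s - u s|).
  have := Lw_combination 1 (-1) sepU m0 bv bu Lv Lu.
  by rewrite (_ : (fun s => `|1 *: v s + -1 *: u s|) = (fun s => `|v s - u s|))//;
    apply/funext => s; rewrite scale1r scaleN1r.
have hzeta s : t <= s -> forall w, (z s - y s) w =
    \int[mu]_(r in `[t, s]) dot (Bs (S1 (s - r) w)) (v r - u r).
  move=> ts w; have := trajectory_combination 1 (-1) bv Lv bu Lu hz hy ts w.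
  rewrite !scale1r !scaleN1r subrr (sg0 SC) ?subr_ge0// dual_zeroE add0r => ->.
  by apply: eq_Rintegral => r _; rewrite scale1r scaleN1r.
have [i1 i2 e12] := duality SC S1C adj gS gS1 B_linear beta0 B_bound BsP sepV sepU m0 m'0
  mm' om bw bG Lww LG hzeta hpi.
have E : phi = (fun s => expR (- lam * s) * (z s - y s) (G s) -
    expR (- lam * s) * dot (Bs (pi s)) (v s - u s)).
  by apply/funext => s; rewrite /phi mulrBr.
split; last by rewrite E RintegralB// e12 subrr.
rewrite E; exact: (@integrableB _ _ R mu _ mD _ _ i1 i2).
Qed.

Lemma costate_sufficient x u v y z pi :
  borel `[t, +oo[ u -> Lw t lam m (fun s => `|u s|) ->
  borel `[t, +oo[ v -> Lw t lam m (fun s => `|v s|) ->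
  trajectory x u y -> trajectory x v z ->
  Lw t lam m' (fun s => `|dg0 (y s)|) -> costate (fun s => dg0 (y s)) pi ->
  {ae mu, forall s, t <= s -> subdifferential h0 (u s) (- Bs (pi s))} ->
  (cost g0 h0 lam t u y <= cost g0 h0 lam t v z)%E.
Proof.
move=> bu Lu bv Lv hy hz LG hpi sub.
have bY := trajectory_borel bu hy; have bZ := trajectory_borel bv hz.
have [iphi phi0] := variation_duality bu Lu bv Lv hy hz (drift_borel bY) LG hpi.
have [k _ [_ gi _]] := predual_gradient g0S dg0P.
have mD : measurable (`[t, +oo[ : set R) by [].
apply: (integral_le_perturbed mD (running_cost_measurable bu bY)
  (running_cost_measurable bv bZ) iphi phi0).
apply: (ae_imply _ sub) => s hs; rewrite /= in_itv/= andbT => ts.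
have := hs ts (v s); have := gi (y s) (z s); rewrite dotNl => h1 h2.
by rewrite -mulrDr ler_wpM2l ?expR_ge0//; lra.
Qed.

End Exponent.
End Optimality.

Section Shift.
Context {R : realType}.
Local Notation mu := (@lebesgue_measure R).

Lemma Rintegral_shift (f : R -> R) (s : R) : measurable_fun setT f ->
  mu.-integrable `[s, +oo[ (EFin \o (fun r => f (r - s))) ->
  \int[mu]_(r in `[s, +oo[) f (r - s) = \int[mu]_(r in `[0, +oo[) f r.
Proof.
move=> mf fi; rewrite /Rintegral; congr fine.
pose phi (r : measurableTypeR R) : measurableTypeR R := r - s.
have mphi : measurable_fun setT phi by apply: (@measurable_funB _ (measurableTypeR R) R).
have P : phi @^-1` `[0, +oo[%classic = `[s, +oo[%classic.
  by apply/seteqP; split=> r /=; rewrite !in_itv/= !andbT subr_ge0.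
have E A : measurable A -> pushforward mu phi A = mu A.
  move=> mA; apply/esym/lebesgue_measure_unique => //= _ [[a b]] _ <-.
  rewrite /pushforward (_ : phi @^-1` _ = `]a + s, b + s]%classic); last first.
    by apply/seteqP; split=> r /=; rewrite !in_itv/= ltrBrDr lerBlDr.
  rewrite !lebesgue_measure_itv/= !lte_fin ltrD2r; case: ifP => // _.
  by rewrite -!EFinB; congr EFin; lra.
have mEf : measurable_fun setT (EFin \o f : measurableTypeR R -> _) by exact/measurable_EFinP.
have := @integral_pushforward _ _ (measurableTypeR R) (measurableTypeR R) R phi mphi mu
  `[0, +oo[%classic (EFin \o f) mEf.
rewrite P => /(_ fi (measurable_itv _)) <-.
by apply: eq_measure_integral => A mA _; exact: E.
Qed.

End Shift.

(** * Co-states of constant sources *)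

Section Vanishing.
Context {R : realType} {V : hilbertType R}.
Variables (S : R -> dual V -> dual V) (S1 : R -> V -> V) (omega : R).
Hypothesis S1C : C0_semigroup S1.
Hypothesis adj : forall (s : R) x v, 0 <= s -> S s x v = x (S1 s v).
Hypothesis gS1 : forall (s : R) v, 0 <= s -> `|S1 s v| <= expR (omega * s) * `|v|.
Hypothesis sepV : separable V.
Variables (t lam : R).
Local Notation mu := (@lebesgue_measure R).

Variables (c : V) (kappa : R -> V).
Let F (x : dual V) (s r : R) : R := x (expR (- lam * (r - s)) *: S1 (r - s) c).
Hypothesis Fi : forall s x, t <= s -> mu.-integrable `[s, +oo[ (EFin \o F x s).
Hypothesis hk : costate S1 t lam (fun=> c) kappa.

Let f (x : dual V) (a : R) : R := expR (- lam * a) * x (S1 `|a| c).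

Let fE x s r : s <= r -> F x s r = f x (r - s).
Proof. by move=> sr; rewrite /F /f dualZ ger0_norm ?subr_ge0. Qed.

Let mf x : measurable_fun setT (f x).
Proof.
apply: measurable_funM.
  by apply: measurableT_comp => //; exact: measurable_funM.
apply: (measurable_dual_costate S1C gS1 sepV (a := idfun) (G := fun=> c)) => //.
  exact: measurable_id.
exact: borel_cst.
Qed.

Lemma constant_costate s : t <= s -> kappa s = kappa t.
Proof.
move=> ts; apply: dual_separates => x.
have E r : t <= r -> x (kappa r) = \int[mu]_(a in `[0, +oo[) f x a.
  move=> tr; rewrite hk// -(Rintegral_shift (s := r) (mf x)).
    apply: eq_Rintegral => a; rewrite inE/= in_itv/= andbT => ra.
    by rewrite -fE.
  have mI : measurable (`[r, +oo[ : set R) by [].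
  apply: (@eq_integrable _ _ R mu _ mI (EFin \o F x r)); last exact: Fi.
  by move=> a; rewrite inE/= in_itv/= andbT => ra; rewrite /= fE.
by rewrite !E.
Qed.

(** Injectivity of a resolvent, without a resolvent. Test against [dot_dual c]: the part of the
    integral beyond [t + h] is a multiple of [S h x] applied to the co-state at [t + h], which is 0.
    So the part on [[t, t + h]] is 0 as well, although for small [h] its integrand is at least
    [|c|^2 / 2], the weight being at least 1. *)
Lemma constant_costate_eq0 : lam <= 0 -> kappa t = 0 -> c = 0.
Proof.
move=> l0 k0; apply/eqP; apply: contraT => c0.
have nc : 0 < `|c| by rewrite normr_gt0.
have c2 : 0 < `|c| / 2 by rewrite divr_gt0.
have [h h0 hc] := sg_right S1C c c2.
pose x := dot_dual c.
have xi := Fi x (lexx t).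
have xk : \int[mu]_(r in `[t, +oo[) F x t r = 0 by rewrite -hk// k0 linear0.
have tht : t <= t + h by rewrite lerDl ltW.
have := Rintegral_itvB (x := t + h) xi; rewrite !bnd_simp tht xk sub0r.
move=> /(_ isT isT) e1.
have mI : measurable (`[t + h, +oo[ : set R) by [].
have tl : \int[mu]_(r in `]t + h, +oo[) F x t r = 0.
  rewrite Rintegral_itv_obnd_cbnd; last first.
    apply: (@integrableS _ _ R mu `[t, +oo[) xi => //.
    by move=> r /=; rewrite !in_itv/= !andbT => /ltW; apply: le_trans; rewrite lerDl ltW.
  transitivity (\int[mu]_(r in `[t + h, +oo[) (expR (- lam * h) * F (S h x) (t + h) r)).
    apply: eq_Rintegral => r; rewrite inE/= in_itv/= andbT => thr.
    rewrite /F (_ : r - t = h + (r - (t + h))); last by ring.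
    rewrite (sg_add S1C c (ltW h0)) ?subr_ge0// !dualZ adj ?(ltW h0)//.
    by rewrite mulrDr expRD mulrA.
  rewrite RintegralZl//; last exact: Fi.
  by rewrite -hk// constant_costate// k0 linear0 mulr0.
move: e1; rewrite tl => /eqP; rewrite oppr_eq0 => /eqP e1.
have : 0 < \int[mu]_(r in `[t, t + h]) (`|c| ^+ 2 / 2).
  rewrite Rintegral_cst//= lebesgue_measure_itv/= lte_fin ltrDl h0 -EFinB/=.
  by rewrite mulr_gt0 ?divr_gt0 ?exprn_gt0// addrAC subrr add0r.
suff : \int[mu]_(r in `[t, t + h]) (`|c| ^+ 2 / 2) <= 0.
  by move=> /le_lt_trans /[apply]; rewrite ltxx.
rewrite -e1; apply: le_Rintegral => //.
- exact: itv_integrable_cst.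
- apply: (@integrableS _ _ R mu `[t, +oo[) xi => //.
  by move=> r /=; rewrite !in_itv/= andbT => /andP[].
move=> r /=; rewrite in_itv/= => /andP[tr rth].
rewrite fE// /f ger0_norm ?subr_ge0//.
have hr : `|S1 (r - t) c - c| <= `|c| / 2.
  by apply: hc; rewrite subr_ge0 tr lerBlDl.
have h1 : `|c| ^+ 2 / 2 <= x (S1 (r - t) c).
  have -> : x (S1 (r - t) c) = `|c| ^+ 2 + dot c (S1 (r - t) c - c).
    by rewrite /x dot_dualE dotBr dotxx; lra.
  have : `|dot c (S1 (r - t) c - c)| <= `|c| * (`|c| / 2).
    by rewrite (le_trans (CauchySchwarz _ _))// ler_wpM2l.
  by rewrite ler_norml expr2 mulrA => /andP[+ _]; lra.
apply: (le_trans h1); rewrite ler_peMl//.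
  by apply: le_trans h1; rewrite divr_ge0// exprn_ge0.
by rewrite -expR0 ler_expR mulr_ge0 ?oppr_ge0// subr_ge0.
Qed.

End Vanishing.

Section Integrability.
Context {R : realType}.
Local Notation mu := (@lebesgue_measure R).

Lemma Lw_integrable (t lam m : R) (a : R -> R) : Lw t lam m a ->
  mu.-integrable `[t, +oo[ (EFin \o (fun s => expR (- lam * s) * `|a s| `^ m)).
Proof.
move=> [ma ia]; apply/integrableP; split.
  by apply/measurable_EFinP; exact: Lw_measurable_weight.
apply: le_lt_trans ia; rewrite le_eqVlt; apply/orP; left; apply/eqP.
apply: eq_integral => s _; rewrite /= ger0_norm//.
Qed.

Lemma quadratic_integrable (t lam c0 c1 : R) (w f : R -> R) : 0 < lam -> 0 <= c0 -> 0 <= c1 ->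
  measurable_fun `[t, +oo[ f -> Lw t lam 2 w ->
  (forall s, t <= s -> `|f s| <= c0 + c1 * `|w s| ^+ 2) ->
  mu.-integrable `[t, +oo[ (EFin \o (fun s => expR (- lam * s) * f s)).
Proof.
move=> l0 c00 c10 mf Lww fw; have mD : measurable (`[t, +oo[ : set R) by [].
have p20 : 0 < 2 :> R by [].
have i1 := Lw_integrable (Lw_cst t (1 : R) p20 l0).
have i2 := Lw_integrable Lww.
have i1' := @integrableZl _ _ R mu _ mD c0 _ i1.
have i2' := @integrableZl _ _ R mu _ mD c1 _ i2.
have ii := @integrableD _ _ R mu _ mD _ _ i1' i2'.
apply: (@le_integrable _ _ R mu `[t, +oo[ mD _ _ _ _ ii).
  apply/measurable_EFinP; apply: measurable_funM => //; exact: measurable_weight.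
move=> s; rewrite /= in_itv/= andbT => ts; rewrite lee_fin normr1 powR1 mulr1.
rewrite (powR_mulrn 2)// normrM (ger0_norm (expR_ge0 _)).
rewrite [leRHS]ger0_norm; last first.
  by rewrite addr_ge0 ?mulr_ge0 ?expR_ge0// exprn_ge0.
by rewrite !(mulrCA _ (expR _)) (mulrC c0) -mulrDr ler_wpM2l ?expR_ge0 ?fw.
Qed.

(** A value below [+oo] says little alone, an infinite negative part giving [-oo]. The minorant
    makes the negative part finite, and then the positive part must be finite too. *)
Lemma integrable_of_lower_bound (D : set R) (f g : R -> R) : measurable D ->
  measurable_fun D f -> mu.-integrable D (EFin \o g) ->
  (forall s, D s -> g s <= f s) -> (\int[mu]_(s in D) (f s)%:E < +oo)%E ->
  mu.-integrable D (EFin \o f).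
Proof.
move=> mD mf gi gf fi.
have mEf : measurable_fun D (EFin \o f) by exact/measurable_EFinP.
have fn : (\int[mu]_(s in D) (EFin \o f)^\- s < +oo)%E.
  have /integrableP[_] := gi; apply: le_lt_trans.
  apply: ge0_le_integral => //.
  - exact: measurable_funeneg.
  - by apply: measurableT_comp => //; exact: measurable_int gi.
  move=> s Ds; rewrite funenegE /= -EFin_max lee_fin ge_max normr_ge0 andbT.
  by apply: (@le_trans _ _ (- g s)); rewrite ?lerN2 ?gf// -normrN ler_norm.
have fp : (\int[mu]_(s in D) (EFin \o f)^\+ s < +oo)%E.
  rewrite ltey; apply/eqP => fpoo; move: fi.
  rewrite [X in (X < _)%E](_ : _ = \int[mu]_(s in D) (EFin \o f) s)%E// integralE fpoo.
  rewrite addye ?ltxx//; apply/eqP => /eqP; rewrite eqe_oppLR /= => /eqP h.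
  by move: fn; rewrite h ltxx.
apply/integrableP; split => //.
rewrite (_ : (\int[mu]_(s in D) _)%E = \int[mu]_(s in D)
    ((EFin \o f)^\+ s + (EFin \o f)^\- s))%E; last first.
  by apply: eq_integral => s _; rewrite -[LHS]/((abse \o (EFin \o f)) s) fune_abse.
rewrite ge0_integralD//; first exact: lte_add_pinfty.
- exact: measurable_funepos.
- exact: measurable_funeneg.
Qed.

End Integrability.

Section Drift.
Context {R : realType} {V : hilbertType R}.
Variables (S : R -> dual V -> dual V) (S1 : R -> V -> V) (omega : R).
Hypothesis S1C : C0_semigroup S1.
Hypothesis adj : forall (s : R) x v, 0 <= s -> S s x v = x (S1 s v).
Hypothesis gS1 : forall (s : R) v, 0 <= s -> `|S1 s v| <= expR (omega * s) * `|v|.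
Hypothesis sepV : separable V.
Variables (t lam m m' : R).
Hypotheses (m0 : 0 < m) (m'0 : 0 < m') (mm' : m^-1 + m'^-1 = 1).
Hypothesis om : omega * m < lam.
Local Notation mu := (@lebesgue_measure R).

Lemma costate_choice (G : R -> V) : borel `[t, +oo[ G ->
  Lw t lam m' (fun s => `|G s|) -> exists pi, costate S1 t lam G pi.
Proof.
move=> bG LG.
have h s : exists v : V, t <= s -> forall x : dual V, x v =
    \int[mu]_(r in `[s, +oo[) (x (expR (- lam * (r - s)) *: S1 (r - s) (G r)) : R).
  have [ts|st] := leP t s; last by exists 0.
  by have [v hv] := costate_exists S1C gS1 sepV m0 m'0 mm' om bG LG ts; exists v.
by exists (fun s => sval (cid (h s))) => s ts; case: cid => v /= /(_ ts).
Qed.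

(* If G differs from c by an element of L^m', then pi minus the co-state of
   G - c is the co-state of the constant c, a constant vector; as lam <= 0 it
   can only be in a weighted space if it vanishes. *)
Lemma costate_drift_eq0 (c : V) (G pi : R -> V) : 0 <= t -> lam <= 0 ->
  borel `[t, +oo[ G -> Lw t lam m' (fun s => `|G s - c|) ->
  Lw t lam m' (fun s => `|pi s|) ->
  (forall s, t <= s -> is_bochner_integral `[s, +oo[
    (fun r => expR (- lam * (r - s)) *: S1 (r - s) (G r)) (pi s)) -> c = 0.
Proof.
move=> t0 l0 bG LE Lpi hpi; have mD : measurable (`[t, +oo[ : set R) by [].
have bE : borel `[t, +oo[ (fun s => G s - c).
  rewrite (_ : (fun s => G s - c) = (fun s => 1 *: G s + (-1) *: c)).
    by apply: borel_combination => //; exact: borel_cst.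
  by apply/funext => s; rewrite scale1r scaleN1r.
have [rho hrho] := costate_choice bE LE.
have Lrho := costate_Lw S1C gS1 sepV m0 m'0 mm' om bE LE hrho.
(* As long as [c] may be nonzero, [G] is not known to be in a weighted space; this integrability is
   extracted from the existence of the Bochner integral defining [pi]. *)
have FG s (x : dual V) : t <= s -> mu.-integrable `[s, +oo[
    (EFin \o (fun r => x (expR (- lam * (r - s)) *: S1 (r - s) (G r)) : R)).
  move=> ts; have mI : measurable (`[s, +oo[ : set R) by [].
  have [bf _] := hpi s ts.
  exact: (functional_integrable (@dual_linear _ _ x) (dual_le x) mI bf
    (bochner_norm_integrable mI (hpi s ts))).
have FE s x (ts : t <= s) := costate_weak_integrable S1C gS1 sepV m0 m'0 mm' om bE LE x ts.
have cE s r (x : dual V) : s <= r ->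
    x (expR (- lam * (r - s)) *: S1 (r - s) (G r)) -
    x (expR (- lam * (r - s)) *: S1 (r - s) (G r - c)) =
    x (expR (- lam * (r - s)) *: S1 (r - s) c).
  by move=> sr; rewrite -dualB -scalerBr -(sgB S1C) ?subr_ge0// subKr.
have Fc s (x : dual V) : t <= s -> mu.-integrable `[s, +oo[
    (EFin \o (fun r => x (expR (- lam * (r - s)) *: S1 (r - s) c) : R)).
  move=> ts; have mI : measurable (`[s, +oo[ : set R) by [].
  have ii := @integrableB _ _ R mu _ mI _ _ (FG s x ts) (FE s x ts).
  apply: (@eq_integrable _ _ R mu `[s, +oo[ mI _ _ _ ii).
  by move=> r; rewrite inE/= in_itv/= andbT => sr; rewrite /= -EFinB cE.
have hk : costate S1 t lam (fun=> c) (fun s => pi s - rho s).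
  move=> s ts x; have mI : measurable (`[s, +oo[ : set R) by [].
  rewrite dualB (costate_weak ts (hpi s ts)) hrho// -RintegralB//.
  - by apply: eq_Rintegral => r; rewrite inE/= in_itv/= andbT => sr; exact: cE.
  - exact: FG.
  - exact: FE.
apply: (constant_costate_eq0 S1C adj gS1 sepV Fc hk l0).
apply/eqP; apply: contraT => k0.
have kp : 0 < `|pi t - rho t| by rewrite normr_gt0.
suff : False by [].
apply: (Lw_const_absurd t0 l0 m'0 m'0 kp Lpi Lrho).
apply: aeW => s ts.
rewrite !normr_id -(constant_costate S1C gS1 sepV Fc hk ts).
exact: ler_normB.
Qed.

End Drift.

(** * The maximum principle *)

Section MaximumPrinciple.
Context {R : realType} {V U : hilbertType R}.
Variables (S : R -> dual V -> dual V) (S1 : R -> V -> V).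
Variables (B : U -> dual V) (Bs : V -> U) (omega beta : R).
Hypothesis SC : C0_semigroup S.
Hypothesis S1C : C0_semigroup S1.
Hypothesis adj : forall (s : R) x v, 0 <= s -> S s x v = x (S1 s v).
Hypothesis gS : forall (s : R) x, 0 <= s -> `|S s x| <= expR (omega * s) * `|x|.
Hypothesis gS1 : forall (s : R) v, 0 <= s -> `|S1 s v| <= expR (omega * s) * `|v|.
Hypothesis B_linear : linear B.
Hypothesis beta0 : 0 <= beta.
Hypothesis B_bound : forall u, `|B u| <= beta * `|u|.
Hypothesis BsP : is_control_adjoint B Bs.
Hypothesis sepV : separable V.
Hypothesis sepU : separable U.
Variables (g0 : dual V -> R) (dg0 : dual V -> V) (h0 : U -> R).
Hypothesis g0S : Sigma0 g0.
Hypothesis dg0P : is_predual_derivative g0 dg0.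
Hypothesis h0_convex : @convex_function R U setT h0.
Hypothesis h0_lsc : lower_semicontinuous (fun u => (h0 u)%:E).
Hypothesis conj0 : convex_conjugate h0 0 = 0%E.
Hypothesis conj_fin : forall s : U, convex_conjugate h0 s \is a fin_num.
Hypothesis conjS : Sigma0 (fun s : U => fine (convex_conjugate h0 s)).
Variables (t lam p q a b : R).
Hypotheses (p_ge2 : 2 <= p) (q0 : 0 < q) (pq : p^-1 + q^-1 = 1).
Hypothesis a0 : 0 < a.
Hypothesis h0_growth : forall u : U, a * `|u| `^ p + b <= h0 u.
Hypotheses (om1 : omega < lam) (om2 : omega * 2 < lam) (t0 : 0 <= t).
Local Notation mu := (@lebesgue_measure R).
Local Notation ctrl := (conj_gradient conjS).

Let p0 : 0 < p. Proof. by apply: lt_le_trans p_ge2. Qed.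

Let two0 : 0 < 2 :> R. Proof. by []. Qed.

Let half2 : 2^-1 + 2^-1 = 1 :> R. Proof. by field. Qed.

Let q_ge1 : 1 <= q.
Proof.
have pi0 : 0 < p^-1 by rewrite invr_gt0.
have : q^-1 <= 1 by move: pq; lra.
by rewrite invf_le1.
Qed.

Let q_le2 : q <= 2.
Proof.
have : p^-1 <= 2^-1 by rewrite lef_pV2 ?posrE.
move=> h; have : q * 2^-1 <= q * q^-1 by rewrite ler_wpM2l ?(ltW q0)//; move: pq half2; lra.
by rewrite mulfV ?gt_eqF//; lra.
Qed.

Let Bs_pi_borel pi : borel `[t, +oo[ pi -> borel `[t, +oo[ (fun s => - Bs (pi s)).
Proof.
move=> bpi; apply: (borel_comp (F := fun v => - Bs v)) bpi => // v.
by apply: cvgN; exact: (Bs_continuous beta0 B_bound BsP).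
Qed.

Lemma drift_Lw y : 0 < lam -> borel `[t, +oo[ y -> Lw t lam 2 (fun s => `|y s|) ->
  Lw t lam 2 (fun s => `|dg0 (y s)|).
Proof.
move=> l0 bY LY; have [k k0 [Lip _ _]] := predual_gradient g0S dg0P.
apply: (Lw_le two0 _ _ (Lw_add two0 (Lw_cst t (`|dg0 0| : R) two0 l0)
  (Lw_scale k two0 LY))).
  by apply: borel_norm => //; exact: (drift_borel g0S dg0P).
move=> s _; rewrite normr_id ger0_norm ?addr_ge0 ?mulr_ge0//.
rewrite -{1}(subrK (dg0 0) (dg0 (y s))) addrC (le_trans (ler_normD _ _))//.
by rewrite lerD2l (le_trans (Lip _ _))// subr0.
Qed.

Lemma mild_costateE y pi : mild_costate lam S1 dg0 t y pi ->
  costate S1 t lam (fun s => dg0 (y s)) pi.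
Proof. by move=> h s ts x; exact: (costate_weak ts (h s ts)). Qed.

Lemma costate_optimal x u y pi v z :
  Lweighted p lam t u -> mild_state S B t x u y ->
  Lweighted q lam t pi -> mild_costate lam S1 dg0 t y pi ->
  {ae mu, forall s, t <= s -> subdifferential h0 (u s) (- Bs (pi s))} ->
  Lweighted p lam t v -> mild_state S B t x v z ->
  (cost g0 h0 lam t u y <= cost g0 h0 lam t v z)%E.
Proof.
move=> /(Lweighted_Lw lam t u p0)[bu Lu] hy /(Lweighted_Lw lam t pi q0)[bpi Lpi] hpi sub.
move=> /(Lweighted_Lw lam t v p0)[bv Lv] hz.
have ty := mild_trajectory adj BsP hy; have tz := mild_trajectory adj BsP hz.
have bY := trajectory_borel S1C adj gS1 beta0 B_bound BsP sepV sepU bu ty.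
have [l0|l0] := ltP 0 lam.
  have L2 := Lw_exponent l0 two0 p_ge2.
  have LY := trajectory_Lw SC S1C adj gS gS1 B_linear beta0 B_bound BsP sepV sepU
    two0 two0 half2 om2 bu (L2 _ _ Lu) ty.
  exact: (costate_sufficient SC S1C adj gS gS1 B_linear beta0 B_bound BsP sepV sepU
    g0S dg0P h0_lsc two0 two0 half2 om2 bu (L2 _ _ Lu) bv (L2 _ _ Lv) ty tz
    (drift_Lw l0 bY LY) (mild_costateE hpi) sub).
(* From [2 omega < lam <= 0]. A negative [omega] makes the condition easier for larger exponents, so
   it passes from 2 to [p]. *)
have omn : omega < 0 by move: om2; lra.
have omp : omega * p < lam by apply: le_lt_trans om2; rewrite ler_nM2l.
have omq : omega * q < lam by apply: le_lt_trans om1; rewrite ger_nMr ?q_ge1.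
have qp : q^-1 + p^-1 = 1 by rewrite addrC.
have [k k0 [kLip _]] := conj_gradient_props conjS.
(* Almost everywhere [u] is the conjugate gradient at [- Bs (pi s)], so it is within a multiple of
   [|pi s|] of the value at 0. A nonzero value there would keep [|u|] plus this multiple away from
   0, contradicting [Lw_const_absurd]. *)
have close s : subdifferential h0 (u s) (- Bs (pi s)) ->
    `|u s - ctrl 0| <= `|(k * beta) * `|pi s| |.
  move=> /(subdifferential_gradient conj_fin conjS) ->.
  rewrite (le_trans (kLip _ _))// subr0 normrN ger0_norm ?mulr_ge0// -mulrA.
  by rewrite ler_wpM2l// (Bs_bound beta0 B_bound BsP).
have c0 : ctrl 0 = 0.
  apply/eqP; apply: contraT => n0; have np : 0 < `|ctrl 0| by rewrite normr_gt0.
  suff : False by [].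
  apply: (Lw_const_absurd t0 l0 p0 q0 np Lu (Lw_scale (k * beta) q0 Lpi)).
  apply: (ae_imply _ sub) => s hs ts; have := close s (hs ts).
  rewrite normr_id => h; have := ler_normB (u s) (u s - ctrl 0).
  by rewrite subKr => /le_trans; apply; rewrite lerD2l.
have Luq : Lw t lam q (fun s => `|u s|).
  apply: (Lw_le_ae q0 _ _ (Lw_scale (k * beta) q0 Lpi)); first exact: borel_norm.
  apply: (ae_imply _ sub) => s hs ts; rewrite normr_id.
  by have := close s (hs ts); rewrite c0 subr0.
(* Dominated by the co-state, [u] is in [L^q_lam]; as [omega q <= omega < lam], so is the
   trajectory. *)
have LY := trajectory_Lw SC S1C adj gS gS1 B_linear beta0 B_bound BsP sepV sepU
  q0 p0 qp omq bu Luq ty.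
have [kg kg0 [gLip _ _]] := predual_gradient g0S dg0P.
have bG := drift_borel g0S dg0P bY.
have gle s : t <= s -> `|dg0 (y s) - dg0 0| <= `|kg * `|y s| |.
  by move=> _; rewrite (le_trans (gLip _ _))// subr0 ger0_norm ?mulr_ge0.
have d0 : dg0 0 = 0.
  apply: (costate_drift_eq0 S1C adj gS1 sepV p0 q0 pq omp t0 l0 bG _ Lpi hpi).
  apply: (Lw_le q0 _ _ (Lw_scale kg q0 LY)); last by move=> s ts; rewrite normr_id gle.
  apply: borel_norm => //.
  apply: (borel_comp (F := fun v => v - dg0 0)) bG => // w.
  by apply: cvgB; [exact: cvg_id|exact: cvg_cst].
have LG : Lw t lam q (fun s => `|dg0 (y s)|).
  apply: (Lw_le q0 _ _ (Lw_scale kg q0 LY)); first exact: borel_norm.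
  by move=> s ts; have := gle s ts; rewrite d0 subr0 normr_id.
exact: (costate_sufficient SC S1C adj gS gS1 B_linear beta0 B_bound BsP sepV sepU
  g0S dg0P h0_lsc p0 q0 pq omp bu Lu bv Lv ty tz LG (mild_costateE hpi) sub).
Qed.

Lemma drift_growth : exists2 C : R, 0 <= C & forall y, `|g0 y| <= C + C * `|y| ^+ 2.
Proof.
have [k k0 [_ lo hi]] := predual_gradient g0S dg0P.
exists (`|g0 0| + `|dg0 0| ^+ 2 + 1 + k).
  by rewrite !addr_ge0// exprn_ge0.
move=> y; have := lo 0 y; have := hi 0 y; rewrite subr0.
have := dual_le y (dg0 0); rewrite ler_norml => /andP[].
have := ler_norm (g0 0); have := ler_norm (- g0 0); rewrite normrN.
have : 0 <= (`|y| - `|dg0 0|) ^+ 2 by exact: sqr_ge0.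
rewrite sqrrB -mulr_natr.
have : 0 <= `|g0 0| * `|y| ^+ 2 by rewrite mulr_ge0// exprn_ge0.
have : 0 <= `|dg0 0| ^+ 2 * `|y| ^+ 2 by rewrite mulr_ge0// exprn_ge0.
have : 0 <= `|y| ^+ 2 by rewrite exprn_ge0.
have : 0 <= `|dg0 0| ^+ 2 by rewrite exprn_ge0.
have : 0 <= k * `|y| ^+ 2 by rewrite mulr_ge0// exprn_ge0.
rewrite ler_norml !mulrDl mul1r.
move: (`|y| ^+ 2) (`|dg0 0| ^+ 2) => Y D.
move: (y (dg0 0)) (g0 0) (g0 y) => yd g00 gy *.
by apply/andP; split; lra.
Qed.

(** Equality in Fenchel-Young at [ctrl s], compared with the competitor [ctrl 0] of zero cost, gives
    [h0 (ctrl s) <= dot s (ctrl s - ctrl 0)]; the Lipschitz bound makes this quadratic. *)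
Lemma ctrl_cost_le : exists2 C : R, 0 <= C & forall s : U,
  0 <= h0 (ctrl s) <= C * `|s| ^+ 2.
Proof.
have [k k0 [kLip _]] := conj_gradient_props conjS.
exists k => // s; rewrite (cost_ge0 conj0 conj_fin)/=.
have h1 := gradient_attains h0_lsc conj_fin conjS s.
have h2 := fenchel_young conj_fin s (ctrl 0).
rewrite (cost_gradient0 h0_lsc conj0 conj_fin) subr0 in h2.
have h3 : dot s (ctrl s - ctrl 0) <= k * `|s| ^+ 2.
  rewrite (le_trans (ler_norm _))// (le_trans (CauchySchwarz _ _))//.
  rewrite expr2 mulrCA ler_wpM2l// (le_trans (kLip _ _))// subr0//.
by move: h3; rewrite dotBr; lra.
Qed.

(** Coercivity raises the exponent from 2 to [p]: [a |ctrl s|^p + b <= h0 (ctrl s) <= C |s|^2]. The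
    constant [b] is integrable because [lam > 0]. *)
Lemma ctrl_Lw s : 0 < lam -> borel `[t, +oo[ s -> Lw t lam 2 (fun r => `|s r|) ->
  borel `[t, +oo[ (fun r => ctrl (s r)) /\ Lw t lam p (fun r => `|ctrl (s r)|).
Proof.
move=> l0 bs Ls; have mD : measurable (`[t, +oo[ : set R) by [].
have [k k0 [kLip _]] := conj_gradient_props conjS.
have bc : borel `[t, +oo[ (fun r => ctrl (s r)).
  exact: (borel_comp (F := ctrl) mD (lipschitz_continuous kLip) bs).
split; [exact: bc|split; first exact: borel_norm].
have [C C0 hC] := ctrl_cost_le.
have mp : measurable_fun `[t, +oo[ (fun r => `|ctrl (s r)| `^ p).
  by apply: (measurableT_comp (measurable_powR _)); exact: borel_norm.
have : mu.-integrable `[t, +oo[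
    (EFin \o (fun r => expR (- lam * r) * `|ctrl (s r)| `^ p)).
  apply: (quadratic_integrable (c0 := a^-1 * `|b|) (c1 := a^-1 * C) l0 _ _ mp Ls).
  - by rewrite mulr_ge0// invr_ge0 ltW.
  - by rewrite mulr_ge0// invr_ge0 ltW.
  move=> r tr; rewrite ger0_norm ?powR_ge0// normr_id -mulrA -mulrDr ler_pdivlMl//.
  have := h0_growth (ctrl (s r)); have /andP[_] := hC (s r).
  by have := ler_norm (- b); rewrite normrN; lra.
move=> /integrableP[_]; apply: le_lt_trans; rewrite le_eqVlt; apply/orP; left.
apply/eqP; apply: eq_integral => r _ /=.
by rewrite normr_id ger0_norm// mulr_ge0 ?expR_ge0// powR_ge0.
Qed.

Let running u y s : R := expR (- lam * s) * (g0 (y s) + h0 (u s)).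

(* The cost along u + e (uh - u), with uh = ctrl (- Bs pi), is at most the cost
   of u minus e times the integral of the Fenchel-Young gap of u plus O(e^2):
   the first-order terms in y and in Bs pi cancel by duality. *)
Lemma optimal_subdifferential x u y uh z pi :
  0 < lam -> borel `[t, +oo[ u -> Lw t lam p (fun s => `|u s|) -> trajectory S S1 Bs t x u y ->
  borel `[t, +oo[ uh -> Lw t lam p (fun s => `|uh s|) -> trajectory S S1 Bs t x uh z ->
  costate S1 t lam (fun s => dg0 (y s)) pi ->
  (forall v w, Lweighted p lam t v -> mild_state S B t x v w ->
    (cost g0 h0 lam t u y <= cost g0 h0 lam t v w)%E) ->
  (forall s, uh s = ctrl (- Bs (pi s))) ->
  {ae mu, forall s, t <= s -> subdifferential h0 (u s) (- Bs (pi s))}.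
Proof.
move=> l0 bu Lu ty buh Luh tz hpi opt uhE.
have mD : measurable (`[t, +oo[ : set R) by [].
have L2 := Lw_exponent l0 two0 p_ge2.
have Lu2 := L2 _ _ Lu; have Luh2 := L2 _ _ Luh.
have tb := trajectory_borel S1C adj gS1 beta0 B_bound BsP sepV sepU.
have tL := trajectory_Lw SC S1C adj gS gS1 B_linear beta0 B_bound BsP sepV sepU
    two0 two0 half2 om2.
have bY := tb _ _ _ _ bu ty; have bZ := tb _ _ _ _ buh tz.
have LY := tL _ _ _ _ bu Lu2 ty; have LZ := tL _ _ _ _ buh Luh2 tz.
have bG := drift_borel g0S dg0P bY; have LG := drift_Lw l0 bY LY.
have bpi := costate_borel S1C gS1 sepV bG hpi.
have Lpi := costate_Lw S1C gS1 sepV two0 two0 half2 om2 bG LG hpi.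
have bs := Bs_pi_borel bpi.
have Ls : Lw t lam 2 (fun s => `|- Bs (pi s)|).
  apply: (Lw_le two0 _ _ (Lw_scale beta two0 Lpi)); first exact: borel_norm.
  move=> s _; rewrite normr_id normrN ger0_norm ?mulr_ge0//.
  exact: (Bs_bound beta0 B_bound BsP).
pose phi s : R := expR (- lam * s) *
  ((z s - y s) (dg0 (y s)) - dot (Bs (pi s)) (uh s - u s)).
have [iphi phi0] : mu.-integrable `[t, +oo[ (EFin \o phi) /\
    \int[mu]_(s in `[t, +oo[) phi s = 0.
  exact: (variation_duality SC S1C adj gS gS1 B_linear beta0 B_bound BsP
    sepV sepU two0 two0 half2 om2 bu Lu2 buh Luh2 ty tz bG LG hpi).
have sY := separable_dual sepV.
have Lz : Lw t lam 2 (fun s => `|1 *: z s + (-1) *: y s|).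
  exact: (Lw_combination 1 (-1) sY two0 bZ bY LZ LY).
have [Cg Cg0 hCg] := drift_growth; have [Ch Ch0 hCh] := ctrl_cost_le.
have [k k0 [_ _ hi]] := predual_gradient g0S dg0P.
have mg w : borel `[t, +oo[ w -> measurable_fun `[t, +oo[ (fun s => g0 (w s)).
  move=> bw; apply/(borel_real _ mD).
  exact: (borel_comp (Y := R^o) mD (Sigma0_continuous g0S) bw).
have ig w : borel `[t, +oo[ w -> Lw t lam 2 (fun s => `|w s|) ->
    mu.-integrable `[t, +oo[ (EFin \o (fun s : R => expR (- lam * s) * g0 (w s))).
  move=> bw Lww; apply: (quadratic_integrable l0 Cg0 Cg0 (mg w bw) Lww) => s _.
  by rewrite normr_id.
have mh := lsc_measurable mD h0_lsc.
have ihh : mu.-integrable `[t, +oo[ (EFin \o (fun s : R => expR (- lam * s) * h0 (uh s))).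
  apply: (quadratic_integrable l0 (lexx (0 : R)) Ch0 (mh _ buh) Ls) => s _.
  by rewrite uhE normr_id add0r; have /andP[h1 h2] := hCh (- Bs (pi s)); rewrite ger0_norm.
have add f1 f2 : mu.-integrable `[t, +oo[ (EFin \o f1) ->
    mu.-integrable `[t, +oo[ (EFin \o f2) ->
    mu.-integrable `[t, +oo[ (EFin \o (fun s : R => f1 s + f2 s : R)).
  by move=> i1 i2; exact: (@integrableD _ _ R mu `[t, +oo[ mD _ _ i1 i2).
have scl (c : R) f1 : mu.-integrable `[t, +oo[ (EFin \o f1) ->
    mu.-integrable `[t, +oo[ (EFin \o (fun s : R => c * f1 s : R)).
  by move=> i1; exact: (@integrableZl _ _ R mu `[t, +oo[ mD c _ i1).
have ext f1 f2 : (forall s, f1 s = f2 s) -> mu.-integrable `[t, +oo[ (EFin \o f1) ->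
    mu.-integrable `[t, +oo[ (EFin \o f2).
  by move=> /funext ->.
have iz : mu.-integrable `[t, +oo[ (EFin \o running uh z).
  by apply: ext (add _ _ (ig z bZ LZ) ihh) => s; rewrite /running mulrDr.
have mild v w := trajectory_mild SC adj gS B_linear B_bound BsP sepV sepU two0 two0 half2
  om2 (u := v) (x := x) (y := w).
(* Optimality against [uh], whose cost is finite, bounds the cost of [u] above, and [h0 >= 0] bounds
   its running cost below by the integrable [g0] term. Integrability of the [h0 (u s)] term follows
   by difference. *)
have iy : mu.-integrable `[t, +oo[ (EFin \o running u y).
  apply: (integrable_of_lower_bound mD _ (ig y bY LY)).
  - exact: (running_cost_measurable g0S h0_lsc).
  - move=> s _; rewrite /running ler_wpM2l ?expR_ge0// lerDl.
    exact: (cost_ge0 conj0 conj_fin).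
  apply: (@le_lt_trans _ _ (cost g0 h0 lam t uh z)).
    apply: opt; first exact: ((Lweighted_Lw lam t uh p0).2 (conj buh Luh)).
    exact: (mild _ _ _ buh Luh2 tz).
  by apply: integrable_lty => //; exact: iz.
have ihu : mu.-integrable `[t, +oo[ (EFin \o (fun s : R => expR (- lam * s) * h0 (u s))).
  apply: ext (add _ _ iy (scl (-1) _ (ig y bY LY))) => s.
  by rewrite /running; lra.
(* The Fenchel-Young gap of [u s] at [- Bs (pi s)], the conjugate being written out at its maximizer
   [uh s]. *)
pose gap s := h0 (u s) - h0 (uh s) - dot (- Bs (pi s)) (u s - uh s).
have gap0 s : 0 <= gap s.
  rewrite /gap uhE; have := gradient_subdifferential h0_lsc conj_fin conjS (- Bs (pi s)) (u s).
  by lra.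
have mdot : measurable_fun `[t, +oo[ (fun s => dot (- Bs (pi s)) (u s - uh s) : R).
  apply/(borel_real _ mD).
  apply: (borel_pair (Z := R^o) (F := fun w => dot w.1 w.2) sepU sepU mD
    (@dot_continuous R U) bs).
  rewrite (_ : (fun s => u s - uh s) = (fun s => 1 *: u s + (-1) *: uh s)).
    exact: borel_combination.
  by apply/funext => s; rewrite scale1r scaleN1r.
have idot : mu.-integrable `[t, +oo[
    (EFin \o (fun s : R => expR (- lam * s) * dot (- Bs (pi s)) (u s - uh s))).
  have LL := Lw_add two0 Ls (Lw_add two0 Lu2 Luh2).
  apply: (quadratic_integrable l0 (lexx (0 : R)) ler01 mdot LL) => s _.
  rewrite add0r mul1r (le_trans (CauchySchwarz _ _))// ger0_norm ?addr_ge0//.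
  rewrite (le_trans (ler_wpM2l _ (ler_normB _ _)))// expr2.
  by rewrite ler_pM ?addr_ge0// ?lerDl ?lerDr ?addr_ge0.
have igap : mu.-integrable `[t, +oo[ (EFin \o (fun s : R => expR (- lam * s) * gap s)).
  apply: ext (add _ _ ihu (add _ _ (scl (-1) _ ihh) (scl (-1) _ idot))) => s.
  by rewrite /gap; lra.
have iQ : mu.-integrable `[t, +oo[ (EFin \o (fun s : R => expR (- lam * s) *
    (k * `|z s - y s| ^+ 2))).
  apply: (quadratic_integrable l0 (lexx (0 : R)) k0 _ Lz) => [|s _]; last first.
    by rewrite scale1r scaleN1r normr_id add0r ger0_norm// mulr_ge0// exprn_ge0.
  apply: measurable_funM => //; apply: measurable_funX.
  have := borel_norm mD (borel_combination 1 (-1) sY mD bZ bY).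
  by apply: eq_measurable_fun => s _; rewrite scale1r scaleN1r.
have key (e : R) : 0 < e -> e <= 1 ->
    \int[mu]_(s in `[t, +oo[) (expR (- lam * s) * gap s) <=
    e * \int[mu]_(s in `[t, +oo[) (expR (- lam * s) * (k * `|z s - y s| ^+ 2)).
  move=> e0 e1.
  pose v s := e *: uh s + (1 - e) *: u s; pose w s := e *: z s + (1 - e) *: y s.
  have bv : borel `[t, +oo[ v by exact: borel_combination.
  have Lv : Lw t lam p (fun s => `|v s|) by exact: (Lw_combination _ _ sepU p0).
  have tw : trajectory S S1 Bs t x v w.
    have := trajectory_combination SC adj gS B_linear B_bound BsP sepU two0 two0 half2
      om2 e (1 - e) buh Luh2 bu Lu2 tz ty.
    by rewrite -scalerDl addrC subrK scale1r.
  have bw := tb _ _ _ _ bv tw.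
  have h1 : (cost g0 h0 lam t u y <= cost g0 h0 lam t v w)%E.
    apply: opt; first exact: ((Lweighted_Lw lam t v p0).2 (conj bv Lv)).
    exact: (mild _ _ _ bv (L2 _ _ Lv) tw).
  (* Majorant of the running cost along [v]: convexity of [h0] on the segment and the descent
     inequality for [g0]. Adding and subtracting the [Bs (pi s)] term regroups the part linear in
     [e] as [phi] minus the weighted gap. *)
  pose r s := running u y s + (e * phi s + (- e * (expR (- lam * s) * gap s) +
    e ^+ 2 * (expR (- lam * s) * (k * `|z s - y s| ^+ 2)))).
  have ir : mu.-integrable `[t, +oo[ (EFin \o r).
    exact: (add _ _ iy (add _ _ (scl e _ iphi) (add _ _ (scl (- e) _ igap) (scl (e ^+ 2) _ iQ)))).
  have h2 : (cost g0 h0 lam t v w <= \int[mu]_(s in `[t, +oo[) (r s)%:E)%E.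
    apply: (integral_le_perturbed mD (phi := fun=> 0)).
    - exact: (running_cost_measurable g0S h0_lsc).
    - by apply/measurable_EFinP; exact: measurable_int ir.
    - exact: integrable0.
    - by rewrite Rintegral_cst// mul0r.
    apply: aeW => s _; rewrite addr0.
    have c1 := convexE h0_convex (uh s) (u s) (ltW e0) e1.
    have c2 := hi (y s) (w s).
    have wE : w s - y s = e *: (z s - y s).
      by rewrite /w scalerBl scale1r scalerBr addrA addrAC addrK.
    rewrite wE dual_scaleE normrZ exprMn (ger0_norm (ltW e0)) in c2.
    have -> : r s = expR (- lam * s) * (g0 (y s) + h0 (u s) + e * (
      (z s - y s) (dg0 (y s)) - dot (Bs (pi s)) (uh s - u s) - gap s) +
      e ^+ 2 * (k * `|z s - y s| ^+ 2)).
      by rewrite /r /running /phi; ring.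
    rewrite ler_wpM2l ?expR_ge0// /gap dotNl -(opprB (uh s)) dotNr opprK.
    move: c1 c2; rewrite -/(v s).
    move: (g0 (w s)) (h0 (v s)) (dot (Bs (pi s)) (uh s - u s)) => gw hv dd.
    move: ((z s - y s) (dg0 (y s)) : R) (`|z s - y s| ^+ 2) => zd zz.
    by lra.
  have := le_trans h1 h2.
  rewrite /cost -[leLHS]fineK ?integrable_fin_num// -[leRHS]fineK ?integrable_fin_num//.
  rewrite lee_fin -/(Rintegral mu _ r) -/(Rintegral mu _ (running u y)).
  rewrite /r RintegralD//; last first.
    exact: (add _ _ (scl e _ iphi) (add _ _ (scl (- e) _ igap) (scl (e ^+ 2) _ iQ))).
  rewrite RintegralD//; [|exact: scl|by apply: add; exact: scl].
  rewrite RintegralD//; [|exact: scl|exact: scl].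
  rewrite !RintegralZl// phi0.
  set I1 := Rintegral _ _ _; set I2 := Rintegral _ _ _; set I3 := Rintegral _ _ _.
  rewrite expr2 => h; rewrite -(ler_pM2l e0); move: h; lra.
pose g s := expR (- lam * s) * gap s.
have g_ge0 s : 0 <= g s by rewrite mulr_ge0 ?expR_ge0.
(* Dividing by [e] has left a bound linear in [e]; the choice below makes it at most any prescribed
   margin while keeping [e <= 1]. *)
have gR : \int[mu]_(s in `[t, +oo[) g s <= 0.
  apply/ler_addgt0Pr => e e0; rewrite add0r.
  set Q := \int[mu]_(s in `[t, +oo[) (expR (- lam * s) * (k * `|z s - y s| ^+ 2)) in key.
  have Q0 : 0 <= Q.
    by apply: Rintegral_ge0 => s _; rewrite !mulr_ge0 ?expR_ge0// exprn_ge0.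
  have Q1 : 0 < Q + 1 by rewrite ltr_wpDl.
  have d0 : 0 < Num.min 1 (e / (Q + 1)) by rewrite lt_min ltr01 divr_gt0.
  apply: (le_trans (key _ d0 _)); first by rewrite ge_min lexx.
  apply: (@le_trans _ _ (e / (Q + 1) * Q)).
    by rewrite ler_wpM2r// ge_min lexx orbT.
  by rewrite -mulrA ler_piMr ?(ltW e0)// ler_pdivrMl// mulr1 lerDl.
have I0 : (\int[mu]_(s in `[t, +oo[) `|(EFin \o g) s| = 0)%E.
  rewrite (_ : (\int[mu]_(s in _) _)%E = \int[mu]_(s in `[t, +oo[) (g s)%:E)%E; last first.
    by apply: eq_integral => s _; rewrite /= ger0_norm.
  apply/eqP; rewrite eq_le; apply/andP; split; last first.
    by apply: integral_ge0 => s _; rewrite lee_fin.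
  by rewrite -[leLHS]fineK ?integrable_fin_num// lee_fin.
have mg' : measurable_fun `[t, +oo[ (EFin \o g) by exact: measurable_int igap.
have := (ae_eq_integral_abs mu mD mg').1 I0; apply: ae_imply => s /= gs ts w.
have /eqP : g s = 0.
  by have [] : (g s)%:E = 0%E by apply: gs; rewrite in_itv/= andbT.
rewrite mulf_eq0 gt_eqF ?expR_gt0//= /gap => /eqP.
(* With zero gap, [u s] has the same value of [dot (- Bs (pi s)) - h0] as the maximizer [uh s] and
   inherits its subgradient inequality. *)
have := gradient_subdifferential h0_lsc conj_fin conjS (- Bs (pi s)) w.
by rewrite -uhE !dotBr; lra.
Qed.

Lemma optimal_costate x u y : 0 < lam ->
  Lweighted p lam t u -> mild_state S B t x u y ->
  (forall v w, Lweighted p lam t v -> mild_state S B t x v w ->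
    (cost g0 h0 lam t u y <= cost g0 h0 lam t v w)%E) ->
  exists pi, [/\ Lweighted q lam t pi, mild_costate lam S1 dg0 t y pi,
    expR ((omega - lam) * T) *: pi T @[T --> +oo] --> (0 : V) &
    {ae mu, forall s, t <= s -> subdifferential h0 (u s) (- Bs (pi s))}].
Proof.
move=> l0 /(Lweighted_Lw lam t u p0)[bu Lu] hy opt.
have ty := mild_trajectory adj BsP hy.
have L2 := Lw_exponent l0 two0 p_ge2.
have bY := trajectory_borel S1C adj gS1 beta0 B_bound BsP sepV sepU bu ty.
have LY := trajectory_Lw SC S1C adj gS gS1 B_linear beta0 B_bound BsP sepV sepU
    two0 two0 half2 om2 bu (L2 _ _ Lu) ty.
have bG := drift_borel g0S dg0P bY; have LG := drift_Lw l0 bY LY.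
have [pi hpi] := costate_choice S1C gS1 sepV two0 two0 half2 om2 bG LG.
have bpi := costate_borel S1C gS1 sepV bG hpi.
have Lpi := costate_Lw S1C gS1 sepV two0 two0 half2 om2 bG LG hpi.
have bs := Bs_pi_borel bpi.
have Ls : Lw t lam 2 (fun s => `|- Bs (pi s)|).
  apply: (Lw_le two0 _ _ (Lw_scale beta two0 Lpi)); first exact: borel_norm.
  move=> s _; rewrite normr_id normrN ger0_norm ?mulr_ge0//.
  exact: (Bs_bound beta0 B_bound BsP).
have [buh Luh] := ctrl_Lw l0 bs Ls.
have [z tz] := trajectory_exists SC adj gS B_linear B_bound BsP sepU two0 two0 half2 om2
  x buh (L2 _ _ Luh).
exists pi; split.
(* The co-state was built in [L^2_lam]; as [p >= 2] gives [q <= 2] and [lam > 0], it is also in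
   [L^q_lam]. *)
- exact: ((Lweighted_Lw lam t pi q0).2 (conj bpi (Lw_exponent l0 q0 q_le2 Lpi))).
- by move=> s ts; exact: (costate_bochner S1C gS1 sepV two0 two0 half2 om2 bG LG ts (hpi s ts)).
- exact: (costate_limit S1C gS1 sepV two0 two0 half2 om2 bG LG hpi).
- exact: (optimal_subdifferential l0 bu Lu ty buh Luh tz hpi opt).
Qed.

End MaximumPrinciple.

Theorem theorem4p5 (R : realType) (V H U : hilbertType R)
  (sepV : separable V) (sepH : separable H) (sepU : separable U)
  (i : {linear V -> H}) (i_inj : injective i) (i_cont : continuous i)
  (DA : set (dual V)) (A : dual V -> dual V) (eA : R -> dual V -> dual V)
  (omega : R) (genA : generates DA A eA)
  (eA_growth : forall (s : R) (x : dual V), 0 <= s ->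
     `|eA s x| <= expR (omega * s) * `|x|)
  (B : {linear U -> dual V}) (B_cont : continuous B)
  (g0 : dual V -> R) (g0_Sigma0 : Sigma0 g0)
  (h0 : U -> R) (h0_convex : @convex_function R U setT h0)
  (h0_lsc : lower_semicontinuous (fun u => (h0 u)%:E))
  (h0_subdiff_inj : forall u1 u2 : U, u1 <> u2 ->
     subdifferential h0 u1 `&` subdifferential h0 u2 = set0)
  (h0_conj0 : convex_conjugate h0 0 = 0%E)
  (h0_conj_fin : forall s : U, convex_conjugate h0 s \is a fin_num)
  (h0_conj_Sigma0 : Sigma0 (fun s : U => fine (convex_conjugate h0 s)))
  (a b p : R) (a_gt0 : 0 < a) (p_gt1 : 1 < p)
  (h0_growth : forall u : U, a * `|u| `^ p + b <= h0 u)
  (lam : R) (lam_omega : omega < lam)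
  (dg0 : dual V -> V) (dg0P : is_predual_derivative g0 dg0)
  (DA1 : set V) (A1 : V -> V) (A1P : is_duality_adjoint DA A DA1 A1)
  (eA1 : R -> V -> V) (genA1 : generates DA1 A1 eA1)
  (Bs : V -> U) (BsP : is_control_adjoint B Bs)
  (p_ge2 : 2 <= p) (q : R) (qE : q = p / (p - 1))
  (lam_max : Num.max (2 * omega) omega < lam)
  (t : R) (t_ge0 : 0 <= t) (x : dual V) :
  (forall (u : R -> U) (y : R -> dual V),
     admissible eA B lam p t x u y -> L1loc t y ->
     (exists pi : R -> V, Lweighted q lam t pi /\
        CO eA B h0 lam eA1 Bs dg0 omega t x u y pi) ->
     optimal eA B g0 h0 lam p t x u y)
  /\
  (2 < p /\ 0 < lam \/ [/\ p = 2, 0 < lam & omega < 0] ->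
   forall (u : R -> U) (y : R -> dual V),
     optimal eA B g0 h0 lam p t x u y ->
     exists pi : R -> V, Lweighted q lam t pi /\
       CO eA B h0 lam eA1 Bs dg0 omega t x u y pi).
Proof.
have SC := genA.1; have S1C := genA1.1.
have adj (s : R) (z : dual V) (v : V) : 0 <= s -> eA s z v = z (eA1 s v).
  exact: (adjoint_semigroup genA eA_growth A1P genA1).
have gS1 (s : R) (v : V) : 0 <= s -> `|eA1 s v| <= expR (omega * s) * `|v|.
  exact: (adjoint_growth genA eA_growth A1P genA1).
have B_linear : linear B by exact: linearP.
have [beta beta0 B_bound] := linear_continuous_bounded B_linear B_cont.
have p1 : 0 < p - 1 by rewrite subr_gt0.
have q0 : 0 < q by rewrite qE divr_gt0// (lt_trans _ p_gt1).
have pq : p^-1 + q^-1 = 1.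
  by rewrite qE; field; rewrite !gt_eqF// (lt_trans _ p_gt1).
have om2 : omega * 2 < lam.
  by rewrite mulrC (le_lt_trans _ lam_max)// le_max lexx.
split=> [u y [Lu hy] _ [pi [Lpi [_ hpi _ sub]]]|hyp u y [[Lu hy] opt]].
  split=> // v z [Lv hz].
  exact: (costate_optimal SC S1C adj eA_growth gS1 B_linear (ltW beta0) B_bound BsP
    sepV sepU g0_Sigma0 dg0P h0_lsc h0_conj_fin h0_conj_Sigma0 p_ge2 q0 pq lam_omega
    om2 t_ge0 Lu hy Lpi hpi sub Lv hz).
have l0 : 0 < lam by case: hyp => [[]|[]].
have [|pi [Lpi hpi lim sub]] := optimal_costate SC S1C adj eA_growth gS1 B_linear
  (ltW beta0) B_bound BsP sepV sepU g0_Sigma0 dg0P h0_convex h0_lsc h0_conj0 h0_conj_fin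
  h0_conj_Sigma0 p_ge2 q0 pq a_gt0 h0_growth om2 l0 Lu hy.
  by move=> v w Lv hw; exact: opt.
by exists pi.
Qed.
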